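(* Assume the network assumption, the stochastic gradient assumption, the unbiased compressor assumption (with parameter $C>0$) and the smoothness assumption (with constant $L$) stated in the context. Let $\alpha,\gamma>0$ satisfy $$\gamma\le\min\left\{\frac12,\frac{\alpha^2(1-\lambda_2)}{15872\,C},\frac{\alpha}{2}\right\},\qquad \alpha\le\frac{1}{4(C+1)},$$ let $\Delta_0=f(\bar x_{-1})-f^{\inf}$, and run CEDAS with the constant stepsize $$\eta_k=\eta=\frac{1}{\sqrt{\frac{L\sigma^2K}{n\Delta_0}}+\frac{32L}{\gamma(1-\lambda_2)}}.$$ Then $$\frac1K\sum_{k=-1}^{K-2}\mathbb{E}\left[\|\nabla f(\bar x_k)\|^2\right]=\mathcal{O}\left(\frac{1}{\sqrt{nK}}+\frac{n}{(1-\tilde\lambda_2)K}+\frac{\|\mathbf{x}_{-1}\|^2+\|H_0\|^2}{n(1-\tilde\lambda_2)K}+\frac{\|\nabla F(\mathbf{x}_{-1})\|^2}{(1-\tilde\lambda_2)^2K^2}\right).$$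
   Context: Notation. There are $n\ge2$ agents; $f_i:\mathbb{R}^p\to\mathbb{R}$ is differentiable, $f=\frac1n\sum_{i=1}^nf_i$, and $f^{\inf}=\inf_{x\in\mathbb{R}^p}f(x)$ (finite). For $\mathbf{x}\in\mathbb{R}^{n\times p}$ with $i$-th row $x_i^\top$, $\bar x=\frac1n\sum_ix_i$, and $\nabla F(\mathbf{x})\in\mathbb{R}^{n\times p}$ has $i$-th row $\nabla f_i(x_i)^\top$. $\mathbf{1}\in\mathbb{R}^n$ is the all-ones vector. $\|\cdot\|$ is the Euclidean norm of vectors and the Frobenius norm of matrices. $\mathcal{O}(\cdot)$ hides factors independent of $n$, $1-\lambda_2$, $K$ and all other quantities displayed in the bound (they may depend on e.g. $L,\sigma,\Delta_0$). Network assumption. The communication graph on the agents is undirected and connected; $W=(w_{ij})\in\mathbb{R}^{n\times n}$ is symmetric, entrywise nonnegative, positive semidefinite, $W\mathbf{1}=\mathbf{1}$, and for $i\ne j$ one has $w_{ij}=w_{ji}>0$ if $i,j$ are linked and $w_{ij}=w_{ji}=0$ otherwise. Its eigenvalues are $1=\lambda_1>\lambda_2\ge\cdots\ge\lambda_n\ge0$; $\tilde\lambda_2=1-\frac\gamma2(1-\lambda_2)$. CEDAS. Given stepsizes $\eta_k>0$ ($k\ge-1$), parameters $\alpha,\gamma>0$, a (possibly random) compression operator $\mathcal{C}:\mathbb{R}^p\to\mathbb{R}^p$ applied row by row, and deterministic $\mathbf{x}_{-1},H_0\in\mathbb{R}^{n\times p}$, set $D_0=0$, $\mathbf{x}_0=\mathbf{x}_{-1}-\eta_{-1}G_{-1}$,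 and for $k\ge0$: $\mathbf{y}_k=\mathbf{x}_k-\eta_kG_k-D_k$; $Q_k=\mathcal{C}(\mathbf{y}_k-H_k)$; $D_{k+1}=D_k+\frac\gamma2(I-W)(H_k+Q_k)$; $H_{k+1}=H_k+\alpha Q_k$; $\mathbf{x}_{k+1}=\mathbf{x}_k-\eta_kG_k-D_{k+1}$. Here $G_k$ has rows $g_{i,k}^\top$ with $g_{i,k}=\nabla f_i(x_{i,k};\xi_{i,k})$ the stochastic gradient, and $x_{i,k}^\top$ is the $i$-th row of $\mathbf{x}_k$. Stochastic gradient assumption. For all $k\ge-1$, conditionally on all randomness generated before the samples $\xi_{1,k},\dots,\xi_{n,k}$ are drawn, these samples are independent across $i$, $g_{i,k}$ has mean $\nabla f_i(x_{i,k})$, and $\|g_{i,k}-\nabla f_i(x_{i,k})\|^2$ has expectation at most $\sigma^2$ ($\sigma>0$). Unbiased compressor assumption. $\mathbb{E}[\mathcal{C}(x)\mid x]=x$ and $\mathbb{E}[\|\mathcal{C}(x)-x\|^2\mid x]\le C\|x\|^2$ for all $x\in\mathbb{R}^p$, with $C>0$; at each use these hold conditionally on all randomness preceding the compression. Smoothness assumption. Each $\nabla f_i$ is $L$-Lipschitz. *)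

(* Defs.v *)
From HB Require Import structures.
From mathcomp Require Import all_boot all_order all_algebra.
From mathcomp Require Import all_classical all_reals all_analysis.

Set Implicit Arguments.
Unset Strict Implicit.
Unset Printing Implicit Defensive.

Import Order.TTheory GRing.Theory Num.Theory.
Import numFieldNormedType.Exports.

Local Open Scope classical_set_scope.
Local Open Scope ring_scope.

(* Frobenius norm, which on row vectors is the Euclidean norm; the library norm
   on matrices is the entrywise maximum. *)
Definition fnorm (R : realType) (m n : nat) (A : 'M[R]_(m, n)) : R :=
  Num.sqrt (\sum_(i < m) \sum_(j < n) A i j ^+ 2).

Definition grad (R : realType) (p : nat) (f : 'rV[R]_p -> R) (x : 'rV[R]_p) :
  'rV[R]_p := \row_(j < p) 'D_(delta_mx 0 j) f x.

Definition avg_fun (R : realType) (n p : nat) (f : 'I_n -> 'rV[R]_p -> R)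
  (x : 'rV[R]_p) : R := n%:R^-1 * \sum_(i < n) f i x.

Definition row_mean (R : realType) (n p : nat) (x : 'M[R]_(n, p)) : 'rV[R]_p :=
  n%:R^-1 *: \sum_(i < n) row i x.

Definition rowwise (R : realType) (n p : nat)
    (h : 'I_n -> 'rV[R]_p -> 'rV[R]_p) (x : 'M[R]_(n, p)) : 'M[R]_(n, p) :=
  \matrix_(i < n) h i (row i x).

Definition lipschitz_gradient (R : realType) (p : nat) (L : R)
    (f : 'rV[R]_p -> R) : Prop :=
  (forall x, differentiable f x) /\
  (forall x y, fnorm (grad f x - grad f y) <= L * fnorm (x - y)).

(* [lam] lists the eigenvalues of [W] with multiplicity in nonincreasing order;
   [lam`_0] is the first eigenvalue, [lam`_1] the second. *)
Record network_assumption (R : realType) (n : nat) (link : rel 'I_n)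
    (W : 'M[R]_n) (lam : n.-tuple R) : Prop := NetworkAssumption {
  link_irr : irreflexive link;
  link_sym : symmetric link;
  link_connected : forall i j, connect link i j;
  mix_sym : W^T = W;
  mix_ge0 : forall i j, 0 <= W i j;
  mix_psd : forall v : 'cV[R]_n, 0 <= (v^T *m W *m v) 0 0;
  mix_ones : W *m (const_mx 1 : 'cV[R]_n) = const_mx 1;
  mix_linked : forall i j, i != j -> link i j -> 0 < W i j;
  mix_unlinked : forall i j, i != j -> ~~ link i j -> W i j = 0;
  eig_char : char_poly W = \prod_(l <- lam) ('X - l%:P);
  eig_sorted : sorted (fun a b : R => b <= a) lam;
  eig_first : lam`_0 = 1;
  eig_second : lam`_1 < 1;
  eig_ge0 : forall l, l \in lam -> 0 <= l
}.

Definition lambda_tilde2 (R : realType) (gamma lambda2 : R) : R :=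
  1 - gamma / 2 * (1 - lambda2).

Record cedas_state (R : realType) (n p : nat) := CedasState {
  st_x : 'M[R]_(n, p);
  st_D : 'M[R]_(n, p);
  st_H : 'M[R]_(n, p)
}.

Definition cedas_step (R : realType) (n p : nat) (W : 'M[R]_n)
    (alpha gamma eta : R) (sgrad compress : 'M[R]_(n, p) -> 'M[R]_(n, p))
    (s : cedas_state R n p) : cedas_state R n p :=
  let G := sgrad (st_x s) in
  let y := st_x s - eta *: G - st_D s in
  let Q := compress (y - st_H s) in
  let D := st_D s + (gamma / 2) *: ((1%:M - W) *m (st_H s + Q)) in
  CedasState (st_x s - eta *: G - D) D (st_H s + alpha *: Q).

(* In everything that follows the time index is shifted by one: index [t] stands
   for iteration [k = t - 1], so that [t = 0] is [k = -1].  The exception is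
   [cedas_run], whose value at [k] is the state (x_k, D_k, H_k) for [k >= 0]. *)
Fixpoint cedas_run (R : realType) (n p : nat) (W : 'M[R]_n) (alpha gamma : R)
    (eta : nat -> R) (sgrad compress : nat -> 'M[R]_(n, p) -> 'M[R]_(n, p))
    (xm1 H0 : 'M[R]_(n, p)) (k : nat) : cedas_state R n p :=
  if k is k'.+1 then
    cedas_step W alpha gamma (eta k) (sgrad k) (compress k)
      (cedas_run W alpha gamma eta sgrad compress xm1 H0 k')
  else CedasState (xm1 - eta 0 *: sgrad 0 xm1) 0 H0.

Definition cedas_x (R : realType) (n p : nat) (W : 'M[R]_n) (alpha gamma : R)
    (eta : nat -> R) (sgrad compress : nat -> 'M[R]_(n, p) -> 'M[R]_(n, p))
    (xm1 H0 : 'M[R]_(n, p)) (t : nat) : 'M[R]_(n, p) :=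
  if t is k.+1 then
    st_x (cedas_run W alpha gamma eta sgrad compress xm1 H0 k)
  else xm1.

Definition cedas_process (R : realType) (n p : nat) (T Xi Theta : Type)
    (W : 'M[R]_n) (alpha gamma : R) (eta : nat -> R)
    (oracle : 'I_n -> 'rV[R]_p -> Xi -> 'rV[R]_p)
    (comp : Theta -> 'rV[R]_p -> 'rV[R]_p)
    (xi : nat -> 'I_n -> T -> Xi) (theta : nat -> 'I_n -> T -> Theta)
    (xm1 H0 : 'M[R]_(n, p)) (t : nat) (w : T) : 'M[R]_(n, p) :=
  cedas_x W alpha gamma eta
    (fun s => rowwise (fun i v => oracle i v (xi s i w)))
    (fun s => rowwise (fun i v => comp (theta s i w) v))
    xm1 H0 t.

Definition borel_rV (R : realType) (p : nat) :=
  g_sigma_algebraType (@open 'rV[R]_p).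

Definition sub_sigma_algebra (d : measure_display) (T : measurableType d)
    (F : set (set T)) : Prop :=
  sigma_algebra setT F /\ F `<=` measurable.

Definition measurable_wrt (T : Type) (F : set (set T)) (d : measure_display)
    (U : measurableType d) (X : T -> U) : Prop :=
  forall B : set U, measurable B -> F (X @^-1` B).

(* [Y] is a version of the conditional expectation of [X] given [F]. *)
Definition is_cond_exp (R : realType) (d : measure_display)
    (T : measurableType d) (P : probability T R) (F : set (set T))
    (X Y : T -> R) : Prop :=
  [/\ P.-integrable setT (EFin \o X),
      P.-integrable setT (EFin \o Y),
      measurable_wrt F Y &
      forall A, F A ->
        (\int[P]_(w in A) (X w)%:E = \int[P]_(w in A) (Y w)%:E)%E].

Definition is_cond_exp_rV (R : realType) (d : measure_display)
    (T : measurableType d) (P : probability T R) (F : set (set T)) (p : nat)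
    (X Y : T -> 'rV[R]_p) : Prop :=
  forall j : 'I_p, is_cond_exp P F (fun w => X w 0 j) (fun w => Y w 0 j).

Definition cond_exp_le (R : realType) (d : measure_display)
    (T : measurableType d) (P : probability T R) (F : set (set T))
    (X B : T -> R) : Prop :=
  exists Y : T -> R,
    is_cond_exp P F X Y /\ {ae P, forall w, Y w <= B w}.

(* Mutual conditional independence given [F]: the product rule for conditional
   probabilities; subfamilies are covered by taking some [A i] to be [setT]. *)
Definition cond_independent (R : realType) (d : measure_display)
    (T : measurableType d) (P : probability T R) (F : set (set T))
    (n : nat) (dU : measure_display) (U : measurableType dU)
    (X : 'I_n -> T -> U) : Prop :=
  forall A : 'I_n -> set U, (forall i, measurable (A i)) ->
    exists Z : 'I_n -> T -> R,
      (forall i, is_cond_exp P F (\1_(X i @^-1` A i)) (Z i)) /\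
      is_cond_exp P F (\1_[set w | forall i, A i (X i w)])
        (fun w => \prod_(i < n) Z i w).

(* [Fs t] is the information available just before the samples of time [t] are
   drawn, [Fc t] the information available just after that, hence just before
   the compression of time [t].  No compression takes place at [t = 0]. *)
Record cedas_filtration (d : measure_display) (T : measurableType d) (n : nat)
    (dX : measure_display) (Xi : measurableType dX)
    (dT : measure_display) (Theta : measurableType dT)
    (xi : nat -> 'I_n -> T -> Xi) (theta : nat -> 'I_n -> T -> Theta)
    (Fs Fc : nat -> set (set T)) : Prop := CedasFiltration {
  Fs_sub : forall t, sub_sigma_algebra (Fs t);
  Fc_sub : forall t, sub_sigma_algebra (Fc t);
  Fs_Fc : forall t, Fs t `<=` Fc t;
  Fc_Fs : forall t, Fc t `<=` Fs t.+1;
  xi_adapted : forall t i, measurable_wrt (Fc t) (xi t i);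
  theta_adapted : forall t i, measurable_wrt (Fs t.+2) (theta t.+1 i)
}.

Record stochastic_gradient_assumption (R : realType) (d : measure_display)
    (T : measurableType d) (P : probability T R) (n p : nat)
    (dX : measure_display) (Xi : measurableType dX)
    (f : 'I_n -> 'rV[R]_p -> R) (oracle : 'I_n -> 'rV[R]_p -> Xi -> 'rV[R]_p)
    (xi : nat -> 'I_n -> T -> Xi) (Fs : nat -> set (set T))
    (x : nat -> T -> 'M[R]_(n, p)) (sigma : R) : Prop :=
  StochasticGradientAssumption {
  sg_measurable : forall i,
    measurable_fun [set: borel_rV R p * Xi]
      (fun z => oracle i z.1 z.2 : borel_rV R p);
  sg_indep : forall t, cond_independent P (Fs t) (xi t);
  sg_mean : forall t i,
    is_cond_exp_rV P (Fs t) (fun w => oracle i (row i (x t w)) (xi t i w))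
                            (fun w => grad (f i) (row i (x t w)));
  sg_var : forall t i,
    cond_exp_le P (Fs t)
      (fun w => fnorm (oracle i (row i (x t w)) (xi t i w)
                       - grad (f i) (row i (x t w))) ^+ 2)
      (fun=> sigma ^+ 2)
}.

(* The argument [X] ranges over all square-integrable random vectors known
   before the compression; this covers both deterministic vectors and the
   vectors which the algorithm actually compresses. *)
Record unbiased_compressor_assumption (R : realType) (d : measure_display)
    (T : measurableType d) (P : probability T R) (n p : nat)
    (dT : measure_display) (Theta : measurableType dT)
    (comp : Theta -> 'rV[R]_p -> 'rV[R]_p)
    (theta : nat -> 'I_n -> T -> Theta) (Fc : nat -> set (set T)) (C : R) :
    Prop := UnbiasedCompressorAssumption {
  comp_measurable :
    measurable_fun [set: Theta * borel_rV R p]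
      (fun z => comp z.1 z.2 : borel_rV R p);
  comp_unbiased : forall t i (X : T -> 'rV[R]_p),
    measurable_wrt (Fc t.+1) (X : T -> borel_rV R p) ->
    P.-integrable setT (fun w => (fnorm (X w) ^+ 2)%:E) ->
    is_cond_exp_rV P (Fc t.+1) (fun w => comp (theta t.+1 i w) (X w)) X;
  comp_var : forall t i (X : T -> 'rV[R]_p),
    measurable_wrt (Fc t.+1) (X : T -> borel_rV R p) ->
    P.-integrable setT (fun w => (fnorm (X w) ^+ 2)%:E) ->
    cond_exp_le P (Fc t.+1)
      (fun w => fnorm (comp (theta t.+1 i w) (X w) - X w) ^+ 2)
      (fun w => C * fnorm (X w) ^+ 2)
}.

(* Main.v *)
Require Import Defs.
From HB Require Import structures.
From mathcomp Require Import all_boot all_order all_algebra.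
From mathcomp Require Import ring lra.

Set Implicit Arguments.
Unset Strict Implicit.
Unset Printing Implicit Defensive.

Import Order.TTheory GRing.Theory Num.Theory.

Local Open Scope ring_scope.

(** Write [J] for the averaging of the rows and [M = (gamma / 2) (I - W)].  The
    variable [D_k] of CEDAS is [M U_k] with [U_(k+1) = U_k + y_k + e_k], where
    [e_k] is the compression error, so that CEDAS is a primal-dual method for
    minimizing the sum of the [f_i] under the constraint [M x = 0], disturbed by
    the gradient noise [z_k] and by [e_k].  All random matrices are regarded as
    vectors of the space of square-integrable random matrices, with
    [<X, Y> = E tr (X^T Y)].  There the assumptions on conditional means become
    orthogonality relations: the noise is orthogonal to everything that is known
    before it is drawn.  The convergence proof uses nothing else about
    probability, and is carried out in an arbitrary semi-inner-product space.

    Disagreement.  Three quantities are followed: the deviation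
    [a = x - J x]; the dual error [u], which is the balanced part of [U]
    corrected by [M^-1 s], where [s = eta (I - J) grad F (J x)] is what [- M U]
    has to equal for the agents to stay together; and the compression gap
    [y - H].  Without disturbances [(a, u)] becomes
    [((I - M)(a - M u), u + a - M u)], and the energy
    [|a|^2 + <u, M u> - |M u|^2] shrinks by the factor [1 - 3 g / 4], where
    [g = (gamma / 2)(1 - lambda2)] is the gap of [M] ([energy_step]).  The
    noises add their own energy, the drift of [s] and the inexactness of the
    gradients are small because [16 L eta <= g] ([energy_next]).  The compression
    error costs [b C |y - H|^2] with [b = gamma / 2], while [|y - H|^2] contracts
    by [1 - alpha] up to the motion of [y] ([comp_gap_next]).  A weighted sum of
    energy and gap is a Lyapunov function because [b C] is small compared with
    [alpha^2 (1 - lambda2)] ([lyapunov_next]), and the sum of the energies over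
    the run is bounded ([energy_sum_le]).

    Optimization.  The mean of the rows performs gradient descent with the
    averaged stochastic gradient, whose noise has variance [sigma^2 / n] because
    the samples of different agents are conditionally independent.  The descent
    inequality for the averaged objective loses only [L^2 |x - J x|^2] to the
    disagreement, and summing it over the run bounds the sum of the squared
    gradients at the mean ([descent_sum]).  Inserting the stepsize gives the rate
    ([rate_of_sum]).

    Two facts link this to the hypotheses.  The second entry of the list of
    eigenvalues bounds the quadratic form of [W] on vectors of zero sum
    ([eig_second_bound]); and conditional independence together with zero
    conditional mean makes the noises of two agents orthogonal
    ([cond_indep_orth]), although these noises depend on the samples and on the
    past jointly. *)

(** * Semi-inner products and mixing operators *)

(** Definiteness is left out: random matrices that agree almost surely are at
    distance zero without being equal. *)
Record semi_inner (R : realFieldType) (V : lmodType R) (dot : V -> V -> R) : Prop :=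
  SemiInner {
  dotC : forall x y, dot x y = dot y x;
  dotDl : forall x y z, dot (x + y) z = dot x z + dot y z;
  dotZl : forall (c : R) (x y : V), dot (c *: x) y = c * dot x y;
  dot_ge0 : forall x, 0 <= dot x x
}.

Section SemiInnerTheory.
Variables (R : realFieldType) (V : lmodType R) (dot : V -> V -> R).
Hypothesis D : semi_inner dot.

Lemma dotDr x y z : dot x (y + z) = dot x y + dot x z.
Proof. by rewrite (dotC D) (dotDl D) !(dotC D x). Qed.

Lemma dotZr (c : R) x y : dot x (c *: y) = c * dot x y.
Proof. by rewrite (dotC D) (dotZl D) (dotC D). Qed.

Lemma dotNl x y : dot (- x) y = - dot x y.
Proof. by rewrite -scaleN1r (dotZl D) mulN1r. Qed.

Lemma dotNr x y : dot x (- y) = - dot x y.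
Proof. by rewrite (dotC D) dotNl (dotC D). Qed.

Lemma dot0l x : dot 0 x = 0.
Proof. by rewrite -(scale0r 0) (dotZl D) mul0r. Qed.

Lemma dot0r x : dot x 0 = 0.
Proof. by rewrite (dotC D) dot0l. Qed.

Definition dotE := (dotDl D, dotDr, dotNl, dotNr, dotZl D, dotZr).

Lemma dot_young (e : R) x y : 0 < e ->
  dot (x + y) (x + y) <= (1 + e) * dot x x + (1 + e^-1) * dot y y.
Proof.
move=> e0.
have : 0 <= e^-1 * dot (e *: x - y) (e *: x - y).
  by apply: mulr_ge0; [rewrite invr_ge0 ltW|exact: dot_ge0 D _].
have -> : e^-1 * dot (e *: x - y) (e *: x - y)
  = e * dot x x - 2 * dot x y + e^-1 * dot y y.
  by rewrite !dotE (dotC D y x); field; rewrite gt_eqF.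
by rewrite !dotE (dotC D y x); lra.
Qed.

Lemma dot_sum2 x y : dot (x + y) (x + y) <= 2 * dot x x + 2 * dot y y.
Proof. by have := @dot_young 1 x y ltr01; rewrite invr1; lra. Qed.

End SemiInnerTheory.

(** What the proof needs to know about the network: [J] is the orthogonal
    projection onto consensus, [M] is a nonnegative self-adjoint operator that is
    zero on consensus, is bounded by [b] and has gap [g] above zero, and [Minv]
    inverts it on the kernel of [J]. *)
Record mixing_operators (R : realFieldType) (V : lmodType R) (dot : V -> V -> R)
    (b g : R) (M J Minv : {linear V -> V}) : Prop := MixingOperators {
  mixC : forall x y, dot (M x) y = dot x (M y);
  meanC : forall x y, dot (J x) y = dot x (J y);
  mean_idem : forall x, J (J x) = J x;
  mix_mean : forall x, M (J x) = 0;
  mean_mix : forall x, J (M x) = 0;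
  mix_dot_ge0 : forall x, 0 <= dot x (M x);
  mix_dot_le : forall x, dot x (M x) <= b * dot x x;
  mix_dot_gap : forall x, J x = 0 -> g * dot x x <= dot x (M x);
  mix_invK : forall x, J x = 0 -> M (Minv x) = x;
  mean_inv : forall x, J x = 0 -> J (Minv x) = 0
}.

Section Energy.
Variables (R : realFieldType) (V : lmodType R) (dot : V -> V -> R).
Hypothesis D : semi_inner dot.
Variables (b g : R) (M J Minv : {linear V -> V}).
Hypothesis mix : mixing_operators dot b g M J Minv.
Hypotheses (g_gt0 : 0 < g) (g_le_b : g <= b) (b_le : b <= 4^-1).

Let dE := (linearD, linearN, linearB, dotE D).

(** The operator inequality [M^2 <= b M]; testing the positivity of [M] on
    [b x - M x] replaces the square root of [M]. *)
Lemma mix_sq_le x : dot (M x) (M x) <= b * dot x (M x).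
Proof.
have h1 := mix_dot_le mix (M x).
have h2 := mix_dot_ge0 mix (b *: x - M x).
have h : 0 <= b * (b * dot x (M x) - dot (M x) (M x)).
  by move: h2 h1; rewrite !(linearB, linearZ) /= !dE -(mixC mix x (M x)); lra.
have b0 : 0 < b := lt_le_trans g_gt0 g_le_b.
by move: h; rewrite pmulr_rge0 // subr_ge0.
Qed.

Lemma mix_sq_ge x : J x = 0 -> g * dot x (M x) <= dot (M x) (M x).
Proof.
move=> Jx; have h1 := mix_dot_gap mix Jx.
have := dot_ge0 D (M x - g *: x); rewrite !dE (mixC mix x x).
by have := ler_wpM2l (ltW g_gt0) h1; lra.
Qed.

(** On a pair (primal deviation, dual error) the weight of the dual error is
    [M - M^2]: it is the one for which the cross terms of the error-free step
    cancel. *)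
Definition qdot (z z' : V * V) : R :=
  dot z.1 z'.1 + dot z.2 (M z'.2) - dot (M z.2) (M z'.2).

(** Nonnegativity comes from [M^2 <= b M <= M]. *)
Lemma qdot_semi_inner : semi_inner qdot.
Proof.
split; rewrite /qdot.
- move=> x y; rewrite (dotC D x.1) (dotC D x.2) (mixC mix) (dotC D (M x.2)).
  by [].
- by move=> x y z /=; rewrite !dE; ring.
- by move=> c x y; rewrite /= !linearZ !dE; ring.
- move=> x; have := dot_ge0 D x.1; have := mix_sq_le x.2.
  have h := mix_dot_ge0 mix x.2.
  by have : b * dot x.2 (M x.2) <= 1 * dot x.2 (M x.2);
    [rewrite ler_wpM2r//; have := b_le; lra|lra].
Qed.

Lemma qdotE z : qdot z z = dot z.1 z.1 + (dot z.2 (M z.2) - dot (M z.2) (M z.2)).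
Proof. by rewrite /qdot; ring. Qed.

Lemma qdot_mix u : dot u (M u) <= 4 / 3 * (dot u (M u) - dot (M u) (M u)).
Proof.
have h := mix_dot_ge0 mix u; have h2 := mix_sq_le u.
by have : b * dot u (M u) <= 4^-1 * dot u (M u); [rewrite ler_wpM2r|lra].
Qed.

(** The effect on the next error pair of adding [w] to [y]: the iterate receives
    [w - M w], the accumulated dual variable receives [w]. *)
Definition impulse (w : V) : V * V := (w - M w, w).

Lemma impulse_le w : qdot (impulse w) (impulse w) <= dot w w.
Proof.
have h := mix_dot_ge0 mix w.
by rewrite /qdot /= !dE (mixC mix w w); lra.
Qed.

Lemma qdot_impulse z w :
  qdot z (impulse w) = dot (z.1 - M z.1 + M z.2 - M (M z.2)) w.
Proof. by rewrite /qdot /= !dE -!(mixC mix); ring. Qed.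

(** The error-free step sends [(a, u)] to [(0, u) + impulse (a - M u)], whose
    energy is exactly [<a, (1 - M) a> + <u, M (1 - M)^2 u>].  The gap of [M]
    gives the factor [1 - g] on [a].  On [u], [M^3 <= M^2 / 4] and [g M <= M^2]
    give [M (1 - M)^2 <= (1 - 3 g / 4) (M - M^2)]. *)
Lemma energy_step a u : J a = 0 -> J u = 0 ->
  qdot ((0, u) + impulse (a - M u)) ((0, u) + impulse (a - M u)) <=
  (1 - 3 / 4 * g) * qdot (a, u) (a, u).
Proof.
move=> Ja Ju.
have ha := mix_dot_gap mix Ja.
have hu := mix_sq_ge Ju.
have h3 := mix_dot_le mix (M u).
have h4 := dot_ge0 D (M u); have h5 := dot_ge0 D a.
have e1 : qdot ((0, u) + impulse (a - M u)) ((0, u) + impulse (a - M u))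
  = dot a a - dot a (M a)
    + (dot u (M u) - 2 * dot (M u) (M u) + dot (M u) (M (M u))).
  rewrite /qdot /= !add0r !dE.
  rewrite -!(mixC mix u) !(dotC D (M u) a) (dotC D (M (M u)) a).
  rewrite !(dotC D (M u) (M a)) (dotC D (M (M u)) (M u)).
  by rewrite (dotC D (M (M u)) (M a)) -!(mixC mix a); ring.
rewrite e1 qdotE /=.
have : b * dot (M u) (M u) <= 4^-1 * dot (M u) (M u) by rewrite ler_wpM2r.
have := ler_wpM2l (ltW g_gt0) h4; have := ler_wpM2l (ltW g_gt0) h5.
by lra.
Qed.

End Energy.

(** * Deciding linear identities between vectors *)

Inductive vexpr (R : Type) :=
  | VAtom of nat | VZero | VAdd of vexpr R & vexpr R | VOpp of vexpr R
  | VScale of R & vexpr R.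

Section ModuleIdentities.
Variables (R : realFieldType) (V : lmodType R).

Fixpoint veval (env : seq V) (e : vexpr R) : V :=
  match e with
  | VAtom i => nth 0 env i
  | VZero => 0
  | VAdd e1 e2 => veval env e1 + veval env e2
  | VOpp e1 => - veval env e1
  | VScale c e1 => c *: veval env e1
  end.

Fixpoint vcoef (e : vexpr R) (i : nat) : R :=
  match e with
  | VAtom j => if eqn i j then 1 else 0
  | VZero => 0
  | VAdd e1 e2 => vcoef e1 i + vcoef e2 i
  | VOpp e1 => - vcoef e1 i
  | VScale c e1 => c * vcoef e1 i
  end.

Lemma veval_coef (env : seq V) e :
  veval env e = \sum_(i < size env) vcoef e i *: nth 0 env i.
Proof.
elim: e => [j||e1 IH1 e2 IH2|e1 IH1|c e1 IH1] /=.
- have [jlt|jge] := ltnP j (size env).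
    rewrite (bigD1 (Ordinal jlt)) //= !eqnE eqxx scale1r big1 ?addr0 // => i ne.
    by rewrite ifN ?scale0r.
  rewrite nth_default // big1 // => i _.
  by rewrite eqnE ltn_eqF ?scale0r // (leq_trans _ jge).
- by rewrite big1 // => i _; rewrite scale0r.
- by rewrite IH1 IH2 -big_split; apply: eq_bigr => i _; rewrite scalerDl.
- by rewrite IH1 -sumrN; apply: eq_bigr => i _; rewrite scaleNr.
- by rewrite IH1 scaler_sumr; apply: eq_bigr => i _; rewrite scalerA.
Qed.

Fixpoint vcoef_eq (n : nat) (e1 e2 : vexpr R) : Prop :=
  if n is m.+1 then vcoef_eq m e1 e2 /\ vcoef e1 m = vcoef e2 m else True.

(** A linear identity between vectors holds if every vector has the same
    coefficient on both sides; this leaves identities between scalars, which are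
    left to [ring]. *)
Lemma veval_eq (env : seq V) e1 e2 :
  vcoef_eq (size env) e1 e2 -> veval env e1 = veval env e2.
Proof.
move=> h; rewrite !veval_coef; apply: eq_bigr => i _; congr (_ *: _).
move: h (ltn_ord i) => /[swap]; move: (nat_of_ord i) => {}i.
elim: (size env) => //= n IH; rewrite ltnS leq_eqVlt => /orP[/eqP ->|/IH h].
  by case.
by case=> /h.
Qed.

End ModuleIdentities.

Ltac vindex x env :=
  lazymatch env with
  | x :: _ => constr:(0%N)
  | _ :: ?t => let i := vindex x t in constr:(S i)
  end.

Ltac vadd x env :=
  lazymatch env with
  | context [x :: _] => env
  | _ => constr:(x :: env)
  end.

Ltac vatoms e env :=
  lazymatch e with
  | 0 => env
  | ?a + ?b => let env1 := vatoms a env in vatoms b env1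
  | - ?a => vatoms a env
  | ?c *: ?a => vatoms a env
  | ?x => vadd x env
  end.

Ltac vreify R e env :=
  lazymatch e with
  | 0 => constr:(VZero R)
  | ?a + ?b => let u := vreify R a env in let v := vreify R b env in
      constr:(VAdd u v)
  | - ?a => let u := vreify R a env in constr:(VOpp u)
  | ?c *: ?a => let u := vreify R a env in constr:(VScale (c : R) u)
  | ?x => let i := vindex x env in constr:(VAtom R i)
  end.

Ltac module_eq :=
  lazymatch goal with
  | |- ?l = ?r :> ?T =>
    lazymatch type of l with
    | _ =>
    let R := lazymatch goal with S : realFieldType |- _ => S end in
    let env0 := constr:(@nil T) in
    let env1 := vatoms l env0 in
    let env := vatoms r env1 in
    let u := vreify R l env in
    let v := vreify R r env in
    apply: (@veval_eq _ _ env u v); cbn; repeat split; ring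
    end
  end.

(** * The disturbed primal-dual recursion *)

(** The trace of a sigma-algebra on the space of random matrices: what is known
    at a given time is stable under every operation of the recursion. *)
Record information_class (R : realFieldType) (V : lmodType R)
    (M J Minv : {linear V -> V}) (gF : V -> V) (S : V -> Prop) : Prop :=
  InformationClass {
  infoD : forall x y, S x -> S y -> S (x + y);
  infoZ : forall c x, S x -> S (c *: x);
  infoM : forall x, S x -> S (M x);
  infoJ : forall x, S x -> S (J x);
  infoI : forall x, S x -> S (Minv x);
  infoG : forall x, S x -> S (gF x)
}.

Lemma linE (R : realFieldType) (V : lmodType R) (f : {linear V -> V}) :
  (forall v w, f (v + w) = f v + f w) * (forall v, f (- v) = - f v) *
  (forall c v, f (c *: v) = c *: f v).
Proof. by do !split; move=> *; rewrite ?linearD ?linearN ?linearZ. Qed.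

Section Recursion.
Variables (R : realFieldType) (V : lmodType R) (dot : V -> V -> R).
Variables (b g : R) (M J Minv : {linear V -> V}) (gF : V -> V).
Variables (L eta alpha C s2 nn delta : R).
Variables (x z U H y e : nat -> V) (Fs Fc : nat -> V -> Prop).

(** In the application [b = gamma / 2], [delta = 1 - lambda2], [g] is the gap of
    [M], [nn] the number of agents and [s2] the variance of one stochastic
    gradient.  The field [rec_bC] is the smallness of [gamma] with respect to
    [alpha^2 (1 - lambda2) / C]; it makes the feedback of the compression gap on
    itself negligible. *)
Record cedas_parameters : Prop := CedasParameters {
  rec_g_gt0 : 0 < g;
  rec_b : b <= 4^-1;
  rec_g : g = b * delta;
  rec_delta : 0 < delta <= 1;
  rec_nn : 1 <= nn;
  rec_s2 : 0 <= s2;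
  rec_C : 0 < C;
  rec_alpha : 0 < alpha <= 4^-1;
  rec_alphaC : alpha * C <= 4^-1;
  rec_bC : 100 * (100 * (b * C)) <= alpha ^+ 2 * delta;
  rec_eta : 0 < eta;
  rec_L : 0 < L;
  rec_etaL : 16 * (L * eta) <= g
}.

(** [z] is the gradient noise and [e] the compression error; [M (U k)] is the
    variable [D_k]. *)
Record cedas_dynamics : Prop := CedasDynamics {
  rec_y : forall k, y k = x k - eta *: (gF (x k) + z k) - M (U k);
  rec_U : forall k, U k.+1 = U k + (y k + e k);
  rec_x : forall k, x k.+1 = y k - M (y k + e k);
  rec_H : forall k, H k.+1 = H k + alpha *: (y k - H k + e k)
}.

(** [Fs k] holds what is known before the samples of step [k] are drawn, [Fc k]
    what is known before the compression of step [k]. *)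
Record cedas_information : Prop := CedasInformation {
  rec_Fs : forall k, information_class M J Minv gF (Fs k);
  rec_Fc : forall k, information_class M J Minv gF (Fc k);
  rec_FsFc : forall k v, Fs k v -> Fc k v;
  rec_Fs_x : forall k, Fs k (x k);
  rec_Fs_U : forall k, Fs k (U k);
  rec_Fc_H : forall k, Fc k (H k);
  rec_Fc_z : forall k, Fc k (z k)
}.

(** Vanishing conditional means appear as orthogonality to what is known.  The
    variance of the averaged noise, [rec_Jz_var], has no factor [nn]: this is the
    gain of having independent agents. *)
Record cedas_noise : Prop := CedasNoise {
  rec_z_orth : forall k v, Fs k v -> dot v (z k) = 0;
  rec_e_orth : forall k v, Fc k v -> dot v (e k) = 0;
  rec_z_var : forall k, dot (z k) (z k) <= nn * s2;
  rec_Jz_var : forall k, dot (J (z k)) (J (z k)) <= s2;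
  rec_e_var : forall k, dot (e k) (e k) <= C * dot (y k - H k) (y k - H k)
}.

Hypotheses (D : semi_inner dot) (mix : mixing_operators dot b g M J Minv).
Hypothesis lip : forall v w,
  dot (gF v - gF w) (gF v - gF w) <= L ^+ 2 * dot (v - w) (v - w).
Hypotheses (par : cedas_parameters) (dyn : cedas_dynamics).
Hypotheses (info : cedas_information) (noi : cedas_noise).

Let g_gt0 := rec_g_gt0 par.

Local Notation N v := (dot v v).
Let dE := (linearD, linearN, linearB, dotE D).
Let lE := (linE M, linE J, linE Minv, mix_mean mix, mean_mix mix, mean_idem mix).

Let gleb : g <= b.
Proof.
have := rec_g_gt0 par; have := rec_g par; have /andP[d0 d1] := rec_delta par.
move=> -> gg; have b0 : 0 < b by rewrite -(pmulr_lgt0 _ d0).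
by rewrite ler_piMr // ltW.
Qed.

Let b_le := rec_b par.
Let g_le : g <= 4^-1 := le_trans gleb b_le.

Lemma norm_Jl v : N (J v) = dot v (J v).
Proof. by rewrite (meanC mix) (mean_idem mix). Qed.

Lemma norm_pi v : N (v - J v) = N v - N (J v).
Proof. by rewrite !dE (dotC D (J v) v) norm_Jl; ring. Qed.

Lemma norm_pi_le v : N (v - J v) <= N v.
Proof. by rewrite norm_pi gerBl (dot_ge0 D). Qed.

Lemma norm_J_le v : N (J v) <= N v.
Proof. by rewrite -subr_ge0 -norm_pi (dot_ge0 D). Qed.

Lemma J_pi v : J (v - J v) = 0.
Proof. by rewrite linearB /= (mean_idem mix) subrr. Qed.

Lemma M_pi v : M (v - J v) = M v.
Proof. by rewrite linearB /= (mix_mean mix) subr0. Qed.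

(** If all rows are at their mean, the next step keeps them together exactly when
    [M U] equals the opposite of [target]. *)
Definition target k := eta *: (gF (J (x k)) - J (gF (J (x k)))).
Definition dev k := x k - J (x k).
(** The dual variable measured from its moving equilibrium. *)
Definition dual k := U k - J (U k) + Minv (target k).
Definition grad_gap k := eta *: ((gF (x k) - gF (J (x k)))
                                 - J (gF (x k) - gF (J (x k)))).
Definition noise k := eta *: (z k - J (z k)).
Definition dual_drift k := Minv (target k.+1) - Minv (target k).
Definition energy k := qdot dot M (dev k, dual k) (dev k, dual k).
Definition comp_gap k := N (y k - H k).
Definition mean_grad k := N (J (gF (x k))).

Lemma J_target k : J (target k) = 0.
Proof. by rewrite linearZ /= J_pi scaler0. Qed.

Lemma J_dev k : J (dev k) = 0. Proof. exact: J_pi. Qed.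

Lemma J_dual k : J (dual k) = 0.
Proof. by rewrite linearD /= J_pi add0r (mean_inv mix) // J_target. Qed.

Lemma M_dual k : M (dual k) = M (U k) + target k.
Proof. by rewrite linearD /= M_pi (mix_invK mix) // J_target. Qed.

Lemma dev_y k :
  y k - J (y k) = dev k - M (dual k) - grad_gap k - noise k.
Proof.
rewrite M_dual (rec_y dyn) /grad_gap /noise /target /dev.
by rewrite !lE; module_eq.
Qed.

Lemma J_x_next k : J (x k.+1) = J (x k) - eta *: J (gF (x k) + z k).
Proof.
rewrite (rec_x dyn) linearB /= (mean_mix mix) subr0 (rec_y dyn).
by rewrite !(linearB, linearZ) /= (mean_mix mix) subr0.
Qed.

(** The compression error is kept apart from the other disturbances: it is
    revealed last, hence orthogonal to all the others. *)
Lemma energy_pair_next k : (dev k.+1, dual k.+1) =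
  ((0, dual k) + impulse M (dev k - M (dual k)) - impulse M (grad_gap k)
   - impulse M (noise k) + (0, dual_drift k)) + (- M (e k), e k - J (e k)).
Proof.
have yE := dev_y k.
have MyE : M (y k) = M (dev k - M (dual k) - grad_gap k - noise k).
  by rewrite -yE M_pi.
congr pair.
- transitivity ((y k - J (y k)) - M (y k) - M (e k)).
    by rewrite /dev (rec_x dyn) !lE; module_eq.
  by rewrite MyE yE /= !lE; module_eq.
- transitivity (dual k + (y k - J (y k)) + (e k - J (e k)) + dual_drift k).
    by rewrite /dual /dual_drift (rec_U dyn) !lE; module_eq.
  by rewrite yE /=; module_eq.
Qed.

Lemma infoN S : information_class M J Minv gF S -> forall v, S v -> S (- v).
Proof. by move=> h v Sv; rewrite -scaleN1r; exact: infoZ h _ _ Sv. Qed.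

Lemma infoB S : information_class M J Minv gF S ->
  forall v w, S v -> S w -> S (v - w).
Proof. by move=> h v w Sv Sw; apply: (infoD h) => //; exact: infoN. Qed.

Ltac info_closed h :=
  repeat first
  [ assumption
  | apply: (infoN h) | apply: (infoD h) | apply: (infoZ h)
  | apply: (infoM h) | apply: (infoJ h) | apply: (infoI h) | apply: (infoG h) ].

Lemma Fs_target k : Fs k (target k).
Proof.
have h := rec_Fs info k; have hx := rec_Fs_x info k.
by rewrite /target; info_closed h.
Qed.

Lemma Fs_dev k : Fs k (dev k).
Proof.
have h := rec_Fs info k; have hx := rec_Fs_x info k.
by rewrite /dev; info_closed h.
Qed.

Lemma Fs_dual k : Fs k (dual k).
Proof.
have h := rec_Fs info k; have hU := rec_Fs_U info k.
by have ht := Fs_target k; rewrite /dual; info_closed h.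
Qed.

Lemma Fs_grad_gap k : Fs k (grad_gap k).
Proof.
have h := rec_Fs info k; have hx := rec_Fs_x info k.
by rewrite /grad_gap; info_closed h.
Qed.

Lemma Fc_noise k : Fc k (noise k).
Proof.
have h := rec_Fc info k; have hz := rec_Fc_z info k.
by rewrite /noise; info_closed h.
Qed.

Lemma Fc_y k : Fc k (y k).
Proof.
have h := rec_Fc info k; have hz := rec_Fc_z info k.
have hx := rec_FsFc info (rec_Fs_x info k).
have hU := rec_FsFc info (rec_Fs_U info k).
by rewrite (rec_y dyn); info_closed h.
Qed.

Lemma Fc_dual_drift k : Fc k (dual_drift k).
Proof.
have h := rec_Fc info k; have hy := Fc_y k.
have ht := rec_FsFc info (Fs_target k).
have hJ : Fc k (J (x k.+1)).
  by rewrite (rec_x dyn) linearB /= (mean_mix mix) subr0; info_closed h.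
by rewrite /dual_drift {1}/target; info_closed h.
Qed.

Lemma pi_orth k v : Fs k v -> dot v (noise k) = 0.
Proof.
move=> Sv; have h := rec_Fs info k.
rewrite /noise (dotZr D) !dE -(meanC mix) (rec_z_orth noi Sv).
by rewrite (rec_z_orth noi (infoJ h Sv)) subrr mulr0.
Qed.

Lemma noise_le k : N (noise k) <= eta ^+ 2 * (nn * s2).
Proof.
rewrite /noise (dotZl D) (dotZr D) mulrA -expr2.
rewrite ler_wpM2l ?sqr_ge0 //.
exact: le_trans (norm_pi_le _) (rec_z_var noi k).
Qed.

Lemma Leta2 : (L * eta) ^+ 2 <= g ^+ 2 / 256.
Proof.
have h := rec_etaL par; have e0 := rec_eta par; have L0 := rec_L par.
have p0 : 0 <= L * eta by rewrite mulr_ge0 ?ltW.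
have : (16 * (L * eta)) ^+ 2 <= g ^+ 2.
  by rewrite ler_sqr // ?nnegrE ?mulr_ge0 // ltW.
by rewrite exprMn; lra.
Qed.

Lemma grad_gap_le k : N (grad_gap k) <= g ^+ 2 / 256 * N (dev k).
Proof.
rewrite /grad_gap (dotZl D) (dotZr D) mulrA -expr2.
apply: (@le_trans _ _ (eta ^+ 2 * (L ^+ 2 * N (dev k)))).
  rewrite ler_wpM2l ?sqr_ge0 //.
  exact: le_trans (norm_pi_le _) (lip _ _).
rewrite mulrA -exprMn (mulrC eta).
by rewrite ler_wpM2r ?(dot_ge0 D) // Leta2.
Qed.

Lemma mean_step_le k :
  N (J (gF (x k) + z k)) <= mean_grad k + s2.
Proof.
have h := rec_Fs info k; have hx := rec_Fs_x info k.
have cross : dot (J (gF (x k))) (J (z k)) = 0.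
  by rewrite -(meanC mix) (rec_z_orth noi) //; info_closed h.
rewrite lE !dE (dotC D (J (z k)) (J (gF _))) cross.
by have := rec_Jz_var noi k; rewrite /mean_grad; lra.
Qed.

(** The equilibrium moves only with the mean of the rows, that is by
    [eta J (gF x + z)], and [L eta <= g / 16] makes this a small multiple of the
    mean gradient. *)
Lemma target_drift_le k :
  N (target k.+1 - target k) <=
    g ^+ 2 / 256 * (eta ^+ 2 * (mean_grad k + s2)).
Proof.
have -> : target k.+1 - target k =
  eta *: ((gF (J (x k.+1)) - gF (J (x k)))
          - J (gF (J (x k.+1)) - gF (J (x k)))).
  by rewrite /target !lE; module_eq.
rewrite (dotZl D) (dotZr D) mulrA -expr2.
apply: (@le_trans _ _ (eta ^+ 2 * (L ^+ 2 * N (J (x k.+1) - J (x k))))).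
  rewrite ler_wpM2l ?sqr_ge0 //.
  exact: le_trans (norm_pi_le _) (lip _ _).
rewrite mulrA -exprMn (mulrC eta).
have -> : J (x k.+1) - J (x k) = (- eta) *: J (gF (x k) + z k).
  by rewrite J_x_next; module_eq.
rewrite (dotZl D) (dotZr D) [- eta * (- eta * _)]mulrA mulrNN -expr2.
apply: ler_pM; [exact: sqr_ge0| |exact: Leta2|].
  by rewrite mulr_ge0 ?sqr_ge0 // (dot_ge0 D).
by rewrite ler_wpM2l ?sqr_ge0 // mean_step_le.
Qed.

Lemma dev_le_energy k : N (dev k) <= energy k.
Proof.
rewrite /energy qdotE /= lerDl.
have h := qdot_mix D mix g_gt0 gleb b_le (dual k).
have := mix_dot_ge0 mix (dual k); lra.
Qed.

Lemma energy_ge0 k : 0 <= energy k.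
Proof. exact: le_trans (dot_ge0 D _) (dev_le_energy k). Qed.

Lemma dual_le_energy k : N (M (dual k)) <= 4 / 3 * b * energy k.
Proof.
have h := qdot_mix D mix g_gt0 gleb b_le (dual k).
have h2 := mix_sq_le D mix g_gt0 gleb (dual k).
have h3 := dot_ge0 D (dev k).
have b0 : 0 <= b := le_trans (ltW g_gt0) gleb.
apply: (le_trans h2); rewrite [_ * b]mulrC -mulrA ler_wpM2l //.
by rewrite /energy qdotE /=; lra.
Qed.

Let qD := qdot_semi_inner D mix g_gt0 gleb b_le.

(** The disturbances are peeled off from the last revealed to the first.  The
    compression error and the gradient noise are orthogonal to what precedes them
    and contribute their own energy.  The drift of the equilibrium and the
    inexactness of the gradients are absorbed by Young's inequality with weight
    [g / 8], which leaves [1 - g / 4] of the contraction [1 - 3 g / 4]. *)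
Lemma energy_next k : energy k.+1 <=
  (1 - g / 4) * energy k + 3 * (eta ^+ 2 * (nn * s2))
  + (eta ^+ 2 * mean_grad k) / 20 + b * C * comp_gap k.
Proof.
pose q v := qdot dot M v v.
pose Z0 := (0, dual k) + impulse M (dev k - M (dual k)).
pose Z1 := Z0 - impulse M (grad_gap k).
pose Z2 := Z1 - impulse M (noise k).
pose Z3 := Z2 + (0, dual_drift k).
pose E := (- M (e k), e k - J (e k)).
have hF := rec_Fs info k; have hC := rec_Fc info k.
have Fdev := Fs_dev k; have Fdual := Fs_dual k; have Fgap := Fs_grad_gap k.
have Cnoise := Fc_noise k; have Cdrift := Fc_dual_drift k.
have SZ1 : Fs k Z1.1 /\ Fs k Z1.2.
  have h : Fs k (dev k - M (dual k)) by apply: (infoB hF); info_closed hF.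
  have h0 : Fs k 0 by rewrite -(scale0r (dual k)); info_closed hF.
  by split; rewrite /Z1 /Z0 /=; info_closed hF.
have SZ3 : Fc k Z3.1 /\ Fc k Z3.2.
  have [h1 h2] := SZ1; have {}h1 := rec_FsFc info h1.
  have {}h2 := rec_FsFc info h2.
  have h0 : Fc k 0 by rewrite -(scale0r (noise k)); info_closed hC.
  split; [change (Fc k (Z1.1 - (noise k - M (noise k)) + 0))
         |change (Fc k (Z1.2 - noise k + dual_drift k))]; by info_closed hC.
(* the compression error, orthogonal to everything else *)
have step3 : energy k.+1 <= q Z3 + b * C * comp_gap k.
  have cross : qdot dot M Z3 E = 0.
    rewrite /qdot; move: SZ3.1 SZ3.2; move: (Z3.1) (Z3.2) => v1 v2 h1 h2.
    rewrite /E /= M_pi !dE -!(mixC mix).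
    by rewrite !(rec_e_orth noi); do 1?[ring | by info_closed hC].
  have EE : q E <= b * (C * comp_gap k).
    have -> : q E = dot (e k) (M (e k)).
      rewrite /q /qdot /E /= M_pi !dE (meanC mix) (mean_mix mix) (dot0r D).
      by ring.
    apply: le_trans (mix_dot_le mix _) _.
    by rewrite ler_wpM2l ?(le_trans (ltW g_gt0) gleb) // (rec_e_var noi).
  rewrite /energy energy_pair_next -/Z0 -/Z1 -/Z2 -/Z3 -/E.
  move: cross EE; rewrite /q; move: (Z3) (E) => v w cross EE.
  by rewrite (dotDl qD) !(dotDr qD) (dotC qD w v) cross; lra.
have ge4 := g_le; have gg := g_gt0.
have g8 : 0 < g / 8 by lra.
(* the drift, whose energy is at most [|M drift|^2 / g] by the gap of [M] *)
have step2 : q Z3 <= (1 + g / 8) * q Z2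
    + (g + 8) / 256 * (eta ^+ 2 * (mean_grad k + s2)).
  apply: le_trans (dot_young qD _ _ g8) _; rewrite lerD2l.
  have h : g * qdot dot M (0, dual_drift k) (0, dual_drift k)
      <= g ^+ 2 / 256 * (eta ^+ 2 * (mean_grad k + s2)).
    have JJ : J (dual_drift k) = 0.
      by rewrite /dual_drift linearB /= !(mean_inv mix) ?subrr // J_target.
    have MJ : M (dual_drift k) = target k.+1 - target k.
      by rewrite /dual_drift linearB /= !(mix_invK mix) // J_target.
    have := mix_sq_ge D mix g_gt0 JJ; have := target_drift_le k.
    have := ler_wpM2l (ltW g_gt0) (dot_ge0 D (M (dual_drift k))).
    by rewrite qdotE /= (dot0l D) MJ; lra.
  have -> : 1 + (g / 8)^-1 = (g + 8) / g by field; lra.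
  have h2 : 0 <= (g + 8) / g by rewrite divr_ge0; lra.
  move: (ler_wpM2l h2 h).
  move: (qdot _ _ _ _) (eta ^+ 2 * _) => qq B.
  have -> : (g + 8) / g * (g * qq) = g * ((g + 8) / g * qq) by field; lra.
  have -> : (g + 8) / g * (g ^+ 2 / 256 * B) = g * ((g + 8) / 256 * B).
    by field; lra.
  by rewrite (ler_pM2l g_gt0).
(* the gradient noise, orthogonal to [Z1] *)
have step1 : q Z2 <= q Z1 + eta ^+ 2 * (nn * s2).
  have [h1 h2] := SZ1.
  have cross : qdot dot M Z1 (impulse M (noise k)) = 0.
    rewrite (qdot_impulse D mix) pi_orth //.
    by info_closed hF.
  move: cross (impulse_le D mix (noise k)) (noise_le k).
  rewrite /q /Z2; move: (Z1) (impulse M (noise k)) => v w cross.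
  rewrite (dotDl qD) !(dotDr qD) (dotNl qD w) !(dotNr qD _ w) (dotNl qD w).
  by rewrite (dotC qD w v) cross; lra.
(* the inexactness of the gradients, proportional to the deviation *)
have step0 : q Z1 <= (1 + g / 8) * ((1 - 3 / 4 * g) * energy k)
    + (g ^+ 2 + 8 * g) / 256 * energy k.
  apply: le_trans (dot_young qD _ _ g8) _; apply: lerD.
    rewrite ler_wpM2l //; first by lra.
    exact: (energy_step D mix g_gt0 b_le (J_dev k) (J_dual k)).
  rewrite (dotNl qD) (dotNr qD) opprK.
  have -> : 1 + (g / 8)^-1 = (g + 8) / g by field; lra.
  have h : qdot dot M (impulse M (grad_gap k)) (impulse M (grad_gap k))
     <= g ^+ 2 / 256 * energy k.
    apply: le_trans (impulse_le D mix _) _; apply: le_trans (grad_gap_le k) _.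
    by rewrite ler_wpM2l ?dev_le_energy // divr_ge0 ?sqr_ge0.
  have h2 : 0 <= (g + 8) / g by rewrite divr_ge0; lra.
  have := ler_wpM2l h2 h.
  have -> : (g + 8) / g * (g ^+ 2 / 256 * energy k)
     = (g ^+ 2 + 8 * g) / 256 * energy k by field; lra.
  by [].
have E0 := energy_ge0 k.
have B0 : 0 <= eta ^+ 2 * mean_grad k by rewrite mulr_ge0 ?sqr_ge0 ?(dot_ge0 D).
have S0 : 0 <= eta ^+ 2 * s2 by rewrite mulr_ge0 ?sqr_ge0 ?(rec_s2 par).
have Sn : eta ^+ 2 * s2 <= eta ^+ 2 * (nn * s2).
  by rewrite ler_wpM2l ?sqr_ge0 // ler_peMl ?(rec_s2 par) // (rec_nn par).
apply: (le_trans step3); rewrite lerD2r; apply: (le_trans step2).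
have step10 := le_trans step1 (lerD step0 (lexx _)).
have g80 : 0 <= 1 + g / 8 by lra.
have := ler_wpM2l g80 step10.
set qz := (X in X <= _ -> _) => hz.
have c1 : (1 + g / 8) * ((1 + g / 8) * (1 - 3 / 4 * g) + (g ^+ 2 + 8 * g) / 256)
  <= 1 - g / 4 by nra.
have c2 := ler_wpM2r E0 c1.
have c3 : (g + 8) / 256 * (eta ^+ 2 * (mean_grad k + s2))
   <= 1 / 20 * (eta ^+ 2 * mean_grad k) + 1 / 20 * (eta ^+ 2 * s2).
  by rewrite (mulrDr (eta ^+ 2)) mulrDr; apply: lerD; rewrite ler_wpM2r //; lra.
have c4 : (1 + g / 8) * (eta ^+ 2 * (nn * s2)) <= 2 * (eta ^+ 2 * (nn * s2)).
  by rewrite ler_wpM2r //; lra.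
by rewrite -/qz; lra.
Qed.

Lemma comp_gap_ge0 k : 0 <= comp_gap k.
Proof. exact: dot_ge0 D _. Qed.

(** [H] follows [y] by a relaxation of step [alpha], and the variance
    [alpha^2 C |y - H|^2] of its error is at most [alpha / 4] of the gap since
    [alpha C <= 1 / 4]. *)
Lemma comp_gap_next k : comp_gap k.+1 <=
  (1 - alpha) * comp_gap k + 3 / alpha * N (y k.+1 - y k).
Proof.
have /andP[a0 a4] := rec_alpha par; have aC := rec_alphaC par.
have [w wE] : exists w, w = y k - H k by exists (y k - H k).
have hC := rec_Fc info k; have hy := Fc_y k; have hH := rec_Fc_H info k.
have -> : comp_gap k.+1 = N (((1 - alpha) *: w - alpha *: e k) + (y k.+1 - y k)).
  rewrite /comp_gap (rec_H dyn) wE.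
  by congr (dot _ _); module_eq.
have a20 : 0 < alpha / 2 by lra.
apply: le_trans (dot_young D _ _ a20) _.
have -> : 1 + (alpha / 2)^-1 = (alpha + 2) / alpha by field; lra.
have cross : dot w (e k) = 0.
  by rewrite (rec_e_orth noi) // wE; info_closed hC.
have ww : 0 <= N w by exact: dot_ge0 D _.
apply: lerD.
  rewrite !dE (dotC D (e k) w) cross.
  have h : alpha ^+ 2 * N (e k) <= alpha / 4 * N w.
    apply: (@le_trans _ _ (alpha ^+ 2 * (C * N w))).
      by rewrite ler_wpM2l ?sqr_ge0 // wE (rec_e_var noi).
    have := ler_wpM2l (ltW a0) (ler_wpM2r ww aC); lra.
  have h2 : (1 + alpha / 2) * ((1 - alpha) ^+ 2 + alpha / 4) <= 1 - alpha by nra.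
  have h3 : 0 <= 1 + alpha / 2 by lra.
  have := ler_wpM2l h3 h; have := ler_wpM2r ww h2.
  rewrite /comp_gap -wE; lra.
by rewrite ler_wpM2r ?(dot_ge0 D) // ler_wpM2r ?invr_ge0 ?(ltW a0) //; lra.
Qed.

(** Measured from the equilibrium, the motion of [y] consists of the noise, of
    the mean gradients, of the terms [M (dual _)], whose square is of order [b]
    times the energy, and of smaller terms.  The factor [b] is what allows the compression gap to be
    compensated by the energy. *)
Lemma y_move_le k : N (y k.+1 - y k) <=
  9 * (eta ^+ 2 * (nn * s2)) + 8 * (eta ^+ 2 * mean_grad k.+1)
  + eta ^+ 2 * mean_grad k + 23 * b * energy k.+1 + 6 * b * energy k.
Proof.
have -> : y k.+1 - y k =
  (((- eta) *: z k.+1 + (- eta) *: J (gF (x k.+1)))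
   + ((- 1) *: grad_gap k.+1 + (target k.+1 - target k)))
  + ((- 2) *: M (dual k.+1) + M (dual k)).
  have xE : y k - M (y k + e k) = x k.+1 by rewrite (rec_x dyn).
  have yE : y k = x k.+1 + M (U k.+1) - M (U k).
    by rewrite -xE (rec_U dyn) !lE; module_eq.
  rewrite [X in _ - X]yE (rec_y dyn) !M_dual /grad_gap /target !lE.
  by module_eq.
have s2_:= dot_sum2 D.
apply: le_trans (s2_ _ _) _.
have h1 := s2_ ((- 2) *: M (dual k.+1)) (M (dual k)).
have h2 := s2_ ((- eta) *: z k.+1 + (- eta) *: J (gF (x k.+1)))
   ((- 1) *: grad_gap k.+1 + (target k.+1 - target k)).
have h3 := s2_ ((- eta) *: z k.+1) ((- eta) *: J (gF (x k.+1))).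
have h4 := s2_ ((- 1) *: grad_gap k.+1) (target k.+1 - target k).
have sq c v : N (c *: v) = c ^+ 2 * N v by rewrite !dE mulrA expr2.
rewrite (sq (- 2)) in h1; rewrite !(sq (- eta)) in h3; rewrite (sq (- 1)) in h4.
have e1 : eta ^+ 2 * N (z k.+1) <= eta ^+ 2 * (nn * s2).
  by rewrite ler_wpM2l ?sqr_ge0 // (rec_z_var noi).
have e2 := grad_gap_le k.+1; have e3 := target_drift_le k.
have e4 := dual_le_energy k.+1; have e5 := dual_le_energy k.
have e6 := dev_le_energy k.+1.
have E1 := energy_ge0 k.+1; have E0 := energy_ge0 k.
have gg := g_gt0; have ge4 := g_le; have gb := gleb.
have B0 : 0 <= eta ^+ 2 * mean_grad k by rewrite mulr_ge0 ?sqr_ge0 ?(dot_ge0 D).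
have S0 : 0 <= eta ^+ 2 * s2 by rewrite mulr_ge0 ?sqr_ge0 ?(rec_s2 par).
have Sn : eta ^+ 2 * s2 <= eta ^+ 2 * (nn * s2).
  by rewrite ler_wpM2l ?sqr_ge0 // ler_peMl ?(rec_s2 par) // (rec_nn par).
have g2 : g ^+ 2 <= 4^-1 * g by rewrite expr2 ler_wpM2r // ltW.
have c2 : g ^+ 2 / 256 * N (dev k.+1) <= b / 256 * energy k.+1.
  have h : g ^+ 2 / 256 <= b / 256 by lra.
  apply: (@le_trans _ _ (g ^+ 2 / 256 * energy k.+1)).
    by rewrite ler_wpM2l // divr_ge0 ?sqr_ge0.
  by rewrite ler_wpM2r.
have c3 : g ^+ 2 / 256 * (eta ^+ 2 * (mean_grad k + s2))
   <= 1 / 8 * (eta ^+ 2 * mean_grad k + eta ^+ 2 * s2).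
  have h : g ^+ 2 / 256 <= 1 / 8 by lra.
  by rewrite -(mulrDr (eta ^+ 2)) ler_wpM2r // mulrDr addr_ge0.
have bE0 : 0 <= b * energy k by rewrite mulr_ge0 //; lra.
have bE1 : 0 <= b * energy k.+1 by rewrite mulr_ge0 //; lra.
rewrite /mean_grad in B0 c3 e3 *.
lra.
Qed.

(** One step of the energy is charged [b C] times the gap, and the gap loses
    [alpha] of itself: the weight [2 b C / alpha] pays this charge twice.  The
    [g / 64] taken from the energy pays for the energy that the motion of [y] puts
    back into the gap. *)
Definition lyapunov k :=
  (1 - g / 64) * energy k + 2 * b * C / alpha * comp_gap k.

Lemma comp_weight_ge0 : 0 <= 2 * b * C / alpha.
Proof.
have b0 : 0 <= b := le_trans (ltW g_gt0) gleb.
have /andP[a0 _] := rec_alpha par.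
apply: divr_ge0; last exact: ltW.
by apply: mulr_ge0; [rewrite mulr_ge0 ?ler0n|exact: ltW (rec_C par)].
Qed.

Lemma lyapunov_next k : lyapunov k.+1 + g / 16 * energy k <=
  lyapunov k + 4 * (eta ^+ 2 * (nn * s2)) + 11 / 200 * (eta ^+ 2 * mean_grad k)
  + 1 / 200 * (eta ^+ 2 * mean_grad k.+1).
Proof.
have /andP[a0 a4] := rec_alpha par.
have E1 := energy_ge0 k.+1; have E0 := energy_ge0 k.
have gg := g_gt0; have ge4 := g_le; have gb := gleb.
have b0 : 0 < b by lra.
have P0 := comp_gap_ge0 k.
have bC0 : 0 <= b * C by rewrite mulr_ge0 ?(ltW (rec_C par)) // ltW.
have B0 : 0 <= eta ^+ 2 * mean_grad k by rewrite mulr_ge0 ?sqr_ge0 ?(dot_ge0 D).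
have B1 : 0 <= eta ^+ 2 * mean_grad k.+1 by rewrite mulr_ge0 ?sqr_ge0 ?(dot_ge0 D).
have S0 : 0 <= eta ^+ 2 * (nn * s2).
  have := rec_nn par; have := rec_s2 par => s0 n1.
  by rewrite mulr_ge0 ?sqr_ge0 // mulr_ge0 //; lra.
(* [rho] is the weight of the motion of [y]; by [rec_bC] its product with the
   factor 23 b of [y_move_le] stays below [g / 64] *)
pose rho := 6 * (b * C) / alpha ^+ 2.
have rho0 : 0 <= rho.
  by apply: divr_ge0; [rewrite mulr_ge0 ?ler0n|exact: sqr_ge0].
have rhod : rho <= 6 / 100 / 100 * delta.
  rewrite ler_pdivrMr ?exprn_gt0 //.
  by have := rec_bC par; lra.
have /andP[d0 d1] := rec_delta par.
have rho1 : rho <= 6 / 100 / 100 by lra.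
have rhob : rho * b <= 6 / 100 / 100 * g.
  by have := ler_wpM2r (ltW b0) rhod; rewrite (rec_g par); lra.
have h1 := ler_wpM2l comp_weight_ge0 (comp_gap_next k).
have e1 : 2 * b * C / alpha * ((1 - alpha) * comp_gap k
    + 3 / alpha * N (y k.+1 - y k))
  = 2 * b * C / alpha * comp_gap k - 2 * (b * C * comp_gap k)
    + rho * N (y k.+1 - y k).
  by rewrite /rho; field; lra.
rewrite e1 {e1} in h1.
have h2 := ler_wpM2l rho0 (y_move_le k).
have h3 := energy_next k.
have c1 := ler_wpM2r E1 rhob; have c2 := ler_wpM2r E0 rhob.
have c3 := ler_wpM2r S0 rho1; have c4 := ler_wpM2r B0 rho1.
have c5 := ler_wpM2r B1 rho1.
have c6 : 0 <= g * energy k by rewrite mulr_ge0 // ltW.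
have c7 : 0 <= g * energy k.+1 by rewrite mulr_ge0 // ltW.
have c8 : 0 <= b * C * comp_gap k by rewrite mulr_ge0.
rewrite /lyapunov; lra.
Qed.

Lemma lyapunov_ge k : g / 16 * energy k <= lyapunov k.
Proof.
have E0 := energy_ge0 k; have P0 := comp_gap_ge0 k.
have gg := g_gt0; have ge4 := g_le.
have h : g / 16 * energy k <= (1 - g / 64) * energy k by rewrite ler_wpM2r //; lra.
by have := mulr_ge0 comp_weight_ge0 P0; rewrite /lyapunov; lra.
Qed.

(** Telescoping; the term of [lyapunov_next] in the next mean gradient is carried
    along by one index, and closed at the end by [lyapunov_ge]. *)
Lemma energy_sum_le m :
  g / 16 * (\sum_(k < m) energy k) <=
  lyapunov 0 + 4 * m%:R * (eta ^+ 2 * (nn * s2))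
  + 1 / 16 * (eta ^+ 2 * \sum_(k < m) mean_grad k).
Proof.
have B0 k : 0 <= eta ^+ 2 * mean_grad k by rewrite mulr_ge0 ?sqr_ge0 ?(dot_ge0 D).
have S0 : 0 <= eta ^+ 2 * (nn * s2).
  have := rec_nn par; have := rec_s2 par => s0 n1.
  by rewrite mulr_ge0 ?sqr_ge0 // mulr_ge0 //; lra.
case: m => [|m].
  rewrite !big_ord0 !(mulr0, mul0r, addr0).
  apply: le_trans (lyapunov_ge 0); rewrite mulr_ge0 ?energy_ge0 //.
  by have := g_gt0; lra.
suff h : g / 16 * (\sum_(k < m) energy k) + lyapunov m <=
  lyapunov 0 + 4 * m%:R * (eta ^+ 2 * (nn * s2))
  + 1 / 16 * (eta ^+ 2 * \sum_(k < m) mean_grad k)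
  + 1 / 200 * (eta ^+ 2 * mean_grad m).
  rewrite !big_ord_recr /= -(natr1 m); have := lyapunov_ge m; have := B0 m; lra.
elim: m => [|m IH].
  by rewrite !big_ord0 !(mulr0, mul0r, addr0, add0r) lerDl; have := B0 0%N; lra.
rewrite !big_ord_recr /= -(natr1 m).
by have := lyapunov_next m; have := B0 m; have := B0 m.+1; lra.
Qed.

End Recursion.

(** * From agreement to stationarity *)

Section Descent.
Variables (R : realFieldType) (V : lmodType R) (dot : V -> V -> R).
Variables (b g : R) (M J Minv : {linear V -> V}) (gF : V -> V).
Variables (L eta alpha C s2 nn delta : R).
Variables (x z U H y e : nat -> V) (Fs Fc : nat -> V -> Prop).
Hypotheses (D : semi_inner dot) (mix : mixing_operators dot b g M J Minv).
Hypothesis lip : forall v w,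
  dot (gF v - gF w) (gF v - gF w) <= L ^+ 2 * dot (v - w) (v - w).
Hypothesis par : cedas_parameters b g L eta alpha C s2 nn delta.
Hypothesis dyn : cedas_dynamics M gF eta alpha x z U H y e.
Hypothesis info : cedas_information M J Minv gF x z U H Fs Fc.
Hypothesis noi : cedas_noise dot J C s2 nn z H y e Fs Fc.
Variables (xm zm : V) (phi : nat -> R) (finf : R).

Local Notation N v := (dot v v).
Local Notation run_energy := (energy dot M J Minv gF eta x U).
Local Notation run_mean_grad := (mean_grad dot J gF x).
Local Notation run_lyapunov := (lyapunov dot b g M J Minv gF eta alpha C x U H y).

(** The descent inequality of an [L]-smooth average of [nn] functions, multiplied
    by [nn], when the mean moves from [J v] along the mean of [gF v + w]; [p] and
    [q] are the expected values before and after. *)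
Definition descends v w (p q : R) : Prop :=
  nn * q <= nn * p - eta * dot (J (gF (J v))) (gF v + w)
            + L / 2 * (eta ^+ 2 * N (J (gF v + w))).

(** The run starts with one plain stochastic gradient step from [xm] to [x 0].
    [phi t] is the expected objective at the mean of iterate [t - 1], so that
    [phi 0] belongs to [xm]. *)
Record cedas_start : Prop := CedasStart {
  start_x : x 0%N = xm - eta *: (gF xm + zm);
  start_U : U 0%N = 0;
  start_z_mean : forall v, (v = J (gF xm)) \/ (v = J (gF (J xm))) ->
    dot v zm = 0;
  start_z_var : N zm <= nn * s2;
  start_Jz_var : N (J zm) <= s2;
  start_descent : descends xm zm (phi 0%N) (phi 1%N);
  step_descent : forall k, descends (x k) (z k) (phi k.+1) (phi k.+2);
  phi_lower : forall k, finf <= phi k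
}.

Hypothesis start : cedas_start.

Let g_gt0 := rec_g_gt0 par.
Let gleb : g <= b.
Proof.
have := rec_g_gt0 par; have := rec_g par; have /andP[d0 d1] := rec_delta par.
move=> -> gg; have b0 : 0 < b by rewrite -(pmulr_lgt0 _ d0).
by rewrite ler_piMr // ltW.
Qed.
Let b_le := rec_b par.
Let g_le : g <= 4^-1 := le_trans gleb b_le.

Let Leta_le : L * eta <= 64^-1.
Proof. by have := rec_etaL par; have := g_le; lra. Qed.

Let normZ c v : N (c *: v) = c ^+ 2 * N v.
Proof. by rewrite (dotZl D) (dotZr D) mulrA expr2. Qed.

Let sum2 := dot_sum2 D.

Let sub2 v w : N (v - w) <= 2 * N v + 2 * N w.
Proof.
by apply: le_trans (sum2 _ _) _; rewrite (dotNl D) (dotNr D) opprK.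
Qed.

Lemma lip_eta v w :
  eta ^+ 2 * N (gF v - gF w) <= g ^+ 2 / 256 * N (v - w).
Proof.
apply: (@le_trans _ _ (eta ^+ 2 * (L ^+ 2 * N (v - w)))).
  by rewrite ler_wpM2l ?sqr_ge0 // lip.
rewrite mulrA -exprMn (mulrC eta).
by rewrite ler_wpM2r ?(dot_ge0 D) // (Leta2 par).
Qed.

(** The initial dual variable is zero, so its error is [Minv (target 0)].  Its
    energy is only bounded by [N (target 0) / g], whence the factor [g] in front
    of the Lyapunov function. *)
Lemma lyapunov_start : g * run_lyapunov 0%N <=
  12 * (eta ^+ 2 * N (gF xm))
  + g * (11 * N xm + 4 * N (H 0%N) + 33 * (eta ^+ 2 * (nn * s2))).
Proof.
have gg := g_gt0; have ge4 := g_le; have gb := gleb.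
have g2 : g ^+ 2 <= g / 4.
  by rewrite expr2 -[g / 4]mulrC ler_wpM2r ?(ltW g_gt0) // mulrC.
have /andP[a0 a4] := rec_alpha par.
set A := eta ^+ 2 * N (gF xm); set T := eta ^+ 2 * (nn * s2).
set X := N xm; set Hn := N (H 0%N).
have X0 : 0 <= X by exact: dot_ge0 D _.
have Hn0 : 0 <= Hn by exact: dot_ge0 D _.
have A0 : 0 <= A by rewrite mulr_ge0 ?sqr_ge0 ?(dot_ge0 D).
have zle w : N w <= nn * s2 -> eta ^+ 2 * N w <= T.
  by move=> h; rewrite ler_wpM2l ?sqr_ge0.
have T0 : 0 <= T.
  apply: le_trans (zle _ (start_z_var start)).
  by rewrite mulr_ge0 ?sqr_ge0 ?(dot_ge0 D).
have step : N (eta *: (gF xm + zm)) <= 2 * A + 2 * T.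
  rewrite normZ; have := ler_wpM2l (sqr_ge0 eta) (sum2 (gF xm) zm).
  by have := zle _ (start_z_var start); rewrite /A; lra.
have hx0 : N (x 0%N) <= 2 * X + 4 * A + 4 * T.
  by rewrite (start_x start); have := sub2 xm (eta *: (gF xm + zm)); rewrite /X; lra.
have hgrad v : eta ^+ 2 * N (gF v) <= 2 * A + g / 512 * N (v - xm).
  have -> : gF v = gF xm + (gF v - gF xm) by rewrite addrC subrK.
  have := ler_wpM2l (sqr_ge0 eta) (sum2 (gF xm) (gF v - gF xm)).
  have := lip_eta v xm.
  have : g ^+ 2 / 256 * N (v - xm) <= g / 4 / 256 * N (v - xm).
    by rewrite ler_wpM2r ?(dot_ge0 D) //; lra.
  by rewrite /A; lra.
have htarget : N (target J gF eta x 0%N) <=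
    2 * A + g / 512 * (2 * N (x 0%N) + 2 * X).
  rewrite /target normZ.
  apply: (@le_trans _ _ (eta ^+ 2 * N (gF (J (x 0%N))))).
    by rewrite ler_wpM2l ?sqr_ge0 // (norm_pi_le D mix).
  apply: le_trans (hgrad _) _; rewrite lerD2l ler_wpM2l ?divr_ge0 ?(ltW gg) //.
  apply: le_trans (sub2 _ _) _; rewrite lerD2r ler_wpM2l //.
  exact: norm_J_le D mix _.
have henergy : g * run_energy 0%N <= g * N (x 0%N) + 2 * A
    + g / 512 * (2 * N (x 0%N) + 2 * X).
  set u := dual J Minv gF eta x U 0%N.
  have Mu : M u = target J gF eta x 0%N.
    by rewrite /u (M_dual _ _ _ _ mix) (start_U start) linear0 add0r.
  have Ju : J u = 0 by exact: J_dual mix _.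
  have h1 := mix_sq_ge D mix g_gt0 Ju.
  have h2 : N (dev J x 0%N) <= N (x 0%N) by exact: norm_pi_le D mix _.
  have h3 := ler_wpM2l (ltW gg) h2.
  have h4 := ler_wpM2l (ltW gg) (dot_ge0 D (M u)).
  rewrite /energy qdotE /= -/u; move: h1 h4; rewrite Mu; lra.
have hcomp : comp_gap dot H y 0%N <= 4 * N (x 0%N) + 4 * Hn + 9 * A + 5 * T.
  rewrite /comp_gap (rec_y dyn) (start_U start) linear0 subr0.
  have -> : x 0%N - eta *: (gF (x 0%N) + z 0%N) - H 0%N =
    (x 0%N - H 0%N) - eta *: (gF (x 0%N) + z 0%N) by module_eq.
  have h1 := sub2 (x 0%N - H 0%N) (eta *: (gF (x 0%N) + z 0%N)).
  rewrite normZ in h1; have h2 := sub2 (x 0%N) (H 0%N).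
  have h3 := ler_wpM2l (sqr_ge0 eta) (sum2 (gF (x 0%N)) (z 0%N)).
  have h4 := zle _ (rec_z_var noi 0%N).
  have h5 := hgrad (x 0%N).
  have h6 : N (x 0%N - xm) <= 2 * A + 2 * T.
    have -> : x 0%N - xm = (- 1) *: (eta *: (gF xm + zm)).
      by rewrite (start_x start); module_eq.
    by rewrite normZ; lra.
  have h7 : g / 512 * N (x 0%N - xm) <= 1 / 2048 * (2 * A + 2 * T).
    by apply: ler_pM; rewrite ?(dot_ge0 D) //; lra.
  rewrite /Hn; lra.
have x00 : 0 <= N (x 0%N) by exact: dot_ge0 D _.
have E0 := energy_ge0 gF x U D mix par 0.
have w1 : 2 * b * C / alpha <= 1.
  rewrite ler_pdivrMr //.
  have /andP[d0 d1] := rec_delta par.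
  have h : alpha ^+ 2 * delta <= alpha.
    have : alpha ^+ 2 * delta <= alpha ^+ 2 * 1 by rewrite ler_wpM2l ?sqr_ge0.
    by nra.
  by have := rec_bC par; lra.
have hL : run_lyapunov 0%N <= run_energy 0%N + comp_gap dot H y 0%N.
  have P0 : 0 <= comp_gap dot H y 0%N by exact: dot_ge0 D _.
  rewrite /lyapunov; apply: lerD.
    by rewrite ler_piMl //; lra.
  by rewrite ler_piMl.
have := ler_wpM2l (ltW gg) hL; have := ler_wpM2l (ltW gg) hcomp.
have := ler_wpM2l (ltW gg) hx0.
have := ler_wpM2r A0 ge4; have := ler_wpM2r T0 ge4.
have := mulr_ge0 (ltW gg) X0; have := mulr_ge0 (ltW gg) T0.
have := mulr_ge0 (ltW gg) A0; have := mulr_ge0 (ltW gg) Hn0.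
by lra.
Qed.

(** Polarizing [<J gF (J v), J (gF v)>] produces both the squared gradient at the
    mean and the squared mean gradient; the latter has a favourable sign and later
    pays for the mean gradients created by the disagreement. *)
Lemma descent_step v w p q : descends v w p q ->
  dot (J (gF (J v))) w = 0 -> dot (J (gF v)) w = 0 -> N (J w) <= s2 ->
  eta / 2 * N (J (gF (J v))) + nn * q <=
  nn * p + eta / 2 * (L ^+ 2 * N (v - J v))
  - (eta / 2 - L / 2 * eta ^+ 2) * N (J (gF v)) + L / 2 * (eta ^+ 2 * s2).
Proof.
rewrite /descends => hd o1 o2 hw.
have e0 := rec_eta par; have L0 := rec_L par.
rewrite (dotDr D) o1 addr0 in hd.
have hN : N (J (gF v + w)) <= N (J (gF v)) + s2.
  have cross : dot (J (gF v)) (J w) = 0.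
    by rewrite -(meanC mix) (mean_idem mix).
  by rewrite linearD /= (dotDl D) !(dotDr D) (dotC D (J w) (J (gF v))) cross; lra.
have hdot : 2 * dot (J (gF (J v))) (gF v) =
   N (J (gF (J v))) + N (J (gF v)) - N (J (gF v) - J (gF (J v))).
  have -> : dot (J (gF (J v))) (gF v) = dot (J (gF (J v))) (J (gF v)).
    by rewrite -(meanC mix) (mean_idem mix).
  by rewrite !(dotE D) (dotC D (J (gF v)) (J (gF (J v)))); ring.
have hdiff : N (J (gF v) - J (gF (J v))) <= L ^+ 2 * N (v - J v).
  rewrite -linearB; apply: le_trans (norm_J_le D mix _) _; exact: lip.
have h1 : eta * dot (J (gF (J v))) (gF v) = eta / 2 *
   (N (J (gF (J v))) + N (J (gF v)) - N (J (gF v) - J (gF (J v)))).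
  by rewrite -hdot; field.
have h2 : eta / 2 * N (J (gF v) - J (gF (J v))) <= eta / 2 * (L ^+ 2 * N (v - J v)).
  by rewrite ler_wpM2l //; lra.
have h3 : L / 2 * (eta ^+ 2 * N (J (gF v + w))) <=
   L / 2 * (eta ^+ 2 * (N (J (gF v)) + s2)).
  by rewrite ler_wpM2l ?ler_wpM2l ?sqr_ge0 //; lra.
by rewrite h1 in hd; lra.
Qed.

(** The descent inequalities are summed and the accumulated disagreement is
    replaced by the bound of [energy_sum_le].  Since [(L eta)^2 <= g^2 / 256], the
    mean gradients of that bound come back with a coefficient below the
    [eta / 4] that the descent leaves to them. *)
Theorem descent_sum m :
  N (J (gF (J xm))) + \sum_(k < m) N (J (gF (J (x k)))) <=
  2 * (nn * (phi 0%N - finf)) / eta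
  + 200 * L ^+ 2 / g ^+ 2 * (eta ^+ 2 * N (gF xm))
  + 200 * L ^+ 2 / g * (N xm + N (H 0%N))
  + 600 * L ^+ 2 / g * (m.+1%:R * (eta ^+ 2 * (nn * s2)))
  + L * eta * s2 * m.+1%:R.
Proof.
have e0 := rec_eta par; have L0 := rec_L par.
have gg := g_gt0; have ge4 := g_le; have gb := gleb.
have nn1 := rec_nn par.
set B0 := N (J (gF xm)).
set E1 := \sum_(k < m) run_energy k; set B1 := \sum_(k < m) run_mean_grad k.
set A1 := \sum_(k < m) N (J (gF (J (x k)))).
have h0 : eta / 2 * N (J (gF (J xm))) + nn * phi 1%N <=
  nn * phi 0%N + eta / 2 * (L ^+ 2 * N xm)
  - (eta / 2 - L / 2 * eta ^+ 2) * B0 + L / 2 * (eta ^+ 2 * s2).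
  have := descent_step (start_descent start) (start_z_mean start (or_intror erefl))
    (start_z_mean start (or_introl erefl)) (start_Jz_var start).
  have : eta / 2 * (L ^+ 2 * N (xm - J xm)) <= eta / 2 * (L ^+ 2 * N xm).
    rewrite ler_wpM2l ?divr_ge0 ?(ltW e0) // ler_wpM2l ?sqr_ge0 //.
    exact: norm_pi_le D mix _.
  by rewrite /B0; lra.
have h1 : eta / 2 * A1 + nn * phi m.+1 <=
  nn * phi 1%N + eta / 2 * (L ^+ 2 * E1)
  - (eta / 2 - L / 2 * eta ^+ 2) * B1 + m%:R * (L / 2 * (eta ^+ 2 * s2)).
  rewrite /A1 /E1 /B1; clear A1 E1 B1; elim: m => [|m IH].
    by rewrite !big_ord0 !(mulr0, mul0r, addr0, subr0, add0r).
  rewrite !big_ord_recr /= -(natr1 m).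
  have hFs := rec_Fs info m; have hx := rec_Fs_x info m.
  have o1 : dot (J (gF (J (x m)))) (z m) = 0.
    rewrite (rec_z_orth noi) //.
    by do ?[apply: (infoJ hFs) | apply: (infoG hFs)].
  have o2 : dot (J (gF (x m))) (z m) = 0.
    by rewrite (rec_z_orth noi) //; apply: (infoJ hFs); apply: (infoG hFs).
  have := descent_step (step_descent start m) o1 o2 (rec_Jz_var noi m).
  have : eta / 2 * (L ^+ 2 * N (x m - J (x m))) <= eta / 2 * (L ^+ 2 * run_energy m).
    rewrite ler_wpM2l ?divr_ge0 ?(ltW e0) // ler_wpM2l ?sqr_ge0 //.
    exact: (dev_le_energy gF x U D mix par).
  by rewrite /mean_grad; lra.
have hB0 : 0 <= B0 by exact: dot_ge0 D _.
have hB1 : 0 <= B1 by apply: sumr_ge0 => k _; exact: dot_ge0 D _.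
have hE := energy_sum_le D mix lip par dyn info noi m.
have hS := lyapunov_start.
rewrite -/E1 -/B1 in hE.
set A := eta ^+ 2 * N (gF xm); set T := eta ^+ 2 * (nn * s2).
set X := N xm; set Hn := N (H 0%N).
rewrite -/A -/T -/X -/Hn in hE hS h0.
have T0 : 0 <= T.
  have := rec_s2 par => s0.
  by rewrite /T mulr_ge0 ?sqr_ge0 // mulr_ge0 //; lra.
have X0 : 0 <= X by exact: dot_ge0 D _.
have Hn0 : 0 <= Hn by exact: dot_ge0 D _.
have A0 : 0 <= A by rewrite mulr_ge0 ?sqr_ge0 ?(dot_ge0 D).
have hL2 : (L * eta) ^+ 2 <= g ^+ 2 / 256 := Leta2 par.
have hLE : L ^+ 2 * E1 <= 16 * L ^+ 2 / g ^+ 2 *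
    (12 * A + g * (11 * X + 4 * Hn + 33 * T))
    + 64 * L ^+ 2 / g * (m%:R * T) + B1 / 256.
  have c0 : 0 <= 16 * L ^+ 2 / g ^+ 2.
    by apply: divr_ge0; [rewrite mulr_ge0 ?ler0n ?sqr_ge0|exact: sqr_ge0].
  have h2 := ler_wpM2l c0 (ler_wpM2l (ltW gg) hE).
  have e1 : 16 * L ^+ 2 / g ^+ 2 * (g * (g / 16 * E1)) = L ^+ 2 * E1.
    by field; lra.
  rewrite e1 {e1} in h2; apply: (le_trans h2).
  have e1 : 16 * L ^+ 2 / g ^+ 2 * (g * (run_lyapunov 0%N + 4 * m%:R * T
      + 1 / 16 * (eta ^+ 2 * B1)))
    = 16 * L ^+ 2 / g ^+ 2 * (g * run_lyapunov 0%N)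
      + 64 * L ^+ 2 / g * (m%:R * T) + (L * eta) ^+ 2 / g * B1.
    by field; lra.
  rewrite e1; apply: lerD; first by rewrite lerD2r ler_wpM2l.
  rewrite [B1 / 256]mulrC ler_wpM2r // ler_pdivrMr //.
  by apply: le_trans hL2 _; rewrite expr2; nra.
have Le := Leta_le.
have hphi := phi_lower start m.+1.
have hnphi : nn * finf <= nn * phi m.+1 by rewrite ler_wpM2l //; lra.
(* the coefficient [eta / 2 - L eta^2 / 2] of the mean gradients is at least
   [eta / 4] *)
have cB : L / 2 * eta ^+ 2 <= eta / 4.
  have := ler_wpM2r (ltW e0) Le; rewrite expr2; lra.
have hB0' := ler_wpM2r hB0 cB; have hB1' := ler_wpM2r hB1 cB.
have hLE' := ler_wpM2l (ltW e0) hLE.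
have eB0 := mulr_ge0 (ltW e0) hB0; have eB1 := mulr_ge0 (ltW e0) hB1.
pose Q := 16 * L ^+ 2 / g ^+ 2 * (12 * A + g * (11 * X + 4 * Hn + 33 * T))
    + 64 * L ^+ 2 / g * (m%:R * T).
have total : eta / 2 * (N (J (gF (J xm))) + A1) <=
   nn * (phi 0%N - finf) + eta / 2 * (L ^+ 2 * X) + eta / 2 * Q
   + m.+1%:R * (L / 2 * (eta ^+ 2 * s2)).
  rewrite -(natr1 m) /Q; lra.
have e2 : 0 <= 2 / eta by rewrite divr_ge0 // ltW.
have := ler_wpM2l e2 total.
have -> : 2 / eta * (eta / 2 * (N (J (gF (J xm))) + A1)) = N (J (gF (J xm))) + A1.
  by field; lra.
have -> : 2 / eta * (nn * (phi 0%N - finf) + eta / 2 * (L ^+ 2 * X) + eta / 2 * Q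
   + m.+1%:R * (L / 2 * (eta ^+ 2 * s2))) =
   2 * (nn * (phi 0%N - finf)) / eta + L ^+ 2 * X + Q + L * eta * s2 * m.+1%:R.
  by field; lra.
have -> : Q = 192 * (L ^+ 2 / g ^+ 2 * A) + 176 * (L ^+ 2 / g * X)
   + 64 * (L ^+ 2 / g * Hn) + 528 * (L ^+ 2 / g * T)
   + 64 * (L ^+ 2 / g * (m%:R * T)).
  by rewrite /Q; field; lra.
move=> h; apply: (le_trans h); rewrite lerD2r -!addrA lerD2l !addrA.
have gi : 1 <= g^-1 by rewrite invf_ge1 //; lra.
have K0 : 0 <= L ^+ 2 / g by rewrite divr_ge0 ?sqr_ge0 // ltW.
have K1 : L ^+ 2 <= L ^+ 2 / g by rewrite ler_peMr ?sqr_ge0.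
have q0 := ler_wpM2r X0 K1.
have q1 := mulr_ge0 K0 X0; have q2 := mulr_ge0 K0 Hn0; have q3 := mulr_ge0 K0 T0.
have q4 : 0 <= L ^+ 2 / g * (m%:R * T) by rewrite mulr_ge0 // mulr_ge0.
have q5 : 0 <= L ^+ 2 / g ^+ 2 * A by rewrite mulr_ge0 // divr_ge0 ?sqr_ge0.
rewrite -(natr1 m); lra.
Qed.

End Descent.

(** * The rate for the prescribed stepsize *)

Section Rate.
Variables (R : rcfType) (L sigma Delta0 : R).
Hypotheses (L_gt0 : 0 < L) (sigma_gt0 : 0 < sigma) (Delta0_gt0 : 0 < Delta0).

Definition rate_constant : R :=
  let c := Num.sqrt (L * sigma ^+ 2 / Delta0) in
  2 * Delta0 * c + L * sigma ^+ 2 / c + 32 * L * Delta0 + 600 * L * Delta0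
  + 200 * L ^+ 2 + 200 * L * Delta0 / sigma ^+ 2.

Lemma weighted_sum_le (k1 k2 k3 k4 k5 k6 a b e h t1 t2 t3 t4 t5 : R) :
  t1 <= k1 * a + k3 * b -> t2 <= k6 * h -> t3 <= k5 * e -> t4 <= k4 * b -> t5 <= k2 * a ->
  0 <= k1 -> 0 <= k2 -> 0 <= k3 -> 0 <= k4 -> 0 <= k5 -> 0 <= k6 ->
  0 <= a -> 0 <= b -> 0 <= e -> 0 <= h ->
  t1 + t2 + t3 + t4 + t5 <= (k1 + k2 + k3 + k4 + k5 + k6) * (a + b + e + h).
Proof.
move=> h1 h2 h3 h4 h5 p1 p2 p3 p4 p5 p6 a0 b0 e0 f0.
apply: (@le_trans _ _ (k1 * a + k3 * b + k6 * h + k5 * e + k4 * b + k2 * a)); first lra.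
rewrite -subr_ge0.
have -> : (k1 + k2 + k3 + k4 + k5 + k6) * (a + b + e + h)
   - (k1 * a + k3 * b + k6 * h + k5 * e + k4 * b + k2 * a) =
   (k3 + k4 + k5 + k6) * a + (k1 + k2 + k5 + k6) * b
   + (k1 + k2 + k3 + k4 + k6) * e + (k1 + k2 + k3 + k4 + k5) * h by ring.
by rewrite !addr_ge0 // mulr_ge0 // !addr_ge0.
Qed.

(** With [u = sqrt (n K)] one has [q = c u / n] for a [c] that depends only on
    [L], [sigma] and [Delta0].  Hence [1 / eta = q + 16 L / g] yields terms of
    order [1 / u] and [n / (g K)], and the noise terms are controlled by
    [eta <= 1 / q]. *)
Lemma rate_of_sum (n K g X G S : R) : 1 <= n -> 0 < K -> 0 < g ->
  0 <= X -> 0 <= G ->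
  let q := Num.sqrt (L * sigma ^+ 2 * K / (n * Delta0)) in
  let eta := (q + 16 * L / g)^-1 in
  S <= 2 * (n * Delta0) / eta + 200 * L ^+ 2 / g ^+ 2 * (eta ^+ 2 * G)
       + 200 * L ^+ 2 / g * X
       + 600 * L ^+ 2 / g * (K * (eta ^+ 2 * (n * sigma ^+ 2)))
       + L * eta * sigma ^+ 2 * K ->
  K^-1 * (n^-1 * S) <= rate_constant *
    (1 / Num.sqrt (n * K) + n / (g * K) + X / (n * g * K) + G / (g ^+ 2 * K ^+ 2)).
Proof.
move=> n1 K0 g0 X0 G0 q eta hS.
have n0 : 0 < n by apply: lt_le_trans n1.
have s0 : 0 < sigma ^+ 2 by rewrite exprn_gt0.
rewrite /rate_constant; set c := Num.sqrt (L * sigma ^+ 2 / Delta0).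
set u := Num.sqrt (n * K).
have c0 : 0 < c by rewrite sqrtr_gt0 divr_gt0 ?mulr_gt0.
have u0 : 0 < u by rewrite sqrtr_gt0 mulr_gt0.
have q0 : 0 < q by rewrite sqrtr_gt0 divr_gt0 ?mulr_gt0.
have c2 : c ^+ 2 = L * sigma ^+ 2 / Delta0 by rewrite sqr_sqrtr // ltW // divr_gt0 ?mulr_gt0.
have u2 : u ^+ 2 = n * K by rewrite sqr_sqrtr // ltW // mulr_gt0.
have q2 : q ^+ 2 = L * sigma ^+ 2 * K / (n * Delta0).
  by rewrite sqr_sqrtr // ltW // divr_gt0 ?mulr_gt0.
have qE : q = c * u / n.
  apply: (pexpIrn (n := 2)); rewrite ?nnegrE ?ltW ?divr_gt0 ?mulr_gt0 //.
  rewrite q2 expr_div_n exprMn c2 u2; field.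
  by rewrite !gt_eqF.
have r0 : 0 < q + 16 * L / g by rewrite addr_gt0 // divr_gt0 // mulr_gt0.
have e0 : 0 < eta by rewrite invr_gt0.
have etaq : eta <= q^-1.
  by rewrite lef_pV2 ?posrE // lerDl divr_ge0 // ltW // mulr_gt0.
have eta2 : eta ^+ 2 <= n * Delta0 / (L * sigma ^+ 2 * K).
  rewrite (_ : _ / _ = q^-1 ^+ 2); first by rewrite ler_sqr ?nnegrE ?invr_ge0 // ltW.
  by rewrite exprVn q2 invf_div.
have etaVE : eta^-1 = q + 16 * L / g by rewrite invrK.
have KV : 0 < K^-1 by rewrite invr_gt0.
have nV : 0 < n^-1 by rewrite invr_gt0.
have h1 : K^-1 * (n^-1 * (2 * (n * Delta0) / eta)) <=
    2 * Delta0 * c * (1 / u) + 32 * L * Delta0 * (n / (g * K)).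
  have -> : K^-1 * (n^-1 * (2 * (n * Delta0) / eta)) =
     2 * Delta0 * c * (u / (n * K)) + 32 * L * Delta0 * (1 / (g * K)).
    by rewrite etaVE qE; field; rewrite !gt_eqF.
  rewrite -u2 (_ : u / u ^+ 2 = 1 / u); last by field; rewrite gt_eqF.
  rewrite lerD2l ler_wpM2l ?(ltW (mulr_gt0 (mulr_gt0 _ _) _)) //.
  by rewrite ler_wpM2r // invr_ge0 mulr_ge0 // ltW.
have h2 : K^-1 * (n^-1 * (200 * L ^+ 2 / g ^+ 2 * (eta ^+ 2 * G))) <=
    200 * L * Delta0 / sigma ^+ 2 * (G / (g ^+ 2 * K ^+ 2)).
  have -> : 200 * L * Delta0 / sigma ^+ 2 * (G / (g ^+ 2 * K ^+ 2)) =
    K^-1 * (n^-1 * (200 * L ^+ 2 / g ^+ 2 * ((n * Delta0 / (L * sigma ^+ 2 * K)) * G))).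
    by field; rewrite !gt_eqF.
  rewrite !ler_pM2l //; last by rewrite divr_gt0 ?exprn_gt0 // mulr_gt0 ?exprn_gt0.
  by rewrite ler_wpM2r.
have h3 : K^-1 * (n^-1 * (200 * L ^+ 2 / g * X)) <= 200 * L ^+ 2 * (X / (n * g * K)).
  rewrite (_ : K^-1 * _ = 200 * L ^+ 2 * (X / (n * g * K))) //.
  by field; rewrite !gt_eqF.
have h4 : K^-1 * (n^-1 * (600 * L ^+ 2 / g * (K * (eta ^+ 2 * (n * sigma ^+ 2))))) <=
    600 * L * Delta0 * (n / (g * K)).
  have -> : 600 * L * Delta0 * (n / (g * K)) = K^-1 * (n^-1 * (600 * L ^+ 2 / g *
      (K * ((n * Delta0 / (L * sigma ^+ 2 * K)) * (n * sigma ^+ 2))))).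
    by field; rewrite !gt_eqF.
  rewrite !ler_pM2l //; last by rewrite divr_gt0 // mulr_gt0 ?exprn_gt0.
  by rewrite ler_wpM2r // ltW // mulr_gt0.
have h5 : K^-1 * (n^-1 * (L * eta * sigma ^+ 2 * K)) <=
    L * sigma ^+ 2 / c * (1 / u).
  have -> : L * sigma ^+ 2 / c * (1 / u) = K^-1 * (n^-1 * (L * q^-1 * sigma ^+ 2 * K)).
    by rewrite qE; field; rewrite !gt_eqF.
  by rewrite !ler_pM2l // !ler_pM2r // ler_pM2l.
have Kn : 0 < K^-1 * n^-1 by rewrite mulr_gt0.
have := ler_wpM2l (ltW nV) hS => /(ler_wpM2l (ltW KV)) /le_trans; apply.
apply: (le_trans _ (weighted_sum_le h1 h2 h3 h4 h5 _ _ _ _ _ _ _ _ _ _)).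
- by rewrite !mulrDr.
all: try by rewrite ?mulr_ge0 ?divr_ge0 ?sqr_ge0 ?ltW.
all: by rewrite divr_ge0 // ?mulr_ge0 ?sqr_ge0 ?ltW // !mulr_gt0 // exprn_gt0.
Qed.

End Rate.

(** * Functions with vanishing integrals over a sigma-algebra *)

From mathcomp Require Import all_classical all_reals all_analysis.
From mathcomp Require Import finmap measurable_realfun.

Import numFieldNormedType.Exports.

Local Open Scope classical_set_scope.
Local Open Scope ring_scope.

Section Vanishing.
Variables (R : realType) (d : measure_display) (T : measurableType d).
Variable (P : probability T R).

Lemma measurable_wrtP (F : set (set T)) (hF : sigma_algebra setT F)
    (dU : measure_display) (U : measurableType dU) (X : T -> U) :
  measurable_wrt F X <->
  measurable_fun [set: g_sigma_algebraType F] (X : g_sigma_algebraType F -> U).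
Proof.
have E : @measurable _ (g_sigma_algebraType F) = F.
  exact: sigma_algebra_id.
split=> [mX _ B mB|mX B mB].
  by rewrite setTI E; exact: mX.
by have := mX measurableT B mB; rewrite setTI E.
Qed.

Lemma measurable_wrt_sub (F G : set (set T)) (dU : measure_display)
    (U : measurableType dU) (X : T -> U) : F `<=` G ->
  measurable_wrt F X -> measurable_wrt G X.
Proof. by move=> FG mX B mB; exact/FG/mX. Qed.

Lemma measurable_wrt_fun (F : set (set T)) (dU : measure_display)
    (U : measurableType dU) (X : T -> U) : F `<=` measurable ->
  measurable_wrt F X -> measurable_fun [set: T] X.
Proof. by move=> FG mX _ B mB; rewrite setTI; exact/FG/mX. Qed.

(** The difference between a variable and a version of its conditional
    expectation has this property, and the calculus of conditional expectations
    is reduced to it. *)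
Definition vanishes_on (F : set (set T)) (D : T -> R) : Prop :=
  forall A, F A -> (\int[P]_(w in A) (D w)%:E = 0)%E.

Lemma integral_indicM (A : set T) (D : T -> R) :
  (\int[P]_w (\1_A w * D w)%:E = \int[P]_(w in A) (D w)%:E)%E.
Proof.
rewrite [RHS]integral_mkcond; apply: eq_integral => w _.
rewrite /patch indicE; case: ifP => wA; first by rewrite mul1r.
by rewrite mul0r.
Qed.

Import HBNNSimple.

(** A simple function measurable with respect to [F] is a combination of
    indicators of events of [F]. *)
Lemma vanishes_simple (F : set (set T)) (hF : Defs.sub_sigma_algebra F)
    (D : T -> R) (h : {nnsfun (g_sigma_algebraType F) >-> R}) :
  P.-integrable setT (EFin \o D) -> vanishes_on F D ->
  (\int[P]_w (h w * D w)%:E = 0)%E.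
Proof.
move=> iD vD.
have [sF mF] := hF.
have mA y : F (h @^-1` [set y]).
  have := @measurable_funP _ _ _ _ _ h measurableT [set y] (measurable_set1 y).
  by rewrite setTI /measurable /= (sigma_algebra_id sF).
have iA y : P.-integrable setT (fun w => (\1_(h @^-1` [set y]) w * D w)%:E).
  have -> : (fun w => (\1_(h @^-1` [set y]) w * D w)%:E) =
            (EFin \o D) \_ (h @^-1` [set y]).
    apply/funext => w; rewrite /patch indicE; case: ifP => wA /=.
      by rewrite mul1r.
    by rewrite mul0r.
  apply/(integrable_mkcond _ (mF _ (mA y))).
  by apply: integrableS iD => //; exact: (mF _ (mA y)).
transitivity (\int[P]_w (\sum_(y <- fset_set (range h))
     (y%:E * (\1_(h @^-1` [set y]) w * D w)%:E)))%E.
  apply: eq_integral => w _.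
  rewrite [h w]fimfunE fsbig_finite //= mulr_suml -sumEFin.
  by apply: eq_bigr => y _; rewrite -mulrA.
rewrite integral_sum //; last by move=> y; exact: integrableZl.
apply: big1 => y _; rewrite integralZl // integral_indicM vD ?mule0 //.
Qed.

(** Dominated convergence along simple functions increasing to [Z], with
    dominating function [|Z D|]. *)
Lemma vanishes_ge0 (F : set (set T)) (hF : Defs.sub_sigma_algebra F)
    (D Z : T -> R) :
  P.-integrable setT (EFin \o D) -> vanishes_on F D ->
  measurable_wrt F Z -> (forall w, 0 <= Z w) ->
  P.-integrable setT (fun w => (Z w * D w)%:E) ->
  (\int[P]_w (Z w * D w)%:E = 0)%E.
Proof.
move=> iD vD mZ Z0 iZD; have [sF mF] := hF.
have mZ' : measurable_fun [set: g_sigma_algebraType F]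
    (EFin \o (Z : g_sigma_algebraType F -> R)).
  by apply/measurable_EFinP; exact/measurable_wrtP.
pose h := nnsfun_approx (@measurableT _ (g_sigma_algebraType F)) mZ'.
have hmeas n : measurable_fun [set: T] (h n : T -> R).
  apply: (measurable_wrt_fun mF); apply/(measurable_wrtP sF).
  exact: measurable_funP.
have hle n w : h n w <= Z w.
  rewrite -lee_fin nnsfun_approxE.
  by apply: le_approx => //= x _; rewrite lee_fin.
have m1 n : measurable_fun [set: T] (fun w => (h n w * D w)%:E).
  apply/measurable_EFinP/measurable_funM; first exact: hmeas.
  exact/measurable_EFinP/(measurable_int _ iD).
have [|||_ _ cv] := @dominated_convergence _ T R P setT measurableT
  (fun n w => (h n w * D w)%:E) (fun w => (Z w * D w)%:E)
  (fun w => `|(Z w * D w)%:E|%E) m1 (measurable_int _ iZD).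
- apply: aeW => w _; under eq_fun do rewrite EFinM; rewrite EFinM.
  apply: cvgeZr => //.
  by apply: (cvg_nnsfun_approx measurableT mZ') => // x _; rewrite lee_fin.
- exact: integrable_abse.
- apply: aeW => w n _; rewrite lee_fin !normrM ler_wpM2r //.
  by rewrite !ger0_norm.
have h0 : (fun n => \int[P]_w (h n w * D w)%:E)%E = fun=> 0%E.
  by apply/funext => n; exact: vanishes_simple.
move: cv; rewrite [X in X @ _ --> _]h0 => cv.
exact/esym/(cvg_unique _ (@cvg_cst _ _ _ _ _) cv).
Qed.

Lemma integrable_le (X Y : T -> R) : measurable_fun [set: T] X ->
  (forall w, `|X w| <= Y w) -> P.-integrable setT (EFin \o Y) ->
  P.-integrable setT (EFin \o X).
Proof.
move=> mX XY; apply: le_integrable => //; first exact/measurable_EFinP.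
by move=> w _; rewrite lee_fin (le_trans (XY w)) // ler_norm.
Qed.

Lemma integrable_meas (X : T -> R) : P.-integrable setT (EFin \o X) ->
  measurable_fun [set: T] X.
Proof. by move=> iX; exact/measurable_EFinP/(measurable_int _ iX). Qed.

Lemma integrable_add (X Y : T -> R) : P.-integrable setT (EFin \o X) ->
  P.-integrable setT (EFin \o Y) ->
  P.-integrable setT (EFin \o (fun w => X w + Y w)).
Proof. by move=> iX iY; apply: eq_integrable (integrableD measurableT iX iY). Qed.

Lemma integrable_scale (c : R) (X : T -> R) : P.-integrable setT (EFin \o X) ->
  P.-integrable setT (EFin \o (fun w => c * X w)).
Proof. by move=> iX; apply: eq_integrable (integrableZl measurableT c iX). Qed.

Lemma integrable_sub (X Y : T -> R) : P.-integrable setT (EFin \o X) ->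
  P.-integrable setT (EFin \o Y) ->
  P.-integrable setT (EFin \o (fun w => X w - Y w)).
Proof. by move=> iX iY; apply: eq_integrable (integrableB measurableT iX iY). Qed.

Lemma integrable_bounded (c : R) (X : T -> R) : measurable_fun [set: T] X ->
  (forall w, `|X w| <= c) -> P.-integrable setT (EFin \o X).
Proof.
move=> mX Xc; apply: (@integrable_le _ (cst c)) => //.
exact: finite_measure_integrable_cst.
Qed.

Lemma integrable_boundedM (c : R) (X Y : T -> R) : measurable_fun [set: T] X ->
  (forall w, `|X w| <= c) -> P.-integrable setT (EFin \o Y) ->
  P.-integrable setT (EFin \o (fun w => X w * Y w)).
Proof.
move=> mX Xc iY; apply: (@integrable_le _ (fun w => c * `|Y w|)).
- by apply: measurable_funM => //; exact: integrable_meas.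
- by move=> w; rewrite normrM ler_wpM2r.
- exact/integrable_scale/integrable_norm.
Qed.

Lemma integrable_restrict_real (A : set T) (X : T -> R) : measurable A ->
  P.-integrable setT (EFin \o X) -> P.-integrable A (EFin \o X).
Proof. by move=> mA; exact: integrableS. Qed.

(** What is known can be taken out of a conditional expectation. *)
Lemma vanishes_mul (F : set (set T)) (hF : Defs.sub_sigma_algebra F)
    (D Z : T -> R) :
  P.-integrable setT (EFin \o D) -> vanishes_on F D ->
  measurable_wrt F Z -> P.-integrable setT (EFin \o (fun w => Z w * D w)) ->
  (\int[P]_w (Z w * D w)%:E = 0)%E.
Proof.
move=> iD vD mZ iZD; have [sF mF] := hF.
have mZ' := (measurable_wrtP sF Z).1 mZ.
pose Zp w := Num.max (Z w) 0; pose Zn w := Num.max (- Z w) 0.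
have ZE w : Z w = Zp w - Zn w.
  rewrite /Zp /Zn; have [h|h] := leP 0 (Z w).
    by rewrite max_r ?oppr_le0 // subr0.
  by rewrite max_l ?oppr_ge0 ?(ltW h) // sub0r opprK.
have mZp : measurable_wrt F Zp.
  by apply/(measurable_wrtP sF)/measurable_maxr => //; exact: measurable_cst.
have mZn : measurable_wrt F Zn.
  apply/(measurable_wrtP sF)/measurable_maxr; last exact: measurable_cst.
  exact: measurableT_comp.
have mD := integrable_meas iD.
have iZDp : P.-integrable setT (EFin \o (fun w => Zp w * D w)).
  apply: (@integrable_le _ (fun w => `|Z w * D w|)); last exact: integrable_norm.
    by apply: measurable_funM => //; exact: (measurable_wrt_fun mF).
  move=> w; rewrite !normrM ler_wpM2r // /Zp; case: (leP (Z w) 0) => // _.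
  by rewrite normr0.
have iZDn : P.-integrable setT (EFin \o (fun w => Zn w * D w)).
  apply: (@integrable_le _ (fun w => `|Z w * D w|)); last exact: integrable_norm.
    by apply: measurable_funM => //; exact: (measurable_wrt_fun mF).
  move=> w; rewrite !normrM ler_wpM2r // /Zn; case: (leP (- Z w) 0) => _.
    by rewrite normr0.
  by rewrite normrN.
transitivity (\int[P]_w (Zp w * D w)%:E - \int[P]_w (Zn w * D w)%:E)%E.
  rewrite -integralB_EFin //; apply: eq_integral => w _.
  by rewrite ZE mulrBl.
by rewrite !(vanishes_ge0 hF) ?sube0 // => w; rewrite le_max lexx orbT.
Qed.

(** The events over which [D] has integral zero form a Dynkin system. *)
Lemma vanishes_dynkin (G : set (set T)) (D : T -> R) :
  setI_closed G -> G setT -> G `<=` measurable ->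
  P.-integrable setT (EFin \o D) -> vanishes_on G D ->
  vanishes_on <<s G>> D.
Proof.
move=> GI GT mG iD vD.
pose H := [set A : set T | measurable A /\ (\int[P]_(w in A) (D w)%:E = 0)%E].
suff GH : <<s G>> `<=` H by move=> A /GH[].
rewrite -(setI_closed_g_dynkin_g_sigma_algebra GI); apply: smallest_sub.
  split.
  - by split; [exact: measurableT|exact: vD].
  - move=> A [mA A0]; split; first exact: measurableC.
    have := vD _ GT; rewrite -(setUv A) integral_setU_EFin ?A0 ?add0e //.
    + exact: measurableC.
    + by rewrite setUv; exact: integrable_meas.
    + by apply/disj_setPS; rewrite setICr.
  - move=> A tA AH; split; first by apply: bigcup_measurable => k _; case: (AH k).
    rewrite integral_bigcup //.
    + by apply: eseries0 => k _ _; case: (AH k).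
    + by move=> k; case: (AH k).
    + apply: integrableS iD => //.
      by apply: bigcup_measurable => k _; case: (AH k).
by move=> A GA; split; [exact: mG|exact: vD].
Qed.

Lemma cond_exp_vanishes (F : set (set T)) (hF : Defs.sub_sigma_algebra F)
    (X Y : T -> R) : is_cond_exp P F X Y ->
  P.-integrable setT (EFin \o (fun w => X w - Y w)) /\
  vanishes_on F (fun w => X w - Y w).
Proof.
move=> [iX iY mY XY]; have [sF mF] := hF.
split; first exact: integrable_sub.
move=> A FA; have mA := mF _ FA.
have iXA := integrable_restrict_real mA iX.
have iYA := integrable_restrict_real mA iY.
under eq_integral do rewrite EFinB.
rewrite (integralB_EFin mA) // XY // subee //.
exact: integrable_fin_num.
Qed.

(** The event that [Y] is negative belongs to [F], and the integral over it can
    only be zero. *)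
Lemma ae_ge0 (F : set (set T)) (hF : Defs.sub_sigma_algebra F)
    (Y : T -> R) : measurable_wrt F Y -> P.-integrable setT (EFin \o Y) ->
  (forall A, F A -> 0 <= \int[P]_(w in A) (Y w)%:E)%E ->
  {ae P, forall w, 0 <= Y w}.
Proof.
move=> mY iY Y0; have [sF mF] := hF.
pose N := [set w | Y w < 0].
have FN : F N.
  have := mY `]-oo, 0[%classic (measurable_itv _).
  by congr F; apply/seteqP; split => w /=; rewrite in_itv.
have mN := mF _ FN.
have : (\int[P]_(w in N) `|(Y w)%:E| = 0)%E.
  apply/eqP; rewrite eq_le integral_ge0 // andbT.
  have -> : (\int[P]_(w in N) `|(Y w)%:E| = - \int[P]_(w in N) (Y w)%:E)%E.
    rewrite -integralN; last first.
      exact/integrable_add_def/integrable_restrict_real.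
    by apply: eq_integral => w /set_mem Nw /=; rewrite ltr0_norm.
  by rewrite oppe_le0 Y0.
move/(ae_eq_integral_abs P mN (measurable_int _ (integrable_restrict_real mN iY))).
apply: filterS => w h; rewrite leNgt; apply/negP => Nw.
by have [Yw] := h Nw; rewrite Yw ltxx in Nw.
Qed.

End Vanishing.

(** * Conditional independence and orthogonality *)

Lemma sube0_eq (R : realType) (x y : \bar R) : x \is a fin_num ->
  y \is a fin_num -> (x - y = 0)%E -> x = y.
Proof.
by move: x y => [x||] [y||] // _ _ [] /eqP; rewrite subr_eq0 => /eqP ->.
Qed.

Section ConditionalIndependence.
Variables (R : realType) (d : measure_display) (T : measurableType d).
Variable (P : probability T R).
Variables (F : set (set T)) (hF : Defs.sub_sigma_algebra F).

Let sF := hF.1.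
Let mF := hF.2.

Lemma measurable_wrt_mul (X Y : T -> R) : measurable_wrt F X ->
  measurable_wrt F Y -> measurable_wrt F (fun w => X w * Y w).
Proof.
move=> /(measurable_wrtP sF) mX /(measurable_wrtP sF) mY.
by apply/(measurable_wrtP sF)/measurable_funM.
Qed.

Lemma measurable_wrt_indic (A : set T) : F A -> measurable_wrt F (\1_A : T -> R).
Proof.
move=> FA; apply/(measurable_wrtP sF).
have mA : @measurable _ (g_sigma_algebraType F) A.
  by rewrite /measurable /= (sigma_algebra_id sF).
exact: measurable_indic.
Qed.

Lemma indic_le1 (A : set T) w : `|(\1_A w : R)| <= 1.
Proof. by rewrite indicE; case: (_ \in _); rewrite ?normr1 ?normr0. Qed.

(** Almost everywhere a conditional probability lies between 0 and 1; clipping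
    makes this hold everywhere, so that all products below are integrable. *)
Lemma cond_prob_clip (B : set T) (Z : T -> R) : is_cond_exp P F \1_B Z ->
  exists Z' : T -> R, [/\ is_cond_exp P F \1_B Z', forall w, `|Z' w| <= 1 &
    {ae P, forall w, Z w = Z' w}].
Proof.
move=> [iB iZ mZ BZ].
have h0 : {ae P, forall w, 0 <= Z w}.
  apply: (ae_ge0 hF mZ iZ) => A FA; rewrite -BZ //.
  by apply: integral_ge0 => w _; rewrite lee_fin.
have h1 : {ae P, forall w, 0 <= 1 - Z w}.
  apply: (ae_ge0 hF).
  - apply/(measurable_wrtP sF)/measurable_funB; first exact: measurable_cst.
    exact/(measurable_wrtP sF).
  - by apply: integrable_sub => //; exact: finite_measure_integrable_cst.
  - move=> A FA; have mA := mF FA.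
    have i1 : P.-integrable A (EFin \o cst 1).
      exact: finite_measure_integrable_cst.
    under eq_integral do rewrite EFinB.
    rewrite (integralB_EFin mA i1); last exact: integrable_restrict_real.
    rewrite -BZ // sube_ge0.
      apply: le_integral => //; first exact: integrable_restrict_real.
      by move=> w _; rewrite lee_fin (le_trans (ler_norm _)) ?indic_le1.
    by rewrite (integrable_fin_num _ (integrable_restrict_real mA iB)).
pose Z' w := Num.min (Num.max (Z w) 0) 1.
have mZ' : measurable_wrt F Z'.
  apply/(measurable_wrtP sF)/measurable_minr; last exact: measurable_cst.
  apply: measurable_maxr; last exact: measurable_cst.
  exact/(measurable_wrtP sF).
have b1 w : `|Z' w| <= 1.
  have p0 : 0 <= Z' w by rewrite le_min ler01 le_max lexx orbT.
  by rewrite ger0_norm // ge_min lexx orbT.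
have ae : {ae P, forall w, Z w = Z' w}.
  move: h0 h1; apply: filterS2 => w z0; rewrite subr_ge0 => z1.
  by rewrite /Z' max_l // min_l.
exists Z'; split => //; split => //.
  apply: (@integrable_bounded _ _ _ P 1) => //.
  exact: (measurable_wrt_fun mF).
move=> A FA; rewrite BZ //; have mA := mF FA.
apply: ae_eq_integral => //.
- exact: (measurable_int _ (integrable_restrict_real mA iZ)).
- by apply/measurable_EFinP/measurable_funTS; exact: (measurable_wrt_fun mF).
- by apply: filterS ae => w -> _.
Qed.

Variables (n : nat) (dU : measure_display) (U : measurableType dU).
Variables (X : 'I_n -> T -> U).
Hypotheses (mX : forall i, measurable_fun [set: T] (X i)).
Hypothesis indep : cond_independent P F X.

Let mpre i B : measurable B -> measurable (X i @^-1` B).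
Proof. by move=> mB; have := mX i measurableT mB; rewrite setTI. Qed.

(** Mutual independence is given as a product rule over all indices.  Taking the
    sure event for every index other than [i] and [j] leaves two factors, because
    a conditional probability of the sure event is almost surely 1. *)
Lemma cond_indep_pair i j (Bi Bj : set U) : i != j ->
  measurable Bi -> measurable Bj ->
  exists Zi Zj : T -> R,
  [/\ is_cond_exp P F \1_(X i @^-1` Bi) Zi, is_cond_exp P F \1_(X j @^-1` Bj) Zj,
      (forall w, `|Zi w| <= 1), (forall w, `|Zj w| <= 1) &
      forall A, F A -> (\int[P]_(w in A) (\1_(X i @^-1` Bi) w * \1_(X j @^-1` Bj) w)%:E
        = \int[P]_(w in A) (Zi w * Zj w)%:E)%E].
Proof.
move=> ij mBi mBj.
pose A k := if k == i then Bi else if k == j then Bj else setT.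
have mA k : measurable (A k) by rewrite /A; case: ifP => // _; case: ifP.
have [Z [hZ [_ iZ mZ eZ]]] := indep mA.
have [Zi [ci bi ai]] := cond_prob_clip (hZ i).
have [Zj [cj bj aj]] := cond_prob_clip (hZ j).
have Ai : A i = Bi by rewrite /A eqxx.
have Aj : A j = Bj by rewrite /A eq_sym (negbTE ij) eqxx.
rewrite Ai in ci; rewrite Aj in cj.
exists Zi, Zj; split => // S FS; have mS := mF FS.
have setE : [set w | forall k, A k (X k w)] = (X i @^-1` Bi) `&` (X j @^-1` Bj).
  apply/seteqP; split => w /=.
    by move=> h; split; [have := h i; rewrite Ai|have := h j; rewrite Aj].
  by move=> [wi wj] k; rewrite /A; case: eqP => [->//|_]; case: eqP => [->//|].
rewrite setE in eZ.
transitivity (\int[P]_(w in S) (\1_(X i @^-1` Bi `&` X j @^-1` Bj) w)%:E)%E.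
  by apply: eq_integral => w _; rewrite indicI.
rewrite eZ //.
have ae1 : {ae P, forall w, forall k, k != i -> k != j -> Z k w = 1}.
  apply: filter_forall => k; case: (boolP ((k != i) && (k != j))) => [|ne].
    move=> /andP[ki kj].
    have := hZ k; rewrite /A (negbTE ki) (negbTE kj) preimage_setT => -[ik iZk mZk eZk].
    have i1 : P.-integrable setT (EFin \o (fun=> 1 : R)).
      exact: finite_measure_integrable_cst.
    have e0 B : F B -> (\int[P]_(w in B) (Z k w)%:E = \int[P]_(w in B) (1 : R)%:E)%E.
      by move=> FB; rewrite -eZk //; apply: eq_integral => w _; rewrite indicT.
    have fin B : F B -> (\int[P]_(w in B) (1 : R)%:E)%E \is a fin_num.
      move=> FB; have := integrable_fin_num (mF FB) (integrable_restrict_real (mF FB) i1); exact.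
    have h0 : {ae P, forall w, 0 <= 1 - Z k w}.
      apply: (ae_ge0 hF) => [||B FB].
      - apply/(measurable_wrtP sF)/measurable_funB; first exact: measurable_cst.
        exact/(measurable_wrtP sF).
      - exact: integrable_sub.
      - have mB := mF FB; under eq_integral do rewrite EFinB.
        rewrite (integralB_EFin mB); [|exact: integrable_restrict_real..].
        by rewrite e0 // subee // fin.
    have h1 : {ae P, forall w, 0 <= Z k w - 1}.
      apply: (ae_ge0 hF) => [||B FB].
      - apply/(measurable_wrtP sF)/measurable_funB; last exact: measurable_cst.
        exact/(measurable_wrtP sF).
      - exact: integrable_sub.
      - have mB := mF FB; under eq_integral do rewrite EFinB.
        rewrite (integralB_EFin mB); [|exact: integrable_restrict_real..].
        by rewrite e0 // subee // fin.
    move: h0 h1; apply: filterS2 => w; rewrite !subr_ge0 => z1 z2 _ _.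
    by apply/eqP; rewrite eq_le z1.
  by apply: aeW => w ki kj; rewrite ki kj in ne.
have mZi := measurable_wrt_fun mF (let: And4 _ _ m _ := ci in m).
have mZj := measurable_wrt_fun mF (let: And4 _ _ m _ := cj in m).
apply: ae_eq_integral => //.
- exact: (measurable_int _ (integrable_restrict_real mS iZ)).
- exact/measurable_EFinP/measurable_funTS/measurable_funM.
- move: ae1; move: ai aj; apply: filterS3 => w zi zj z1 _ /=.
  rewrite (bigD1 i) //= (bigD1 j) 1?eq_sym //= zi zj big1 ?mulr1 //.
  by move=> k /andP[ki kj]; exact: z1.
Qed.

(** A system stable under intersection that generates the information of [F]
    together with that of [X i]. *)
Definition joint_events (i : 'I_n) : set (set T) :=
  [set E | exists A B, [/\ F A, measurable B & E = A `&` X i @^-1` B]].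

Lemma joint_eventsI i : setI_closed (joint_events i).
Proof.
move=> _ _ [A [B [FA mB ->]]] [A' [B' [FA' mB' ->]]].
exists (A `&` A'), (B `&` B'); split; last by rewrite preimage_setI setIACA.
- have /= := @measurableI _ (g_sigma_algebraType F) A A'.
  by rewrite /measurable /= (sigma_algebra_id sF); exact.
- exact: measurableI.
Qed.

Lemma F_setT : F setT.
Proof.
have := @measurableT _ (g_sigma_algebraType F).
by rewrite /measurable /= (sigma_algebra_id sF).
Qed.

Lemma joint_eventsT i : joint_events i setT.
Proof.
exists setT, setT; split=> //; first exact: F_setT.
by rewrite preimage_setT setTI.
Qed.

Lemma joint_events_measurable i : joint_events i `<=` measurable.
Proof.
move=> _ [A [B [FA mB ->]]]; apply: measurableI; first exact: mF.
exact: mpre.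
Qed.

Lemma joint_sigma_sub i : Defs.sub_sigma_algebra <<s joint_events i >>.
Proof.
split; first exact: smallest_sigma_algebra.
apply: smallest_sub; last exact: joint_events_measurable.
exact: sigma_algebra_measurable.
Qed.

Lemma F_joint i : F `<=` <<s joint_events i >>.
Proof.
move=> A FA; apply: sub_sigma_algebra; exists A, setT; split => //.
by rewrite preimage_setT setIT.
Qed.

Lemma X_joint i : measurable_wrt <<s joint_events i >> (X i).
Proof.
move=> B mB; apply: sub_sigma_algebra; exists setT, B; split => //.
  exact: F_setT.
by rewrite setTI.
Qed.

Definition square_integrable (Y : T -> R) : Prop :=
  measurable_fun [set: T] Y /\ P.-integrable setT (EFin \o (fun w => Y w ^+ 2)).

Lemma square_integrableM (Y Z : T -> R) : square_integrable Y ->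
  square_integrable Z -> P.-integrable setT (EFin \o (fun w => Y w * Z w)).
Proof.
move=> [mY iY] [mZ iZ].
apply: (@integrable_le _ _ _ P _ (fun w => Y w ^+ 2 + Z w ^+ 2)).
- exact: measurable_funM.
- move=> w; rewrite ler_norml; have := sqr_ge0 (Y w + Z w).
  by have := sqr_ge0 (Y w - Z w); nra.
- exact: integrable_add.
Qed.

Lemma square_integrable1 (Y : T -> R) : square_integrable Y ->
  P.-integrable setT (EFin \o Y).
Proof.
move=> sY; have s1 : square_integrable (fun=> 1).
  split; first exact: measurable_cst.
  exact: finite_measure_integrable_cst.
by apply: eq_integrable (square_integrableM sY s1) => // w _ /=; rewrite mulr1.
Qed.

Lemma F_bounded_orth (D Z : T -> R) (c : R) (A : set T) : F A ->
  P.-integrable setT (EFin \o D) -> vanishes_on P F D ->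
  measurable_wrt F Z -> (forall w, `|Z w| <= c) ->
  (\int[P]_(w in A) (Z w * D w)%:E = 0)%E.
Proof.
move=> FA iD vD mZ Zc.
have mA := mF FA.
rewrite -integral_indicM; under eq_integral do rewrite mulrA.
have mZ' := measurable_wrt_fun mF mZ.
apply: (vanishes_mul hF) => //.
  by apply: measurable_wrt_mul => //; exact: measurable_wrt_indic.
apply: (@integrable_boundedM _ _ _ P c) => //.
  by apply: measurable_funM => //; exact: measurable_indic.
move=> w; rewrite normrM; apply: le_trans (Zc w).
by rewrite ler_piMl // indic_le1.
Qed.

(** [Di] depends on the past and on [X i], [Dj] on the past and on [X j].  It is
    enough that [Dj] has integral zero over every event [A] of [F] intersected with
    an event of [X i].  There the indicator of the latter splits into its
    conditional probability given [F], to which [Dj] is orthogonal by assumption,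
    and a remainder, which by conditional independence is orthogonal to everything
    measurable with respect to [F] and [X j], hence to [Dj]. *)
Lemma cond_indep_orth i j (Di Dj : T -> R) : i != j ->
  measurable_wrt <<s joint_events i >> Di ->
  measurable_wrt <<s joint_events j >> Dj ->
  square_integrable Di -> square_integrable Dj -> vanishes_on P F Dj ->
  (\int[P]_w (Di w * Dj w)%:E = 0)%E.
Proof.
move=> ij mDi mDj sDi sDj vDj.
have iDj := square_integrable1 sDj.
suff vi : vanishes_on P <<s joint_events i >> Dj.
  by apply: (vanishes_mul (joint_sigma_sub i)) => //; exact: square_integrableM.
apply: vanishes_dynkin => //; [exact: joint_eventsI|exact: joint_eventsT|
  exact: joint_events_measurable|].
move=> _ [A [B [FA mB ->]]].
(* a version of the conditional probability of the event B for X i *)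
have [Z [_ [cZ _ bZ _ _]]] := cond_indep_pair ij mB (@measurableT _ U).
have [iB iZ mZ _] := cZ; have [iD vD] := cond_exp_vanishes hF cZ.
have mZ' := measurable_wrt_fun mF mZ.
have mA := mF FA; have mBi := mpre i mB.
(* conditionally on F, the event B is independent of what X j reveals *)
have vj : vanishes_on P <<s joint_events j >>
    (fun w => \1_(X i @^-1` B) w - Z w).
  apply: vanishes_dynkin => //; [exact: joint_eventsI|exact: joint_eventsT|
    exact: joint_events_measurable|].
  move=> _ [A' [B' [FA' mB' ->]]].
  have mA' := mF FA'; have mBj := mpre j mB'.
  have [Yi [Yj [ci cj bi bj prod]]] := cond_indep_pair ij mB mB'.
  have [_ _ mYi _] := ci; have [_ _ mYj _] := cj.
  have [iDi vDi] := cond_exp_vanishes hF ci.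
  have [iDj' vDj'] := cond_exp_vanishes hF cj.
  have mYi' := measurable_wrt_fun mF mYi.
  have mYj' := measurable_wrt_fun mF mYj.
  have e1 := F_bounded_orth FA' iDi vDi mYj bj.
  have e2 := F_bounded_orth FA' iD vD mYj bj.
  have e3 := F_bounded_orth FA' iDj' vDj' mZ bZ.
  have bnd (V W : T -> R) : measurable_fun [set: T] V ->
      measurable_fun [set: T] W -> (forall w, `|V w| <= 1) ->
      (forall w, `|W w| <= 1) -> P.-integrable A' (EFin \o (fun w => V w * W w)).
    move=> mV mW bV bW; apply: integrable_restrict_real => //.
    apply: (@integrable_boundedM _ _ _ P 1) => //.
    exact: (@integrable_bounded _ _ _ P 1).
  have fin (V W : T -> R) : measurable_fun [set: T] V ->
      measurable_fun [set: T] W -> (forall w, `|V w| <= 1) ->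
      (forall w, `|W w| <= 1) ->
      (\int[P]_(w in A') (V w * W w)%:E)%E \is a fin_num.
    by move=> mV mW bV bW; have := integrable_fin_num mA' (bnd _ _ mV mW bV bW).
  have m1 : measurable_fun [set: T] (\1_(X i @^-1` B) : T -> R).
    exact: measurable_indic.
  have m2 : measurable_fun [set: T] (\1_(X j @^-1` B') : T -> R).
    exact: measurable_indic.
  have b1 := @indic_le1 (X i @^-1` B).
  have b2 := @indic_le1 (X j @^-1` B').
  have split3 (V W Y : T -> R) : measurable_fun [set: T] V ->
      measurable_fun [set: T] W -> measurable_fun [set: T] Y ->
      (forall w, `|V w| <= 1) -> (forall w, `|W w| <= 1) ->
      (forall w, `|Y w| <= 1) ->
      (\int[P]_(w in A') (V w * (W w - Y w))%:E = 0)%E ->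
      (\int[P]_(w in A') (V w * W w)%:E = \int[P]_(w in A') (V w * Y w)%:E)%E.
    move=> mV mW mY bV bW bY.
    under eq_integral do rewrite mulrBr EFinB.
    rewrite (integralB_EFin mA' (bnd _ _ mV mW bV bW) (bnd _ _ mV mY bV bY)).
    by apply: sube0_eq; exact: fin.
  have {}e1 := split3 _ _ _ mYj' m1 mYi' bj b1 bi e1.
  have {}e2 := split3 _ _ _ mYj' m1 mZ' bj b1 bZ e2.
  have {}e3 := split3 _ _ _ mZ' m2 mYj' bZ b2 bj e3.
  transitivity (\int[P]_(w in A') (\1_(X j @^-1` B') w *
       (\1_(X i @^-1` B) w - Z w))%:E)%E.
    rewrite integral_mkcondr; apply: eq_integral => w _.
    rewrite /patch  [X in X * _]indicE; case: (w \in _); first by rewrite mul1r.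
    by rewrite mul0r.
  under eq_integral do rewrite mulrBr EFinB.
  rewrite (integralB_EFin mA' (bnd _ _ m2 m1 b2 b1) (bnd _ _ m2 mZ' b2 bZ)).
  have -> : (\int[P]_(w in A') (\1_(X j @^-1` B') w * Z w)%:E =
             \int[P]_(w in A') (\1_(X j @^-1` B') w * \1_(X i @^-1` B) w)%:E)%E.
    transitivity (\int[P]_(w in A') (Z w * \1_(X j @^-1` B') w)%:E)%E.
      by apply: eq_integral => w _; rewrite mulrC.
    rewrite e3; transitivity (\int[P]_(w in A') (Yj w * Z w)%:E)%E.
      by apply: eq_integral => w _; rewrite mulrC.
    rewrite -e2 e1; transitivity (\int[P]_(w in A') (Yi w * Yj w)%:E)%E.
      by apply: eq_integral => w _; rewrite mulrC.
    by rewrite -prod //; apply: eq_integral => w _; rewrite mulrC.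
  by rewrite subee // fin.
have mDj' : measurable_fun [set: T] Dj by case: sDj.
(* split the indicator of B into its conditional probability and the rest *)
have i1 : P.-integrable setT (EFin \o (fun w => \1_A w * Dj w)).
  apply: (@integrable_boundedM _ _ _ P 1) => // w; exact: indic_le1.
have i2 : P.-integrable setT
    (EFin \o (fun w => (\1_A w * Dj w) * (\1_(X i @^-1` B) w - Z w))).
  apply: eq_integrable (_ : P.-integrable setT (EFin \o
    (fun w => (\1_(X i @^-1` B) w - Z w) * (\1_A w * Dj w)))) => //.
    by move=> w _ /=; rewrite mulrC.
  apply: (@integrable_boundedM _ _ _ P 2) => //.
    exact: integrable_meas iD.
  move=> w; apply: (le_trans (ler_normB _ _)).
  by rewrite (_ : 2 = 1 + 1) // lerD ?indic_le1.
have i3 : P.-integrable setT (EFin \o (fun w => Z w * (\1_A w * Dj w))).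
  exact: (@integrable_boundedM _ _ _ P 1).
transitivity (\int[P]_w ((\1_A w * Dj w) * (\1_(X i @^-1` B) w - Z w)
    + Z w * (\1_A w * Dj w))%:E)%E.
  rewrite -integral_indicM; apply: eq_integral => w _.
  by rewrite indicI /=; congr EFin; ring.
under eq_integral do rewrite EFinD.
rewrite (integralD_EFin measurableT i2 i3).
rewrite (vanishes_mul (joint_sigma_sub j) iD vj _ i2) ?add0e; last first.
  have mA1 := measurable_wrt_sub (F_joint (i := j)) (measurable_wrt_indic FA).
  move: mA1 mDj => /(measurable_wrtP (joint_sigma_sub j).1) h1.
  move=> /(measurable_wrtP (joint_sigma_sub j).1) h2.
  exact/(measurable_wrtP (joint_sigma_sub j).1)/measurable_funM.
have := F_bounded_orth FA iDj vDj mZ bZ; rewrite -integral_indicM => h.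
by rewrite -[RHS]h; apply: eq_integral => w _; congr EFin; ring.
Qed.

End ConditionalIndependence.

(** * The spectral gap of the mixing matrix *)

Section SpectralGap.
Variables (R : realType) (n : nat).
Implicit Types u v w : 'rV[R]_n.

Definition dotv u v : R := \sum_i u 0 i * v 0 i.

Lemma dotvC u v : dotv u v = dotv v u.
Proof. by apply: eq_bigr => i _; rewrite mulrC. Qed.

Lemma dotvDl u v w : dotv (u + v) w = dotv u w + dotv v w.
Proof. by rewrite -big_split; apply: eq_bigr => i _; rewrite mxE mulrDl. Qed.

Lemma dotvZl c u v : dotv (c *: u) v = c * dotv u v.
Proof. by rewrite mulr_sumr; apply: eq_bigr => i _; rewrite mxE mulrA. Qed.

Lemma dotvDr u v w : dotv u (v + w) = dotv u v + dotv u w.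
Proof. by rewrite dotvC dotvDl !(dotvC u). Qed.

Lemma dotvZr c u v : dotv u (c *: v) = c * dotv u v.
Proof. by rewrite dotvC dotvZl dotvC. Qed.

Lemma dotv_ge0 u : 0 <= dotv u u.
Proof. by apply: sumr_ge0 => i _; rewrite -expr2 sqr_ge0. Qed.

Lemma dotv_eq0 u : dotv u u = 0 -> u = 0.
Proof.
move=> /eqP; rewrite psumr_eq0 => [/allP h|i _]; last by rewrite -expr2 sqr_ge0.
apply/rowP => i; rewrite mxE; have := h i (mem_index_enum _).
by rewrite /= mulf_eq0 orbb => /eqP.
Qed.

Variables (link : rel 'I_n) (W : 'M[R]_n) (lam : n.-tuple R).
Hypothesis net : network_assumption link W lam.

Lemma W_sym i j : W i j = W j i.
Proof. by rewrite -[in LHS](mix_sym net) mxE. Qed.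

Lemma W_row i : \sum_j W i j = 1.
Proof.
have := congr1 (fun M : 'cV[R]_n => M i 0) (mix_ones net); rewrite !mxE => <-.
by apply: eq_bigr => j _; rewrite mxE mulr1.
Qed.

Lemma W_col j : \sum_i W i j = 1.
Proof. by rewrite -(W_row j); apply: eq_bigr => i _; rewrite W_sym. Qed.

(** The form [2 <v, (I - W) v>]; written as a sum of squares it is visibly
    nonnegative, and by connectedness it vanishes only on constant vectors. *)
Definition dirichlet_form v : R := \sum_i \sum_j W i j * (v 0 i - v 0 j) ^+ 2.

Lemma dotv_W u v : dotv (u *m W) v = \sum_i \sum_j W i j * (u 0 i * v 0 j).
Proof.
rewrite exchange_big; apply: eq_bigr => j _ /=; rewrite mxE mulr_suml.
by apply: eq_bigr => i _; ring.
Qed.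

Lemma dotvW u v : dotv (u *m W) v = dotv u (v *m W).
Proof.
rewrite [RHS]dotvC !dotv_W exchange_big; apply: eq_bigr => i _ /=.
by apply: eq_bigr => j _; rewrite W_sym; ring.
Qed.

Lemma dirichlet_formE v : 2 * (dotv v v - dotv (v *m W) v) = dirichlet_form v.
Proof.
rewrite dotv_W.
have h1 : dotv v v = \sum_i \sum_j W i j * (v 0 i ^+ 2).
  by apply: eq_bigr => i _; rewrite -mulr_suml W_row mul1r expr2.
have h2 : dotv v v = \sum_i \sum_j W i j * (v 0 j ^+ 2).
  rewrite exchange_big; apply: eq_bigr => i _ /=.
  by rewrite -mulr_suml W_col mul1r expr2.
transitivity (dotv v v + dotv v v - 2 * \sum_i \sum_j W i j * (v 0 i * v 0 j)).
  by ring.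
rewrite {1}h1 h2 -big_split /= mulr_sumr -sumrB; apply: eq_bigr => i _.
rewrite -big_split /= mulr_sumr -sumrB; apply: eq_bigr => j _ /=; ring.
Qed.

Lemma dirichlet_form_ge0 v : 0 <= dirichlet_form v.
Proof.
apply: sumr_ge0 => i _; apply: sumr_ge0 => j _.
by rewrite mulr_ge0 ?sqr_ge0 // (mix_ge0 net).
Qed.

Lemma dirichlet_form_eq0 v : dirichlet_form v = 0 -> forall i j, v 0 i = v 0 j.
Proof.
have t0 i j : 0 <= W i j * (v 0 i - v 0 j) ^+ 2.
  by rewrite mulr_ge0 ?sqr_ge0 // (mix_ge0 net).
move=> /eqP; rewrite psumr_eq0 => [/allP h|i _]; last exact: sumr_ge0.
have lk i j : link i j -> v 0 i = v 0 j.
  move=> lij; have ne : i != j.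
    by apply/eqP => e; move: lij; rewrite e (link_irr net).
  have := h i (mem_index_enum _); rewrite /= psumr_eq0 => [/allP hi|k _]; last exact: t0.
  have := hi j (mem_index_enum _); rewrite /= mulf_eq0 sqrf_eq0 subr_eq0.
  by rewrite gt_eqF ?(mix_linked net) //= => /eqP.
move=> i j; have /connectP[s ps ->] := link_connected net i j.
elim: s i ps => //= k s IH i /andP[ik ps].
by rewrite (lk _ _ ik) IH.
Qed.

Lemma W_le v : dotv (v *m W) v <= dotv v v.
Proof. by have := dirichlet_form_ge0 v; rewrite -dirichlet_formE; lra. Qed.

Lemma W_ge0 v : 0 <= dotv (v *m W) v.
Proof.
have := mix_psd net v^T; rewrite trmxK mxE.
by congr (_ <= _); apply: eq_bigr => i _; rewrite [v^T _ _]mxE.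
Qed.

Definition balanced v := \sum_i v 0 i = 0.

Lemma balancedW v : balanced v -> balanced (v *m W).
Proof.
rewrite /balanced => bv; rewrite -[RHS]bv.
transitivity (\sum_i \sum_j v 0 j * W j i); first by apply: eq_bigr => i _; rewrite mxE.
rewrite exchange_big; apply: eq_bigr => i _ /=.
by rewrite -mulr_sumr W_row mulr1.
Qed.

Lemma balanced_comb c u v : balanced u -> balanced v -> balanced (u + c *: v).
Proof.
rewrite /balanced => bu bv; under eq_bigr do rewrite !mxE.
by rewrite big_split /= bu -mulr_sumr bv mulr0 addr0.
Qed.

Lemma continuous_coord (i : 'I_n) : continuous (fun v : 'rV[R]_n => v 0 i).
Proof. exact: coord_continuous. Qed.

Lemma continuous_sum_fun (I : Type) (s : seq I) (f : I -> 'rV[R]_n -> R) :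
  (forall i, continuous (f i)) -> continuous (fun v => \sum_(i <- s) f i v).
Proof.
move=> cf; elim: s => [|i s IH].
  rewrite (_ : (fun v => _) = cst 0); first exact: cst_continuous.
  by apply/funext => v; rewrite big_nil.
rewrite (_ : (fun v => _) = fun v => f i v + \sum_(j <- s) f j v).
  by move=> v; exact: (cvgD (cf i v) (IH v)).
by apply/funext => v; rewrite big_cons.
Qed.

Hypothesis n_ge2 : (2 <= n)%N.

Definition balanced_sphere : set 'rV[R]_n :=
  [set v | balanced v /\ dotv v v = 1].

Lemma balanced_sphere_nonempty : balanced_sphere !=set0.
Proof.
have h0 : (0 < n)%N by exact: leq_trans n_ge2.
pose i0 := Ordinal h0; pose i1 := Ordinal n_ge2.
pose v : 'rV[R]_n := delta_mx 0 i0 - delta_mx 0 i1.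
have ne : i0 != i1 by [].
have v0 : v 0 i0 = 1 by rewrite !mxE !eqxx /= subr0.
have v1 : v 0 i1 = -1 by rewrite !mxE !eqxx /= sub0r.
have vk k : k != i0 -> k != i1 -> v 0 k = 0.
  by move=> /negbTE k0 /negbTE k1; rewrite !mxE k0 k1 subrr.
have dv : dotv v v = 2.
  rewrite /dotv (bigD1 i0) //= (bigD1 i1) //= big1 => [|k /andP[k0 k1]].
    by rewrite v0 v1; ring.
  by rewrite vk // mul0r.
exists ((Num.sqrt 2)^-1 *: v); split.
  rewrite /balanced (bigD1 i0) //= (bigD1 i1) //= big1 => [|k /andP[k0 k1]].
    by rewrite [X in X + _]mxE [X in _ + (X + _)]mxE v0 v1; ring.
  by rewrite mxE vk // mulr0.
by rewrite dotvZl dotvZr dv mulrA -expr2 exprVn sqr_sqrtr // mulVf.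
Qed.

Lemma balanced_sphere_compact : compact balanced_sphere.
Proof.
apply: bounded_closed_compact.
  exists 1; split; first exact: num_real.
  move=> M M1 v [_ dv]; apply: (le_trans _ (ltW M1)).
  rewrite /Num.norm /= mx_normrE; apply: bigmax_le => // -[i j] _ /=.
  rewrite -(@expr_le1 _ 2) // real_normK ?num_real // -dv.
  rewrite /dotv (bigD1 j) //= (ord1 i) -expr2 lerDl.
  by apply: sumr_ge0 => k _; rewrite -expr2 sqr_ge0.
have c1 : continuous (fun v : 'rV[R]_n => \sum_i v 0 i).
  by apply: continuous_sum_fun => i; exact: continuous_coord.
have c2 : continuous (fun v => dotv v v).
  apply: continuous_sum_fun => i v.
  exact: (cvgM (@continuous_coord i v) (@continuous_coord i v)).
have -> : balanced_sphere = (fun v : 'rV[R]_n => \sum_i v 0 i) @^-1` [set 0] `&`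
                            (fun v => dotv v v) @^-1` [set 1].
  by [].
by apply: closedI; apply: closed_comp.
Qed.

(** The quotient [<v W, v> / <v, v>] attains its maximum on the compact unit
    sphere of vectors of zero sum, and the maximizer is an eigenvector.  Its
    eigenvalue is not 1, because the eigenvectors for 1 are constant; so it is an
    entry of the sorted list of eigenvalues beyond the first. *)
Lemma eig_second_bound v : balanced v ->
  dotv (v *m W) v <= lam`_1 * dotv v v.
Proof.
have cq : continuous (fun v => dotv (v *m W) v).
  rewrite (_ : (fun v => _) = fun v => \sum_i \sum_j W i j * (v 0 i * v 0 j));
    last by apply/funext => u; rewrite dotv_W.
  apply: continuous_sum_fun => i; apply: continuous_sum_fun => j u.
  exact: (cvgMr (cvgM (@continuous_coord i u) (@continuous_coord j u))).
have [v0 /set_mem[b0 d0] hmax] := EVT_max_rV balanced_sphere_nonempty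
  balanced_sphere_compact (continuous_subspaceT cq).
set mu := dotv (v0 *m W) v0 in hmax.
have hmu w : balanced w -> dotv (w *m W) w <= mu * dotv w w.
  move=> bw; have [w0|wn0] := eqVneq (dotv w w) 0.
    by rewrite (dotv_eq0 w0) mul0mx /dotv !big1 ?mulr0 // => i _; rewrite !mxE mul0r.
  have wp : 0 < dotv w w by rewrite lt_neqAle eq_sym wn0 dotv_ge0.
  have sp : 0 < Num.sqrt (dotv w w) by rewrite sqrtr_gt0.
  have mem : (Num.sqrt (dotv w w))^-1 *: w \in balanced_sphere.
    apply/mem_set; split.
      rewrite /balanced; under eq_bigr do rewrite mxE.
      by rewrite -mulr_sumr bw mulr0.
    by rewrite dotvZl dotvZr mulrA -expr2 exprVn sqr_sqrtr ?dotv_ge0 // mulVf.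
  have := hmax _ mem; rewrite -scalemxAl dotvZl dotvZr mulrA -expr2 exprVn.
  by rewrite sqr_sqrtr ?dotv_ge0 // ler_pdivrMl // mulrC.
(* the residual of the eigenvector equation: if it were not zero, moving [v0]
   slightly against it would increase the quotient *)
have [w wE] : exists w, w = mu *: v0 - v0 *m W by exists (mu *: v0 - v0 *m W).
have bw : balanced w.
  have -> : w = (0 + mu *: v0) + (-1) *: (v0 *m W).
    by rewrite wE add0r scaleN1r.
  apply: balanced_comb; last exact: balancedW.
  by apply: balanced_comb => //; rewrite /balanced big1 // => i _; rewrite mxE.
have ww : mu * dotv v0 w - dotv (v0 *m W) w = dotv w w.
  have -> : dotv w w = dotv (mu *: v0 + (-1) *: (v0 *m W)) w.
    by rewrite wE scaleN1r -wE.
  by rewrite dotvDl !dotvZl mulN1r.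
have w0 : dotv w w = 0.
  apply/eqP; rewrite eq_le dotv_ge0 andbT leNgt; apply/negP => wp.
  set c := dotv w w in wp ww.
  pose c' := mu * c - dotv (w *m W) w.
  have c'0 : 0 <= c' by rewrite subr_ge0 hmu.
  pose t := - c / (c' + 1).
  have bt : balanced (v0 + t *: w).
    exact: balanced_comb.
  have := hmu _ bt.
  rewrite mulmxDl -scalemxAl !(dotvDl, dotvDr, dotvZl, dotvZr) d0.
  rewrite [dotv (w *m W) v0]dotvW [dotv w (v0 *m W)]dotvC (dotvC w v0) -/mu -/c.
  have e1 : dotv (v0 *m W) w = mu * dotv v0 w - c by rewrite -ww; ring.
  have e2 : dotv (w *m W) w = mu * c - c' by rewrite /c'; ring.
  rewrite e1 e2 => h.
  have {}h : 0 <= 2 * t * c + t * (t * c') by lra.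
  have tE : t * (c' + 1) = - c by rewrite /t divfK //; lra.
  have t0 : t < 0 by rewrite /t mulNr oppr_lt0 divr_gt0 //; lra.
  have e3 : t * c' = - c - t by lra.
  rewrite e3 in h; nra.
have eig : v0 *m W = mu *: v0.
  by apply/eqP; rewrite eq_sym -subr_eq0 -wE (dotv_eq0 w0).
have v0n0 : v0 != 0.
  apply/eqP => e; move: d0; rewrite e /dotv big1 => [|i _].
    by move/eqP; rewrite eq_sym oner_eq0.
  by rewrite mxE mul0r.
have mu_lam : mu \in (lam : seq R).
  have : eigenvalue W mu by apply/eigenvalueP; exists v0.
  by rewrite eigenvalue_root_char (eig_char net) root_prod_XsubC.
have mu_ne1 : mu != 1.
  apply/eqP => e; have : dirichlet_form v0 = 0.
    by rewrite -dirichlet_formE -/mu e d0 subrr mulr0.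
  move/dirichlet_form_eq0 => hc.
  move/eqP: v0n0; apply; apply/rowP => i; rewrite mxE.
  have : n%:R * v0 0 i = 0.
    have := b0; rewrite /balanced (eq_bigr (fun=> v0 0 i)) => [|k _]; last exact: hc.
    by rewrite big_const card_ord iter_addr addr0 mulr_natl.
  move/eqP; rewrite mulf_eq0 pnatr_eq0.
  by rewrite eqn0Ngt (ltnW n_ge2) /= => /eqP.
move=> bv; apply: (le_trans (hmu _ bv)); rewrite ler_wpM2r ?dotv_ge0 //.
have /(nthP 0)[k klt kE] := mu_lam.
have k0 : (0 < k)%N.
  by case: k klt kE => // _ e; move: mu_ne1; rewrite -e (eig_first net) eqxx.
rewrite -kE.
have tr : transitive (fun a b : R => b <= a).
  by move=> a b c ba cb; exact: le_trans cb ba.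
have rf : reflexive (fun a b : R => b <= a) by move=> a; exact: lexx.
apply: (sorted_leq_nth tr rf 0 (eig_sorted net)) => //.
  by rewrite inE size_tuple.
Qed.

End SpectralGap.

(** * Measurability of random vectors *)

Section VectorMeasurability.
Variables (R : realType) (p : nat).

Definition rat_ball (q : 'rV[rat]_p * nat) : set 'rV[R]_p :=
  [set v | forall j, `|ratr (q.1 0 j) - v 0 j| < q.2.+1%:R^-1].

(** An open set is a countable union of boxes of rational centre; this is what
    lets measurability pass from coordinates to vectors. *)
Lemma open_rat_balls (B : set 'rV[R]_p) : open B ->
  B = \bigcup_(q : 'rV[rat]_p * nat)
        [set v | rat_ball q `<=` B /\ rat_ball q v].
Proof.
move=> oB; apply/seteqP; split => [v Bv|v [q _ [qB]]]; last exact: qB.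
have /nbhs_ballP[e /= e0 eB] : nbhs v B by exact: open_nbhs_nbhs.
have e2 : 0 < e / 2 by rewrite divr_gt0.
have [k] := ltr_add_invr e2; rewrite add0r => ke.
have ex (j : 'I_p) : exists q : rat, ratr q \in `]v 0 j, v 0 j + k.+1%:R^-1[.
  by apply: rat_in_itvoo; rewrite ltrDl invr_gt0.
have [q hq] := choice ex.
exists (\row_j q j, k) => //=.
have near_q j : `|ratr (q j) - v 0 j| < k.+1%:R^-1.
  have := hq j; rewrite in_itv /= => /andP[h1 h2].
  by rewrite gtr0_norm ?subr_gt0 // ltrBlDl.
split; last by move=> j /=; rewrite mxE.
move=> u hu; apply: eB; split=> // i j; rewrite (ord1 i) /ball /=.
have := hu j; rewrite /= mxE => h1; have h2 := near_q j.
rewrite (_ : v 0 j - u 0 j = (ratr (q j) - u 0 j) - (ratr (q j) - v 0 j)); last by ring.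
apply: (le_lt_trans (ler_normB _ _)); apply: (lt_trans (ltrD h1 h2)).
by rewrite (splitr e) ltrD.
Qed.

Variables (d : measure_display) (T : measurableType d) (F : set (set T)).
Hypothesis sF : sigma_algebra setT F.

Let Fmeas : @measurable _ (g_sigma_algebraType F) = F.
Proof. exact: sigma_algebra_id. Qed.

Lemma measurable_wrt_row (Y : T -> 'rV[R]_p) :
  (forall j, measurable_wrt F (fun w => Y w 0 j)) ->
  measurable_wrt F (Y : T -> borel_rV R p).
Proof.
move=> mY; apply/(measurable_wrtP sF).
apply: (@measurability _ _ (g_sigma_algebraType F) (borel_rV R p) setT Y
  (@open 'rV[R]_p)) => //.
move=> _ [B oB <-]; rewrite setTI (open_rat_balls oB) preimage_bigcup.
apply: countable_bigcupT_measurable => // q.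
have [qB|nqB] := pselect (rat_ball q `<=` B); last first.
  rewrite (_ : _ @^-1` _ = set0) //.
  by apply/seteqP; split => w //= -[].
rewrite (_ : _ @^-1` _ = \bigcap_(j in [set: 'I_p])
  ((fun w => Y w 0 j) @^-1` `]ratr (q.1 0 j) - q.2.+1%:R^-1,
                              ratr (q.1 0 j) + q.2.+1%:R^-1[)).
  apply: fin_bigcap_measurable => // j _.
  by rewrite Fmeas; apply: mY; exact: measurable_itv.
apply/seteqP; split => w /=.
  move=> [_ h] j _ /=; rewrite in_itv /=; have := h j.
  by rewrite ltr_distlC.
move=> h; split => // j; have := h j Logic.I; rewrite /= in_itv /=.
by rewrite ltr_distlC.
Qed.

Lemma measurable_wrt_comp (Y : T -> 'rV[R]_p) (h : 'rV[R]_p -> R) :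
  continuous h -> measurable_wrt F (Y : T -> borel_rV R p) ->
  measurable_wrt F (fun w => h (Y w)).
Proof.
move=> ch mY; apply/(measurable_wrtP sF).
apply: (@measurability _ _ (g_sigma_algebraType F) _ setT _ _
  (RGenOInfty.measurableE R)).
move=> _ [_ [x ->] <-]; rewrite setTI Fmeas.
have oh : open (h @^-1` `]x, +oo[%classic).
  by apply: open_comp => // ? _; exact: ch.
apply: (mY (h @^-1` `]x, +oo[%classic)).
exact: (@sub_sigma_algebra _ setT (@open 'rV[R]_p) _ oh).
Qed.

Lemma measurable_wrt_coord (Y : T -> 'rV[R]_p) (j : 'I_p) :
  measurable_wrt F (Y : T -> borel_rV R p) ->
  measurable_wrt F (fun w => Y w 0 j).
Proof.
exact: (@measurable_wrt_comp Y (fun v => v 0 j) (@coord_continuous _ _ _ 0 j)).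
Qed.

Lemma measurable_wrt_pair (dA dB dC : measure_display) (A : measurableType dA)
    (B : measurableType dB) (C : measurableType dC) (h : A * B -> C)
    (X : T -> A) (Y : T -> B) : measurable_fun [set: A * B] h ->
  measurable_wrt F X -> measurable_wrt F Y ->
  measurable_wrt F (fun w => h (X w, Y w)).
Proof.
move=> mh /(measurable_wrtP sF) mX /(measurable_wrtP sF) mY.
apply/(measurable_wrtP sF).
have := @measurable_fun_pair _ _ _ (g_sigma_algebraType F) A B X Y mX mY.
exact: measurableT_comp.
Qed.

End VectorMeasurability.

(** * Smooth functions *)

Section Smoothness.
Variables (R : realType) (p : nat).
Implicit Types (x y v : 'rV[R]_p) (f : 'rV[R]_p -> R).

Lemma fnorm_sq m n (A : 'M[R]_(m, n)) :
  fnorm A ^+ 2 = \sum_(i < m) \sum_(j < n) A i j ^+ 2.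
Proof.
rewrite /fnorm sqr_sqrtr //.
by apply: sumr_ge0 => i _; apply: sumr_ge0 => j _; rewrite sqr_ge0.
Qed.

Lemma fnorm_row x : fnorm x ^+ 2 = dotv x x.
Proof. by rewrite fnorm_sq big_ord1; apply: eq_bigr => j _; rewrite expr2. Qed.

Lemma grad_dir f x v : differentiable f x -> 'D_v f x = dotv (grad f x) v.
Proof.
move=> df; rewrite deriveE // [in LHS](row_sum_delta v) linear_sum.
apply: eq_bigr => j _; rewrite linearZ /= mxE -deriveE //.
by rewrite mulrC.
Qed.

Lemma lipschitz_gradient_sq L f x y : 0 < L -> lipschitz_gradient L f ->
  dotv (grad f x - grad f y) (grad f x - grad f y)
    <= L ^+ 2 * dotv (x - y) (x - y).
Proof.
move=> L0 [_ lf]; rewrite -!fnorm_row -exprMn ler_sqr ?nnegrE ?mulr_ge0 ?sqrtr_ge0 //.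
exact: ltW.
Qed.

Lemma derive_line f x v (s : R) : differentiable f (x + s *: v) ->
  is_derive s 1 (fun t : R => f (x + t *: v)) (dotv (grad f (x + s *: v)) v).
Proof.
move=> df; rewrite -grad_dir //.
have E : (fun h : R => h^-1 *: (((fun t : R => f (x + t *: v)) \o shift s) (h *: 1)
                       - f (x + s *: v))) =
         (fun h : R => h^-1 *: ((f \o shift (x + s *: v)) (h *: v) - f (x + s *: v))).
  apply/funext => h /=; congr (_ *: (f _ - _)).
  by rewrite [h *: 1]mulr1 scalerDl addrCA.
have dv := diff_derivable (v := v) df.
split; first by rewrite /derivable E.
by rewrite /derive E.
Qed.

(** Along the segment the difference between [f] and its quadratic majorant has a
    nonpositive derivative. *)
Lemma smooth_upper_bound L f x v : 0 < L -> lipschitz_gradient L f ->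
  f (x + v) <= f x + dotv (grad f x) v + L / 2 * dotv v v.
Proof.
move=> L0 lf; have df := lf.1.
pose c := dotv (grad f x) v; pose q := dotv v v.
have q0 : 0 <= q := dotv_ge0 v.
pose phi (s : R) := f (x + s *: v) + (- c * s + - (L / 2 * q) * (s * s)).
have dphi (s : R) : is_derive s 1 phi
    (dotv (grad f (x + s *: v)) v + (- c * 1 + - (L / 2 * q) * (s * 1 + s * 1))).
  have d1 := derive_line (df (x + s *: v)).
  have did : is_derive s (1 : R) (fun t : R => t) 1 by exact: is_derive_id.
  have d2 : is_derive s (1 : R) (fun t : R => - c * t) (- c * 1).
    exact: (is_deriveZ (- c) did).
  have d3 : is_derive s (1 : R) (fun t : R => - (L / 2 * q) * (t * t))
      (- (L / 2 * q) * (s * 1 + s * 1)).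
    exact: (is_deriveZ (- (L / 2 * q)) (is_deriveM did did)).
  exact: (is_deriveD d1 (is_deriveD d2 d3)).
have : phi 1 <= phi 0.
  apply: (@ler0_derive1_nincr R phi 0 1) => //.
  - move=> s; rewrite in_itv /= => /andP[s0 s1].
    rewrite derive1E (derive_val (is_derive := dphi s)).
    have -> : dotv (grad f (x + s *: v)) v
        = dotv (grad f (x + s *: v) - grad f x) v + c.
      by rewrite -dotvDl subrK.
    have := lipschitz_gradient_sq (x + s *: v) x L0 lf.
    rewrite (_ : x + s *: v - x = s *: v); last by rewrite addrAC subrr add0r.
    move: (grad f (x + s *: v) - grad f x) => w.
    have := dotv_ge0 (w + (- (L * s)) *: v).
    rewrite !(dotvDl, dotvDr, dotvZl, dotvZr) (dotvC v w) -/q => h1 h2.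
    have Ls : 0 < L * s by rewrite mulr_gt0.
    have : (L * s) * dotv w v <= (L * s) * ((L * s) * q) by nra.
    by rewrite ler_pM2l //; lra.
  - apply: continuous_subspaceT => s.
    have [dd _] := dphi s; apply: differentiable_continuous.
    exact/derivable1_diffP.
by rewrite /phi scale1r scale0r addr0 /c /q; lra.
Qed.

(** The topology of row vectors comes from the maximum norm; the square of the
    Euclidean norm is at most [p] times the square of that norm. *)
Lemma sq_lipschitz_continuous (c : R) (h : 'rV[R]_p -> R) :
  (forall x y, (h x - h y) ^+ 2 <= c ^+ 2 * dotv (x - y) (x - y)) ->
  continuous h.
Proof.
move=> hc x.
apply: (proj2 (@cvgrPdist_lt _ _ _ _ (nbhs_filter x) h (h x))) => e e0.
pose D := `|c| * p.+1%:R + 1.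
have D0 : 0 < D by rewrite ltr_wpDl // mulr_ge0.
apply/nbhs_ballP; exists (e / D) => [|y hy] /=; first by rewrite /= divr_gt0.
rewrite -ltr_sqr ?nnegrE ?normr_ge0 // ?(ltW e0) // real_normK ?num_real //.
apply: (le_lt_trans (hc _ _)).
have hj j : (x - y) 0 j ^+ 2 <= (e / D) ^+ 2.
  case: hy => _ /(_ 0 j) /=; rewrite /ball /= !mxE => hj.
  rewrite -[X in X <= _]real_normK ?num_real // ler_sqr ?nnegrE //.
    exact: ltW.
  exact: ltW (divr_gt0 e0 D0).
have : dotv (x - y) (x - y) <= p%:R * (e / D) ^+ 2.
  rewrite mulr_natl -[in X in _ *+ X](card_ord p) -sumr_const.
  by apply: ler_sum => j _; rewrite -expr2 hj.
move=> hp; apply: (le_lt_trans (ler_wpM2l (sqr_ge0 c) hp)).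
have -> : c ^+ 2 * (p%:R * (e / D) ^+ 2) = e ^+ 2 * ((c ^+ 2 * p%:R) / D ^+ 2).
  by field; rewrite gt_eqF.
rewrite gtr_pMr ?exprn_gt0 // ltr_pdivrMr ?exprn_gt0 // mul1r.
rewrite -(real_normK (num_real c)) /D -(natr1 p).
have a0 := normr_ge0 c; have p0 : 0 <= (p%:R : R) by [].
have := mulr_ge0 a0 p0; have := mulr_ge0 (mulr_ge0 a0 a0) p0.
have := mulr_ge0 (mulr_ge0 (mulr_ge0 a0 a0) p0) p0; nra.
Qed.

Lemma grad_continuous L f (j : 'I_p) : 0 < L -> lipschitz_gradient L f ->
  continuous (fun x => grad f x 0 j).
Proof.
move=> L0 lf; apply: (@sq_lipschitz_continuous L) => x y.
apply: le_trans (lipschitz_gradient_sq x y L0 lf).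
rewrite /dotv (bigD1 j) //= -expr2 !mxE lerDl.
by apply: sumr_ge0 => k _; rewrite -expr2 sqr_ge0.
Qed.

Variables (n : nat) (f : 'I_n -> 'rV[R]_p -> R).
Hypothesis df : forall i x, differentiable (f i) x.

Lemma grad_avg x : grad (avg_fun f) x = n%:R^-1 *: \sum_i grad (f i) x.
Proof.
apply/rowP => j; rewrite !mxE summxE.
have -> : avg_fun f = n%:R^-1 *: (\sum_(i < n) f i).
  by apply/funext => y; rewrite /avg_fun /= fct_sumE.
rewrite deriveZ; last by apply: derivable_sum => i; exact: diff_derivable.
rewrite derive_sum; last by move=> i; exact: diff_derivable.
by congr (_ * _); apply: eq_bigr => i _; rewrite mxE.
Qed.

Lemma avg_fun_continuous : continuous (avg_fun f).
Proof.
have -> : avg_fun f = (fun x => n%:R^-1 * \sum_(i < n) f i x) by [].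
have cf : continuous (fun x => \sum_(i < n) f i x).
  by apply: continuous_sum_fun => i y; exact: differentiable_continuous.
by move=> x; exact: (cvgMr (cf x)).
Qed.

Lemma avg_upper_bound L x v : 0 < L -> (forall i, lipschitz_gradient L (f i)) ->
  (0 < n)%N ->
  avg_fun f (x + v) <= avg_fun f x + dotv (grad (avg_fun f) x) v + L / 2 * dotv v v.
Proof.
move=> L0 lf n0; rewrite grad_avg dotvZl.
have nn : (n%:R : R) != 0 by rewrite pnatr_eq0 -lt0n.
have -> : L / 2 * dotv v v = n%:R^-1 * \sum_(i < n) (L / 2 * dotv v v).
  by rewrite big_const card_ord iter_addr addr0 -[X in _ = _ * X]mulr_natl mulrA mulVf // mul1r.
have -> : dotv (\sum_i grad (f i) x) v = \sum_i dotv (grad (f i) x) v.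
  rewrite /dotv exchange_big; apply: eq_bigr => j _ /=.
  by rewrite summxE mulr_suml.
rewrite /avg_fun -!mulrDr -!big_split /= ler_wpM2l ?invr_ge0 //.
by apply: ler_sum => i _; exact: smooth_upper_bound.
Qed.

End Smoothness.

(** * The space of square-integrable random matrices *)

Section SquareIntegrable.
Variables (R : realType) (d : measure_display) (T : measurableType d).
Variable (P : probability T R).

Lemma square_integrable_le (X Y : T -> R) : measurable_fun [set: T] X ->
  (forall w, X w ^+ 2 <= Y w) -> P.-integrable setT (EFin \o Y) ->
  square_integrable P X.
Proof.
move=> mX XY iY; split => //; apply: (integrable_le _ _ iY).
  exact: measurable_funX.
by move=> w; rewrite ger0_norm ?sqr_ge0.
Qed.

Lemma square_integrableZ (c : R) (X : T -> R) : square_integrable P X ->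
  square_integrable P (fun w => c * X w).
Proof.
move=> [mX iX]; apply: (square_integrable_le (Y := fun w => c ^+ 2 * X w ^+ 2)).
- by apply: measurable_funM => //; exact: measurable_cst.
- by move=> w; rewrite exprMn.
- exact: integrable_scale.
Qed.

Lemma square_integrableD (X Y : T -> R) : square_integrable P X ->
  square_integrable P Y -> square_integrable P (fun w => X w + Y w).
Proof.
move=> [mX iX] [mY iY].
apply: (square_integrable_le (Y := fun w => 2 * X w ^+ 2 + 2 * Y w ^+ 2)).
- exact: measurable_funD.
- by move=> w; have := sqr_ge0 (X w - Y w); lra.
- by apply: integrable_add; exact: integrable_scale.
Qed.

Lemma square_integrable_cst (c : R) : square_integrable P (fun=> c).
Proof.
split; first exact: measurable_cst.
exact: finite_measure_integrable_cst.
Qed.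

Lemma square_integrable_sum (I : Type) (s : seq I) (X : I -> T -> R) :
  (forall i, square_integrable P (X i)) ->
  square_integrable P (fun w => \sum_(i <- s) X i w).
Proof.
move=> hX; elim: s => [|i s IH].
  rewrite (_ : (fun w => _) = fun=> 0); first exact: square_integrable_cst.
  by apply/funext => w; rewrite big_nil.
rewrite (_ : (fun w => _) = fun w => X i w + \sum_(j <- s) X j w).
  exact: square_integrableD.
by apply/funext => w; rewrite big_cons.
Qed.

Lemma integrable_big (I : Type) (s : seq I) (X : I -> T -> R) :
  (forall i, P.-integrable setT (EFin \o X i)) ->
  P.-integrable setT (EFin \o (fun w => \sum_(i <- s) X i w)).
Proof.
move=> hX; elim: s => [|i s IH].
  rewrite (_ : _ \o _ = EFin \o cst 0); first exact: finite_measure_integrable_cst.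
  by apply/funext => w /=; rewrite big_nil.
rewrite (_ : _ \o _ = EFin \o (fun w => X i w + \sum_(j <- s) X j w)).
  exact: integrable_add.
by apply/funext => w /=; rewrite big_cons.
Qed.

End SquareIntegrable.

Section MatrixDot.
Variables (R : realType) (n p : nat).
Implicit Types X Y Z : 'M[R]_(n, p).

Definition mdot X Y : R := \sum_i \sum_j X i j * Y i j.

Lemma mdot_rows X Y : mdot X Y = \sum_i dotv (row i X) (row i Y).
Proof. by apply: eq_bigr => i _; apply: eq_bigr => j _; rewrite !mxE. Qed.

Lemma mdot_cols X Y : mdot X Y = \sum_j dotv (col j X)^T (col j Y)^T.
Proof.
by rewrite /mdot exchange_big; apply: eq_bigr => j _; apply: eq_bigr => i _; rewrite !mxE.
Qed.

Lemma mdotC X Y : mdot X Y = mdot Y X.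
Proof. by apply: eq_bigr => i _; apply: eq_bigr => j _; rewrite mulrC. Qed.

Lemma mdotDl X Y Z : mdot (X + Y) Z = mdot X Z + mdot Y Z.
Proof.
rewrite /mdot -big_split; apply: eq_bigr => i _.
by rewrite -big_split; apply: eq_bigr => j _; rewrite mxE mulrDl.
Qed.

Lemma mdotZl c X Y : mdot (c *: X) Y = c * mdot X Y.
Proof.
rewrite /mdot mulr_sumr; apply: eq_bigr => i _.
by rewrite mulr_sumr; apply: eq_bigr => j _; rewrite mxE mulrA.
Qed.

Lemma mdotDr X Y Z : mdot X (Y + Z) = mdot X Y + mdot X Z.
Proof. by rewrite mdotC mdotDl !(mdotC X). Qed.

Lemma mdotZr c X Y : mdot X (c *: Y) = c * mdot X Y.
Proof. by rewrite mdotC mdotZl mdotC. Qed.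

Lemma mdot_ge0 X : 0 <= mdot X X.
Proof. by rewrite mdot_rows sumr_ge0 // => i _; exact: dotv_ge0. Qed.

Lemma fnorm_mdot X : fnorm X ^+ 2 = mdot X X.
Proof. by rewrite fnorm_sq; apply: eq_bigr => i _; apply: eq_bigr => j _; rewrite expr2. Qed.

Lemma mdot_mulmx (A : 'M[R]_n) X Y : mdot (A *m X) Y = mdot X (A^T *m Y).
Proof.
transitivity (\tr (Y^T *m (A *m X))).
  rewrite /mxtrace /mdot exchange_big; apply: eq_bigr => j _ /=.
  by rewrite mxE; apply: eq_bigr => i _; rewrite !mxE mulrC.
rewrite mulmxA -mxtrace_tr !trmx_mul trmxK /mxtrace /mdot exchange_big.
apply: eq_bigr => j _ /=.
by rewrite mxE; apply: eq_bigr => i _; rewrite !mxE.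
Qed.

End MatrixDot.

Section RandomMatrices.
Variables (R : realType) (d : measure_display) (T : measurableType d).
Variables (P : probability T R) (n p : nat).

Definition sq_mx : {pred (T -> 'M[R]_(n, p))} :=
  fun X => `[< forall i j, square_integrable P (fun w => X w i j) >].

Lemma sq_mxP (X : T -> 'M[R]_(n, p)) : reflect (forall i j, square_integrable P (fun w => X w i j))
  (X \in sq_mx).
Proof. exact: asboolP. Qed.

Lemma sq_mx_submod : GRing.submod_closed sq_mx.
Proof.
split.
  apply/sq_mxP => i j; rewrite (_ : (fun w => _) = fun=> 0).
    exact: square_integrable_cst.
  by apply/funext => w; rewrite mxE.
move=> c X Y /sq_mxP hX /sq_mxP hY; apply/sq_mxP => i j.
rewrite (_ : (fun w => _) = fun w => c * X w i j + Y w i j).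
  by apply: square_integrableD => //; exact: square_integrableZ.
by apply/funext => w; rewrite !mxE.
Qed.

HB.instance Definition _ :=
  GRing.isSubmodClosed.Build R (T -> 'M[R]_(n, p)) sq_mx sq_mx_submod.

(** Functions, not classes of functions modulo almost sure equality: every value
    [rval X w] can be used, and [rdot] is only positive semidefinite. *)
Record rmatrix := RMatrix { rval : T -> 'M[R]_(n, p); rvalP : rval \in sq_mx }.

HB.instance Definition _ := [isSub for rval].
HB.instance Definition _ := [Choice of rmatrix by <:].
HB.instance Definition _ := [SubChoice_isSubLmodule of rmatrix by <:].

End RandomMatrices.

Section RandomMatrixSpace.
Variables (R : realType) (d : measure_display) (T : measurableType d).
Variables (P : probability T R) (n p : nat).
Local Notation V := (rmatrix P n p).
Implicit Types X Y Z : V.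

Lemma rvalD X Y w : rval (X + Y) w = rval X w + rval Y w. Proof. by []. Qed.
Lemma rvalZ c X w : rval (c *: X) w = c *: rval X w. Proof. by []. Qed.
Lemma rval0 w : rval (0 : V) w = 0. Proof. by []. Qed.

Lemma rval_inj X Y : (forall w, rval X w = rval Y w) -> X = Y.
Proof. by move=> h; apply: val_inj; apply/funext. Qed.

Lemma rval_sq X i j : square_integrable P (fun w => rval X w i j).
Proof. by have /sq_mxP := rvalP X; exact. Qed.

Definition rdot X Y : R := \int[P]_w mdot (rval X w) (rval Y w).

Lemma mdot_integrable X Y :
  P.-integrable setT (EFin \o (fun w => mdot (rval X w) (rval Y w))).
Proof.
apply: integrable_big => i; apply: integrable_big => j.
by apply: square_integrableM; exact: rval_sq.
Qed.

Lemma rdot_semi_inner : semi_inner rdot.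
Proof.
split; rewrite /rdot.
- by move=> X Y; apply: eq_Rintegral => w _; exact: mdotC.
- move=> X Y Z; rewrite -RintegralD //; [|exact: mdot_integrable..].
  by apply: eq_Rintegral => w _; rewrite rvalD mdotDl.
- move=> c X Y; rewrite -RintegralZl //; last exact: mdot_integrable.
  by apply: eq_Rintegral => w _; rewrite rvalZ mdotZl.
- by move=> X; apply: Rintegral_ge0 => w _; exact: mdot_ge0.
Qed.

Lemma rdot_le X Y X' Y' c :
  (forall w, mdot (rval X w) (rval Y w) <= c * mdot (rval X' w) (rval Y' w)) ->
  rdot X Y <= c * rdot X' Y'.
Proof.
move=> h; rewrite /rdot -RintegralZl //; last exact: mdot_integrable.
apply: le_Rintegral => //; first exact: mdot_integrable.
exact/integrable_scale/mdot_integrable.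
Qed.

Lemma mul_sq (A : 'M[R]_n) X : (fun w => A *m rval X w) \in @sq_mx R d T P n p.
Proof.
apply/sq_mxP => i j.
rewrite (_ : (fun w => _) = fun w => \sum_k A i k * rval X w k j).
  by apply: square_integrable_sum => k; exact/square_integrableZ/rval_sq.
by apply/funext => w; rewrite mxE.
Qed.

Definition rmul (A : 'M[R]_n) X : V := RMatrix (mul_sq A X).

Lemma rmul_linear A : linear (rmul A).
Proof.
move=> c X Y; apply: rval_inj => w.
change (A *m (c *: rval X w + rval Y w) = c *: (A *m rval X w) + A *m rval Y w).
by rewrite mulmxDr -scalemxAr.
Qed.

HB.instance Definition _ A := GRing.isLinear.Build R V V *:%R (rmul A) (rmul_linear A).

Definition rmulL (A : 'M[R]_n) : {linear V -> V} := rmul A.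

Lemma rmulLE A X w : rval (rmulL A X) w = A *m rval X w.
Proof. by []. Qed.

Lemma rmulC A X Y : A^T = A -> rdot (rmulL A X) Y = rdot X (rmulL A Y).
Proof.
move=> AT; apply: eq_Rintegral => w _; rewrite !rmulLE mdot_mulmx AT //.
Qed.

Variables (link : rel 'I_n) (W : 'M[R]_n) (lam : n.-tuple R).
Hypothesis net : network_assumption link W lam.
Hypothesis n_ge2 : (2 <= n)%N.
Variables (b : R).
Hypothesis b_gt0 : 0 < b.

Let delta := 1 - lam`_1.

Definition mean_mx : 'M[R]_n := const_mx n%:R^-1.
Definition mix_mx : 'M[R]_n := b *: (1%:M - W).

Let n0 : (n%:R : R) != 0.
Proof. by rewrite pnatr_eq0 -lt0n ltnW. Qed.

Lemma mean_mxE m (A : 'M[R]_(n, m)) : mean_mx *m A = \matrix_(i, j) (n%:R^-1 * \sum_k A k j).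
Proof.
apply/matrixP => i j; rewrite !mxE mulr_sumr.
by apply: eq_bigr => k _; rewrite mxE.
Qed.

Lemma mean_mx_tr : mean_mx^T = mean_mx.
Proof. by apply/matrixP => i j; rewrite !mxE. Qed.

Lemma mix_mx_tr : mix_mx^T = mix_mx.
Proof. by rewrite /mix_mx linearZ linearB /= trmx1 (mix_sym net). Qed.

Lemma mean_mx_idem : mean_mx *m mean_mx = mean_mx.
Proof.
apply/matrixP => i j; rewrite mean_mxE !mxE.
under eq_bigr do rewrite mxE.
by rewrite big_const card_ord iter_addr addr0 -[X in _ * X]mulr_natl mulKf.
Qed.

Lemma mean_mx_W : mean_mx *m W = mean_mx.
Proof. by apply/matrixP => i j; rewrite mean_mxE !mxE (W_col net) mulr1. Qed.

Lemma mean_mix_mx : mean_mx *m mix_mx = 0.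
Proof. by rewrite /mix_mx -scalemxAr mulmxBr mulmx1 mean_mx_W subrr scaler0. Qed.

Lemma mix_mean_mx : mix_mx *m mean_mx = 0.
Proof.
by rewrite -[LHS]trmxK trmx_mul mean_mx_tr mix_mx_tr mean_mix_mx trmx0.
Qed.

Lemma mix_form (v : 'rV[R]_n) :
  dotv v (v *m mix_mx) = b * (dotv v v - dotv (v *m W) v).
Proof.
rewrite /mix_mx -scalemxAr dotvZr mulmxBr mulmx1; congr (_ * _).
by rewrite dotvDr -scaleN1r dotvZr mulN1r (dotvC v (v *m W)).
Qed.

Lemma mix_gap (v : 'rV[R]_n) : balanced v ->
  b * delta * dotv v v <= dotv v (v *m mix_mx).
Proof.
move=> bv; rewrite mix_form -mulrA ler_wpM2l ?(ltW b_gt0) //.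
by have := eig_second_bound net n_ge2 bv; rewrite /delta; lra.
Qed.

Lemma mix_mdot (X Y : 'M[R]_(n, p)) : mdot X (mix_mx *m Y) =
  \sum_j dotv (col j X)^T ((col j Y)^T *m mix_mx).
Proof.
rewrite mdot_cols; apply: eq_bigr => j _; congr dotv.
by rewrite !tr_col trmx_mul row_mul mix_mx_tr.
Qed.

Lemma col_balanced (X : 'M[R]_(n, p)) j : mean_mx *m X = 0 ->
  balanced (col j X)^T.
Proof.
move=> /matrixP /(_ (Ordinal (ltnW n_ge2)) j); rewrite mean_mxE !mxE.
move/eqP; rewrite mulf_eq0 invr_eq0 (negbTE n0) /= => /eqP h.
by rewrite /balanced -[RHS]h; apply: eq_bigr => k _; rewrite !mxE.
Qed.

(** A row vector killed by [mix_mx + mean_mx] is killed by both summands, so it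
    has zero sum and the gap of the mixing matrix makes it zero. *)
Lemma mix_mean_unit : mix_mx + mean_mx \in unitmx.
Proof.
rewrite -row_free_unit -kermx_eq0; apply/eqP/row_matrixP => i; rewrite row0.
set u := row i _.
have uS : u *m (mix_mx + mean_mx) = 0.
  by rewrite /u -row_mul mulmx_ker row0.
have uJ : u *m mean_mx = 0.
  have := congr1 (fun A => A *m mean_mx) uS.
  by rewrite -mulmxA mulmxDl mix_mean_mx mean_mx_idem add0r mul0mx.
have uM : u *m mix_mx = 0 by have := uS; rewrite mulmxDr uJ addr0.
have bu : balanced u.
  have := congr1 (fun A : 'rV[R]_n => A 0 (Ordinal (ltnW n_ge2))) uJ.
  rewrite [LHS]mxE [RHS]mxE (eq_bigr (fun k => u 0 k * n%:R^-1)); last first.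
    by move=> k _; rewrite [mean_mx _ _]mxE.
  rewrite -mulr_suml.
  by move/eqP; rewrite mulf_eq0 invr_eq0 (negbTE n0) orbF => /eqP.
have := mix_gap bu; rewrite uM.
have -> : dotv u 0 = 0 by rewrite /dotv big1 // => k _; rewrite [X in _ * X]mxE mulr0.
have d0 : 0 < b * delta by rewrite mulr_gt0 // subr_gt0 (eig_second net).
rewrite pmulr_rle0 // => h; apply: dotv_eq0; apply/eqP.
by rewrite eq_le h dotv_ge0.
Qed.

(** On columns of zero sum the added [mean_mx] acts as zero. *)
Definition mix_inv : 'M[R]_n := invmx (mix_mx + mean_mx).

Lemma mean_mix_inv m (A : 'M[R]_(n, m)) : mean_mx *m A = 0 ->
  mean_mx *m (mix_inv *m A) = 0.
Proof.
move=> hA.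
have e : mean_mx *m mix_inv = mean_mx.
  apply: (can_inj (mulmxK mix_mean_unit)).
  by rewrite /mix_inv mulmxKV ?mix_mean_unit // mulmxDr mean_mix_mx mean_mx_idem add0r.
by rewrite mulmxA e.
Qed.

Lemma mix_inv_mul m (A : 'M[R]_(n, m)) : mean_mx *m A = 0 ->
  mix_mx *m (mix_inv *m A) = A.
Proof.
move=> hA; rewrite -[RHS](mulKVmx mix_mean_unit) [RHS]mulmxDl -/mix_inv.
by rewrite mean_mix_inv // addr0.
Qed.

Lemma rmixing : mixing_operators rdot b (b * delta)
  (rmulL mix_mx) (rmulL mean_mx) (rmulL mix_inv).
Proof.
have hJ X : rmulL mean_mx X = 0 -> forall w, mean_mx *m rval X w = 0.
  by move=> h w; rewrite -rmulLE h rval0.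
split.
- by move=> X Y; exact: rmulC mix_mx_tr.
- by move=> X Y; exact: rmulC mean_mx_tr.
- by move=> X; apply: rval_inj => w; rewrite !rmulLE mulmxA mean_mx_idem.
- by move=> X; apply: rval_inj => w; rewrite !rmulLE mulmxA mix_mean_mx mul0mx.
- by move=> X; apply: rval_inj => w; rewrite !rmulLE mulmxA mean_mix_mx mul0mx.
- move=> X; apply: Rintegral_ge0 => w _; rewrite rmulLE mix_mdot.
  apply: sumr_ge0 => j _; rewrite mix_form mulr_ge0 ?(ltW b_gt0) // subr_ge0.
  exact: W_le net _.
- move=> X; apply: rdot_le => w; rewrite rmulLE mix_mdot mdot_cols mulr_sumr.
  apply: ler_sum => j _; rewrite mix_form ler_wpM2l ?(ltW b_gt0) // gerBl.
  exact: W_ge0 net _.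
- move=> X /hJ h; rewrite -[leRHS]mul1r /rdot.
  have -> : b * delta * \int[P]_w mdot (rval X w) (rval X w) =
      \int[P]_w (b * delta * mdot (rval X w) (rval X w)).
    by rewrite RintegralZl //; exact: mdot_integrable.
  rewrite mul1r; apply: le_Rintegral => //.
  + exact/integrable_scale/mdot_integrable.
  + exact: mdot_integrable.
  + move=> w _; rewrite rmulLE mix_mdot mdot_cols mulr_sumr.
    by apply: ler_sum => j _; apply: mix_gap; exact: col_balanced.
- by move=> X /hJ h; apply: rval_inj => w; rewrite !rmulLE mix_inv_mul.
- by move=> X /hJ h; apply: rval_inj => w; rewrite !rmulLE mean_mix_inv.
Qed.

End RandomMatrixSpace.

(** * Random matrices known at a given time *)

Section InformationClass.
Variables (R : realType) (d : measure_display) (T : measurableType d).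
Variables (P : probability T R) (n p : nat).
Local Notation V := (rmatrix P n p).

Definition mx_measurable_wrt (F : set (set T)) (X : T -> 'M[R]_(n, p)) : Prop :=
  forall i j, measurable_wrt F (fun w => X w i j).

Section Closure.
Variables (F : set (set T)) (sF : sigma_algebra setT F).

Lemma mx_measurableD X Y : mx_measurable_wrt F X -> mx_measurable_wrt F Y ->
  mx_measurable_wrt F (fun w => X w + Y w).
Proof.
move=> mX mY i j; apply/(measurable_wrtP sF).
rewrite (_ : (fun w => _) = fun w => X w i j + Y w i j).
  by apply: measurable_funD; exact/(measurable_wrtP sF).
by apply/funext => w; rewrite mxE.
Qed.

Lemma mx_measurableZ c X : mx_measurable_wrt F X ->
  mx_measurable_wrt F (fun w => c *: X w).
Proof.
move=> mX i j; apply/(measurable_wrtP sF).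
rewrite (_ : (fun w => _) = fun w => c * X w i j).
  by apply: measurable_funM; [exact: measurable_cst|exact/(measurable_wrtP sF)].
by apply/funext => w; rewrite mxE.
Qed.

Lemma mx_measurableM (A : 'M[R]_n) X : mx_measurable_wrt F X ->
  mx_measurable_wrt F (fun w => A *m X w).
Proof.
move=> mX i j; apply/(measurable_wrtP sF).
rewrite (_ : (fun w => _) = fun w => \sum_k A i k * X w k j).
  apply: measurable_sum => k.
  by apply: measurable_funM; [exact: measurable_cst|exact/(measurable_wrtP sF)].
by apply/funext => w; rewrite mxE.
Qed.

Lemma mx_measurable_row X i : mx_measurable_wrt F X ->
  measurable_wrt F ((fun w => row i (X w)) : T -> borel_rV R p).
Proof.
move=> mX; apply: measurable_wrt_row => // j.
by rewrite (_ : (fun w => _) = fun w => X w i j) //; apply/funext => w; rewrite mxE.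
Qed.

End Closure.

Variables (L : R) (f : 'I_n -> 'rV[R]_p -> R).
Hypotheses (L_gt0 : 0 < L) (lip : forall i, lipschitz_gradient L (f i)).

Definition grads : 'M[R]_(n, p) -> 'M[R]_(n, p) := rowwise (fun i => grad (f i)).

Lemma row_grads i X : row i (grads X) = grad (f i) (row i X).
Proof. by rewrite /grads /rowwise rowK. Qed.

Lemma grads_measurable (F : set (set T)) X : sigma_algebra setT F ->
  mx_measurable_wrt F X -> mx_measurable_wrt F (fun w => grads (X w)).
Proof.
move=> sF mX i j.
rewrite (_ : (fun w => _) = fun w => grad (f i) (row i (X w)) 0 j).
  apply: (@measurable_wrt_comp _ _ _ _ _ sF (fun w => row i (X w))
    (fun v => grad (f i) v 0 j)); last exact: mx_measurable_row.
  exact: grad_continuous (lip i).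
by apply/funext => w; rewrite -row_grads !mxE.
Qed.

Lemma grads_lipschitz (X Y : 'M[R]_(n, p)) :
  mdot (grads X - grads Y) (grads X - grads Y) <= L ^+ 2 * mdot (X - Y) (X - Y).
Proof.
rewrite !mdot_rows mulr_sumr; apply: ler_sum => i _.
rewrite !linearB /= !row_grads; exact: lipschitz_gradient_sq.
Qed.

Lemma measurable_grads (X : T -> 'M[R]_(n, p)) :
  (forall i j, measurable_fun [set: T] (fun w => X w i j)) ->
  forall i j, measurable_fun [set: T] (fun w => grads (X w) i j).
Proof.
move=> mX.
have sT := @sigma_algebra_measurable _ T.
have h : mx_measurable_wrt measurable X.
  by move=> i j B mB; have := mX i j measurableT B mB; rewrite setTI.
move=> i j; apply: (measurable_wrt_fun (F := measurable)) => //.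
exact: grads_measurable.
Qed.

Lemma mdot_entry_le (X : 'M[R]_(n, p)) i j : X i j ^+ 2 <= mdot X X.
Proof.
rewrite /mdot (bigD1 i) //= (bigD1 j) //= -expr2 -addrA lerDl addr_ge0 //.
  by apply: sumr_ge0 => k _; rewrite -expr2 sqr_ge0.
by apply: sumr_ge0 => k _; apply: sumr_ge0 => l _; rewrite -expr2 sqr_ge0.
Qed.

Lemma mdot_sum2 (X Y : 'M[R]_(n, p)) :
  mdot (X + Y) (X + Y) <= 2 * mdot X X + 2 * mdot Y Y.
Proof.
have := mdot_ge0 (X + (-1) *: Y).
rewrite !(mdotDl, mdotDr, mdotZl, mdotZr) (mdotC Y X); lra.
Qed.

(** A Lipschitz map grows at most linearly. *)
Lemma grads_sq (X : V) : (fun w => grads (rval X w)) \in @sq_mx R d T P n p.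
Proof.
apply/sq_mxP => i j.
pose c := mdot (grads 0) (grads 0).
apply: (square_integrable_le (Y := fun w => 2 * (L ^+ 2 * mdot (rval X w) (rval X w))
   + 2 * c)).
- by apply: measurable_grads => k l; case: (rval_sq X k l).
- move=> w; apply: (le_trans (mdot_entry_le _ i j)).
  have := mdot_sum2 (grads (rval X w) - grads 0) (grads 0).
  rewrite subrK => h; apply: (le_trans h); rewrite lerD2r ler_wpM2l //.
  by have := grads_lipschitz (rval X w) 0; rewrite subr0.
- apply: integrable_add; last exact: finite_measure_integrable_cst.
  by apply: integrable_scale; apply: integrable_scale; exact: mdot_integrable.
Qed.

Definition rgrad (X : V) : V := RMatrix (grads_sq X).

Lemma rgrad_lip X Y : rdot (rgrad X - rgrad Y) (rgrad X - rgrad Y)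
  <= L ^+ 2 * rdot (X - Y) (X - Y).
Proof. by apply: rdot_le => w; exact: grads_lipschitz. Qed.

Definition rinfo (F : set (set T)) (X : V) : Prop := mx_measurable_wrt F (rval X).

Lemma infoP (F : set (set T)) (A B C : 'M[R]_n) : sigma_algebra setT F ->
  information_class (rmulL P p A) (rmulL P p B) (rmulL P p C) rgrad (rinfo F).
Proof.
move=> sF; split.
- by move=> X Y mX mY; exact: mx_measurableD.
- by move=> c X mX; exact: mx_measurableZ.
- by move=> X mX; exact: mx_measurableM.
- by move=> X mX; exact: mx_measurableM.
- by move=> X mX; exact: mx_measurableM.
- by move=> X mX; exact: grads_measurable.
Qed.

Lemma info_orth (F : set (set T)) (X Z : V) : Defs.sub_sigma_algebra F ->
  rinfo F X -> (forall i j, vanishes_on P F (fun w => rval Z w i j)) ->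
  rdot X Z = 0.
Proof.
move=> hF mX vZ; rewrite /rdot /Rintegral.
have iXZ i j : P.-integrable setT (EFin \o (fun w => rval X w i j * rval Z w i j)).
  by apply: square_integrableM; exact: rval_sq.
under eq_integral do rewrite /mdot -sumEFin.
rewrite integral_sum //; last first.
  move=> i; rewrite (_ : (fun w => _) = EFin \o
    (fun w => \sum_j rval X w i j * rval Z w i j)) //; exact: integrable_big.
rewrite big1 // => i _.
under eq_integral do rewrite -sumEFin.
rewrite integral_sum //; last by move=> j; exact: iXZ.
rewrite big1 // => j _.
apply: (vanishes_mul hF _ (vZ i j) (mX i j) (iXZ i j)).
by apply: square_integrable1; exact: rval_sq.
Qed.

End InformationClass.

(** * Integrating conditional bounds *)

Section ConditionalBounds.
Variables (R : realType) (d : measure_display) (T : measurableType d).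
Variable (P : probability T R).

Lemma cond_exp_le_integral (F : set (set T)) (X B : T -> R) :
  Defs.sub_sigma_algebra F -> cond_exp_le P F X B ->
  P.-integrable setT (EFin \o B) ->
  P.-integrable setT (EFin \o X) /\ \int[P]_w X w <= \int[P]_w B w.
Proof.
move=> hF [Y [[iX iY mY XY] YB]] iB; split => //.
have FT : F setT.
  by have := @measurableT _ (g_sigma_algebraType F); rewrite /measurable /= (sigma_algebra_id hF.1).
have mY' := integrable_meas iY; have mB := integrable_meas iB.
rewrite /Rintegral XY //.
have -> : (\int[P]_w (Y w)%:E = \int[P]_w (Num.min (Y w) (B w))%:E)%E.
  apply: ae_eq_integral => //.
  - exact/measurable_EFinP.
  - exact/measurable_EFinP/measurable_minr.
  - by apply: filterS YB => w h _; rewrite min_l.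
apply: le_Rintegral => //.
- apply: (@integrable_le _ _ _ P _ (fun w => `|Y w| + `|B w|)).
  + exact: measurable_minr.
  + by move=> w; case: (leP (Y w) (B w)) => _; rewrite ?lerDl ?lerDr ?normr_ge0.
  + by apply: integrable_add; exact: integrable_norm.
- by move=> w _; rewrite ge_min lexx orbT.
Qed.

End ConditionalBounds.

Section RandomDot.
Variables (R : realType) (d : measure_display) (T : measurableType d).
Variables (P : probability T R) (n p : nat).
Local Notation V := (rmatrix P n p).
Implicit Types X Y : V.

Lemma Rintegral_big (I : Type) (s : seq I) (X : I -> T -> R) :
  (forall i, P.-integrable setT (EFin \o X i)) ->
  \int[P]_w (\sum_(i <- s) X i w) = \sum_(i <- s) \int[P]_w X i w.
Proof.
move=> hX; elim: s => [|i s IH].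
  rewrite big_nil (@eq_Rintegral _ _ _ P setT (fun=> 0)); last first.
    by move=> w _; rewrite big_nil.
  by rewrite Rintegral_cst // mul0r.
rewrite big_cons -IH -RintegralD //; last exact: integrable_big.
by apply: eq_Rintegral => w _; rewrite big_cons.
Qed.

Lemma dotv_row_integrable X Y i k : P.-integrable setT
  (EFin \o (fun w => dotv (row i (rval X w)) (row k (rval Y w)))).
Proof.
apply: integrable_big => j.
rewrite (_ : _ \o _ = EFin \o (fun w => rval X w i j * rval Y w k j)); last first.
  by apply/funext => w /=; rewrite !mxE.
by apply: square_integrableM; exact: rval_sq.
Qed.

Lemma rdot_rows X Y : rdot X Y =
  \sum_i \int[P]_w dotv (row i (rval X w)) (row i (rval Y w)).
Proof.
rewrite -Rintegral_big; last by move=> i; exact: dotv_row_integrable.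
by apply: eq_Rintegral => w _; exact: mdot_rows.
Qed.

Definition to_rmatrix (X : T -> 'M[R]_(n, p)) : V := insubd 0 X.

Lemma to_rmatrixK (X : T -> 'M[R]_(n, p)) : X \in @sq_mx R d T P n p -> rval (to_rmatrix X) = X.
Proof. by move=> hX; exact: insubdK. Qed.

End RandomDot.

Section KnownMatrices.
Variables (R : realType) (d : measure_display) (T : measurableType d).
Variables (P : probability T R) (n p : nat).

Definition known (F : set (set T)) (X : T -> 'M[R]_(n, p)) : Prop :=
  X \in @sq_mx R d T P n p /\ mx_measurable_wrt F X.

Lemma known_sub F G X : F `<=` G -> known F X -> known G X.
Proof.
move=> FG [sX mX]; split=> // i j; exact: measurable_wrt_sub FG (mX i j).
Qed.

Variables (F : set (set T)) (sF : sigma_algebra setT F).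

Lemma knownD X Y : known F X -> known F Y -> known F (fun w => X w + Y w).
Proof.
move=> [sX mX] [sY mY]; split; last exact: mx_measurableD.
exact: (rpredD sX sY).
Qed.

Lemma knownZ c X : known F X -> known F (fun w => c *: X w).
Proof.
move=> [sX mX]; split; last exact: mx_measurableZ.
exact: (rpredZ c sX).
Qed.

Lemma knownB X Y : known F X -> known F Y -> known F (fun w => X w - Y w).
Proof.
move=> hX hY; rewrite (_ : (fun w => _) = fun w => X w + (-1) *: Y w).
  by apply: knownD => //; exact: knownZ.
by apply/funext => w; rewrite scaleN1r.
Qed.

Lemma knownM (A : 'M[R]_n) X : known F X -> known F (fun w => A *m X w).
Proof.
move=> [sX mX]; split; last exact: mx_measurableM.
exact: (mul_sq A (RMatrix sX)).
Qed.

Lemma known_cst (A : 'M[R]_(n, p)) : known F (fun=> A).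
Proof.
split; last by move=> i j; apply/(measurable_wrtP sF)/measurable_cst.
by apply/sq_mxP => i j; exact: square_integrable_cst.
Qed.

Lemma known_grads L f X : 0 < L -> (forall i, lipschitz_gradient L (f i)) ->
  known F X -> known F (fun w => grads f (X w)).
Proof.
move=> L0 lip [sX mX]; split; last exact: (grads_measurable L0 lip sF mX).
exact: (grads_sq L0 lip (RMatrix sX)).
Qed.

Lemma known_row_sq X i : known F X ->
  P.-integrable setT (fun w => (fnorm (row i (X w)) ^+ 2)%:E).
Proof.
move=> [/sq_mxP sX _].
rewrite (_ : (fun w => _) = EFin \o (fun w => \sum_j X w i j ^+ 2)).
  by apply: integrable_big => j; case: (sX i j).
apply/funext => w /=; rewrite fnorm_sq big_ord1; congr EFin.
by apply: eq_bigr => j _; rewrite mxE.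
Qed.

End KnownMatrices.

(** * The mean of the rows *)

Section RowMean.
Variables (R : realType) (n p : nat).
Hypothesis n_ge2 : (2 <= n)%N.
Let n_gt0 : (0 < n)%N := ltnW n_ge2.
Implicit Types A G : 'M[R]_(n, p).

Local Notation J := (mean_mx R n).

Lemma row_mean_mx A i : row i (J *m A) = row_mean A.
Proof.
by apply/rowP => j; rewrite mxE mean_mxE !mxE summxE; congr (_ * _);
  apply: eq_bigr => k _; rewrite mxE.
Qed.

Lemma row_meanD A G : row_mean (A + G) = row_mean A + row_mean G.
Proof. by rewrite -!(row_mean_mx _ (Ordinal n_gt0)) mulmxDr linearD. Qed.

Lemma row_meanZ c A : row_mean (c *: A) = c *: row_mean A.
Proof. by rewrite -!(row_mean_mx _ (Ordinal n_gt0)) -scalemxAr linearZ. Qed.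

Lemma row_meanB A G : row_mean (A - G) = row_mean A - row_mean G.
Proof. by rewrite -!(row_mean_mx _ (Ordinal n_gt0)) mulmxBr linearB. Qed.

Lemma row_mean_eq0 A : J *m A = 0 -> row_mean A = 0.
Proof. by move=> h; rewrite -(row_mean_mx _ (Ordinal n_gt0)) h row0. Qed.

Lemma sum_row A : \sum_i row i A = n%:R *: row_mean A.
Proof. by rewrite /row_mean scalerA mulfV ?scale1r // pnatr_eq0 -lt0n. Qed.

Lemma mdot_mean A : mdot (J *m A) (J *m A) = n%:R * dotv (row_mean A) (row_mean A).
Proof.
rewrite mdot_rows (eq_bigr (fun=> dotv (row_mean A) (row_mean A))).
  by rewrite big_const card_ord iter_addr addr0 mulr_natl.
by move=> i _; rewrite row_mean_mx.
Qed.

Lemma dotv_sumr (v : 'rV[R]_p) (u : 'I_n -> 'rV[R]_p) :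
  dotv v (\sum_i u i) = \sum_i dotv v (u i).
Proof.
rewrite /dotv exchange_big; apply: eq_bigr => j _ /=.
by rewrite summxE mulr_sumr.
Qed.

Lemma mdot_mean_pairs A : mdot (J *m A) (J *m A) =
  n%:R^-1 * \sum_k \sum_l dotv (row k A) (row l A).
Proof.
rewrite mdot_mulmx mean_mx_tr mulmxA mean_mx_idem //.
rewrite mdot_rows mulr_sumr; apply: eq_bigr => k _.
by rewrite row_mean_mx /row_mean dotvZr dotv_sumr.
Qed.

Variable f : 'I_n -> 'rV[R]_p -> R.
Hypothesis df : forall i v, differentiable (f i) v.

Lemma row_mean_grads A : row_mean (grads f (J *m A)) = grad (avg_fun f) (row_mean A).
Proof.
rewrite grad_avg // /row_mean; congr (_ *: _); apply: eq_bigr => i _.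
by rewrite row_grads row_mean_mx.
Qed.

Lemma mdot_mean_grads A G : mdot (J *m grads f (J *m A)) G =
  n%:R * dotv (grad (avg_fun f) (row_mean A)) (row_mean G).
Proof.
rewrite mdot_rows -dotvZr -sum_row dotv_sumr; apply: eq_bigr => i _.
by rewrite row_mean_mx row_mean_grads.
Qed.

Lemma descent_pointwise L eta A A' G : 0 < L ->
  (forall i, lipschitz_gradient L (f i)) ->
  row_mean A' = row_mean A - eta *: row_mean G ->
  n%:R * avg_fun f (row_mean A') <= n%:R * avg_fun f (row_mean A)
    - eta * mdot (J *m grads f (J *m A)) G
    + L / 2 * (eta ^+ 2 * mdot (J *m G) (J *m G)).
Proof.
move=> L0 lf ->; rewrite mdot_mean_grads mdot_mean -scaleNr.
have := avg_upper_bound df (row_mean A) ((- eta) *: row_mean G) L0 lf n_gt0.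
rewrite dotvZl !dotvZr => h.
have := ler_wpM2l (ler0n R n) h; lra.
Qed.

End RowMean.

(** * The expected objective *)

Section RandomObjective.
Variables (R : realType) (d : measure_display) (T : measurableType d).
Variables (P : probability T R) (n p : nat).
Local Notation V := (rmatrix P n p).
Variables (L : R) (f : 'I_n -> 'rV[R]_p -> R).
Hypotheses (n_ge2 : (2 <= n)%N) (L_gt0 : 0 < L).
Hypothesis lip : forall i, lipschitz_gradient L (f i).
Hypothesis lb : has_lbound (range (avg_fun f)).

Local Notation J := (rmulL P p (mean_mx R n)).
Local Notation gF := (rgrad (P := P) L_gt0 lip).

Let df i v : differentiable (f i) v := (lip i).1 v.

Lemma inf_avg_le v : inf (range (avg_fun f)) <= avg_fun f v.
Proof. by apply: ge_inf => //; exists v. Qed.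

(** The objective is bounded below by assumption and above by a quadratic; hence
    it is integrable at the mean of a square-integrable random matrix. *)
Lemma avg_abs_le v : `|avg_fun f v| <= `|inf (range (avg_fun f))| + `|avg_fun f 0|
  + dotv (grad (avg_fun f) 0) (grad (avg_fun f) 0) + (1 + L) * dotv v v.
Proof.
have h1 := inf_avg_le v.
have h2 := avg_upper_bound df 0 v L_gt0 lip (ltnW n_ge2).
rewrite add0r in h2; move: h2; set g := grad _ _ => h2.
have := dotv_ge0 (g + (-1) *: v).
rewrite !(dotvDl, dotvDr, dotvZl, dotvZr) (dotvC v g) => h3.
have g0 := dotv_ge0 g; have v0 := dotv_ge0 v.
have Lv := mulr_ge0 (ltW L_gt0) v0.
have h4 := ler_norm (avg_fun f 0); have h5 := normr_ge0 (avg_fun f 0).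
have h6 := normr_ge0 (inf (range (avg_fun f))).
have h7 : - `|inf (range (avg_fun f))| <= inf (range (avg_fun f)) by rewrite lerNl ler_normr lexx orbT.
by rewrite ler_norml; apply/andP; split; lra.
Qed.

Lemma avg_integrable (X : V) :
  P.-integrable setT (EFin \o (fun w => avg_fun f (row_mean (rval X w)))).
Proof.
have sT := @sigma_algebra_measurable _ T.
have i0 : 'I_n by exact: Ordinal (ltnW n_ge2).
have mJ : mx_measurable_wrt measurable (rval (J X)).
  by move=> i j B mB; have := (rval_sq (J X) i j).1 measurableT B mB; rewrite setTI.
apply: (@integrable_le _ _ _ P _ (fun w => (`|inf (range (avg_fun f))| + `|avg_fun f 0|
  + dotv (grad (avg_fun f) 0) (grad (avg_fun f) 0))
  + (1 + L) * (n%:R^-1 * mdot (rval (J X) w) (rval (J X) w)))).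
- apply: (measurable_wrt_fun (F := measurable)) => //.
  rewrite (_ : (fun w => _) = fun w => avg_fun f (row i0 (rval (J X) w))).
    apply: (measurable_wrt_comp sT (avg_fun_continuous df)).
    exact: mx_measurable_row.
  by apply/funext => w; rewrite rmulLE row_mean_mx.
- move=> w; rewrite rmulLE mdot_mean // mulKf; last by rewrite pnatr_eq0 -lt0n ltnW.
  exact: avg_abs_le.
- apply: integrable_add; first exact: finite_measure_integrable_cst.
  by do 2!apply: integrable_scale; exact: mdot_integrable.
Qed.

Lemma mean_descent eta (X X' Z : V) :
  (forall w, row_mean (rval X' w) =
     row_mean (rval X w) - eta *: row_mean (rval (gF X + Z) w)) ->
  n%:R * \int[P]_w avg_fun f (row_mean (rval X' w)) <=
    n%:R * \int[P]_w avg_fun f (row_mean (rval X w))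
    - eta * rdot (J (gF (J X))) (gF X + Z)
    + L / 2 * (eta ^+ 2 * rdot (J (gF X + Z)) (J (gF X + Z))).
Proof.
move=> step; rewrite /rdot -!RintegralZl //;
  try solve [exact: avg_integrable | exact: mdot_integrable | apply: integrable_scale; exact: mdot_integrable].
have iA Y := integrable_scale n%:R (avg_integrable Y).
have iB := integrable_scale eta (mdot_integrable (J (gF (J X))) (gF X + Z)).
have iC := integrable_scale (L / 2) (integrable_scale (eta ^+ 2)
   (mdot_integrable (J (gF X + Z)) (J (gF X + Z)))).
rewrite -RintegralB // -RintegralD //; last exact: integrable_sub.
apply: le_Rintegral => //.
  by apply: integrable_add => //; exact: integrable_sub.
move=> w _; exact: (descent_pointwise n_ge2 df L_gt0 lip (step w)).
Qed.

Lemma avg_mean_lower (X : V) :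
  inf (range (avg_fun f)) <= \int[P]_w avg_fun f (row_mean (rval X w)).
Proof.
apply: (@le_trans _ _ (\int[P]_w (cst (inf (range (avg_fun f))) w))).
  rewrite Rintegral_cst // [fine _](_ : _ = 1);
    last exact: (congr1 fine (probability_setT P)).
  by rewrite mulr1.
apply: le_Rintegral => //; first exact: finite_measure_integrable_cst.
  exact: avg_integrable.
by move=> w _; exact: inf_avg_le.
Qed.

End RandomObjective.

(** * CEDAS as a disturbed primal-dual recursion *)

Section Process.
Variables (R : realType) (d : measure_display) (T : measurableType d).
Variables (P : probability T R) (n p : nat).
Variables (dX : measure_display) (Xi : measurableType dX).
Variables (dT : measure_display) (Theta : measurableType dT).
Variables (f : 'I_n -> 'rV[R]_p -> R) (W : 'M[R]_n).
Variables (oracle : 'I_n -> 'rV[R]_p -> Xi -> 'rV[R]_p).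
Variables (comp : Theta -> 'rV[R]_p -> 'rV[R]_p).
Variables (xi : nat -> 'I_n -> T -> Xi) (theta : nat -> 'I_n -> T -> Theta).
Variables (Fs Fc : nat -> set (set T)) (xm1 H0 : 'M[R]_(n, p)).
Variables (C alpha gamma eta L sigma : R).

Let x := cedas_process W alpha gamma (fun=> eta) oracle comp xi theta xm1 H0.

Hypotheses (L_gt0 : 0 < L) (lip : forall i, lipschitz_gradient L (f i)).
Hypothesis fil : cedas_filtration xi theta Fs Fc.
Hypothesis sga : stochastic_gradient_assumption P f oracle xi Fs x sigma.
Hypothesis cpa : unbiased_compressor_assumption P comp theta Fc C.

Definition sampled t w : 'M[R]_(n, p) -> 'M[R]_(n, p) :=
  rowwise (fun i v => oracle i v (xi t i w)).
Definition compressed t w : 'M[R]_(n, p) -> 'M[R]_(n, p) :=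
  rowwise (fun i v => comp (theta t i w) v).
(** [state k] is [(x_k, D_k, H_k)] for [k >= 0], while [x t] and everything
    attached to a sampling time is shifted by one: [x k.+1] is [st_x (state k)]. *)
Definition state k w : cedas_state R n p :=
  cedas_run W alpha gamma (fun=> eta) (fun s => sampled s w)
    (fun s => compressed s w) xm1 H0 k.

Definition grad_noise t w := sampled t w (x t w) - grads f (x t w).
Definition y_raw k w :=
  x k.+1 w - eta *: (grads f (x k.+1 w) + grad_noise k.+1 w) - st_D (state k w).
Definition H_raw k w := st_H (state k w).
Definition comp_noise k w :=
  compressed k.+1 w (y_raw k w - H_raw k w) - (y_raw k w - H_raw k w).
(** The variable with [D_k = M U_k]. *)
Fixpoint U_raw k w : 'M[R]_(n, p) :=
  if k is l.+1 then U_raw l w + (y_raw l w + comp_noise l w) else 0.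

Local Notation Mx := (mix_mx W (gamma / 2)).

Lemma y_rawE k w : y_raw k w =
  st_x (state k w) - eta *: sampled k.+1 w (st_x (state k w)) - st_D (state k w).
Proof. by rewrite /y_raw /grad_noise (addrC (grads f _)) subrK. Qed.

Lemma H_plus_Q k w : H_raw k w + compressed k.+1 w (y_raw k w - H_raw k w) =
  y_raw k w + comp_noise k w.
Proof.
rewrite /comp_noise; move: (compressed _ _ _) => Q; move: (y_raw k w) => y.
by rewrite opprB addrCA [y + _]addrC subrK addrC.
Qed.

Lemma D_next k w : st_D (state k.+1 w) =
  st_D (state k w) + Mx *m (y_raw k w + comp_noise k w).
Proof.
by rewrite -H_plus_Q /H_raw y_rawE /mix_mx -scalemxAl.
Qed.

Lemma DE k w : st_D (state k w) = Mx *m U_raw k w.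
Proof.
elim: k => [|k IH]; first by rewrite mulmx0.
by rewrite D_next IH /= [RHS]mulmxDr.
Qed.

Lemma x_next k w : x k.+2 w = y_raw k w - Mx *m (y_raw k w + comp_noise k w).
Proof.
have -> : x k.+2 w = st_x (state k w) - eta *: sampled k.+1 w (st_x (state k w))
    - st_D (state k.+1 w) by [].
by rewrite D_next y_rawE opprD addrA.
Qed.

Lemma H_next k w : H_raw k.+1 w =
  H_raw k w + alpha *: (y_raw k w - H_raw k w + comp_noise k w).
Proof.
rewrite /comp_noise (addrC (y_raw k w - _)) subrK.
by rewrite /H_raw y_rawE.
Qed.

Lemma x1E w : x 1 w = xm1 - eta *: (grads f xm1 + grad_noise 0 w).
Proof. by rewrite /grad_noise (addrC (grads f _)) subrK. Qed.

Lemma row_sampled t w X i : row i (sampled t w X) = oracle i (row i X) (xi t i w).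
Proof. by rewrite /sampled /rowwise rowK. Qed.

Lemma row_compressed t w X i : row i (compressed t w X) = comp (theta t i w) (row i X).
Proof. by rewrite /compressed /rowwise rowK. Qed.

Lemma row_grad_noise t w i : row i (grad_noise t w) =
  oracle i (row i (x t w)) (xi t i w) - grad (f i) (row i (x t w)).
Proof. by rewrite linearB /= row_sampled row_grads. Qed.

Lemma row_comp_noise k w i : row i (comp_noise k w) =
  comp (theta k.+1 i w) (row i (y_raw k w - H_raw k w)) - row i (y_raw k w - H_raw k w).
Proof. by rewrite [LHS]linearB /= row_compressed. Qed.

Lemma entry_row (X : T -> 'M[R]_(n, p)) i j :
  (fun w => X w i j) = (fun w => row i (X w) 0 j).
Proof. by apply/funext => w; rewrite mxE. Qed.

Lemma entry_sq_le (v : 'rV[R]_p) j : v 0 j ^+ 2 <= fnorm v ^+ 2.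
Proof.
rewrite fnorm_sq big_ord1 (bigD1 j) //= lerDl.
by apply: sumr_ge0 => k _; exact: sqr_ge0.
Qed.

Lemma known_noise t : known P (Fs t) (x t) -> known P (Fc t) (grad_noise t).
Proof.
move=> kx; have [sF mF] := Fc_sub fil t.
have mS : mx_measurable_wrt (Fc t) (fun w => sampled t w (x t w)).
  move=> i j; rewrite entry_row.
  rewrite (_ : (fun w => _) = fun w => oracle i (row i (x t w)) (xi t i w) 0 j);
    last by apply/funext => w; rewrite row_sampled.
  apply: measurable_wrt_coord => //.
  apply: (measurable_wrt_pair sF (sg_measurable sga i)); last exact: xi_adapted fil t i.
  apply: (measurable_wrt_sub (Fs_Fc fil (t:=t))).
  by apply: mx_measurable_row; [exact: (Fs_sub fil t).1|exact: kx.2].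
have kg := known_grads (Fc_sub fil t).1 L_gt0 lip (known_sub (Fs_Fc fil (t:=t)) kx).
have mN : mx_measurable_wrt (Fc t) (grad_noise t).
  have h := mx_measurableZ sF (-1) kg.2.
  have := mx_measurableD sF mS h.
  rewrite (_ : (fun w => _ + _) = grad_noise t) //.
  by apply/funext => w; rewrite scaleN1r.
split => //; apply/sq_mxP => i j.
have iN := (cond_exp_le_integral (Fs_sub fil t) (sg_var sga t i)
  (finite_measure_integrable_cst _ _ measurableT)).1.
apply: (square_integrable_le _ _ iN).
  exact: measurable_wrt_fun mF (mN i j).
by move=> w; rewrite -row_grad_noise; have := entry_sq_le (row i (grad_noise t w)) j; rewrite mxE.
Qed.

Lemma known_comp_noise k : known P (Fc k.+1) (fun w => y_raw k w - H_raw k w) ->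
  known P (Fs k.+2) (comp_noise k).
Proof.
move=> ky; have [sF mF] := Fs_sub fil k.+2.
have mrow i := mx_measurable_row (Fc_sub fil k.+1).1 i ky.2.
have mS : mx_measurable_wrt (Fs k.+2)
    (fun w => compressed k.+1 w (y_raw k w - H_raw k w)).
  move=> i j; rewrite entry_row.
  rewrite (_ : (fun w => _) = fun w => comp (theta k.+1 i w)
     (row i (y_raw k w - H_raw k w)) 0 j);
    last by apply/funext => w; rewrite row_compressed.
  apply: measurable_wrt_coord => //.
  apply: (measurable_wrt_pair sF (comp_measurable cpa)); first exact: theta_adapted fil k i.
  exact: measurable_wrt_sub (Fc_Fs fil (t:=k.+1)) (mrow i).
have ky2 := known_sub (Fc_Fs fil (t:=k.+1)) ky.
have mN : mx_measurable_wrt (Fs k.+2) (comp_noise k).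
  have h := mx_measurableZ sF (-1) ky2.2.
  have := mx_measurableD sF mS h.
  rewrite (_ : (fun w => _ + _) = comp_noise k) //.
  by apply/funext => w; rewrite scaleN1r.
split => //; apply/sq_mxP => i j.
have iy := known_row_sq i ky.
have iN := (cond_exp_le_integral (Fc_sub fil k.+1) (comp_var cpa i (mrow i) iy)
  (integrable_scale C iy)).1.
apply: (square_integrable_le _ _ iN).
  exact: measurable_wrt_fun mF (mN i j).
by move=> w; rewrite -row_comp_noise; have := entry_sq_le (row i (comp_noise k w)) j; rewrite mxE.
Qed.

Lemma known_y k : known P (Fs k.+1) (x k.+1) -> known P (Fs k.+1) (U_raw k) ->
  known P (Fc k.+1) (y_raw k).
Proof.
move=> kx kU; have [sF mF] := Fc_sub fil k.+1.
have kx' := known_sub (Fs_Fc fil (t:=k.+1)) kx.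
have kU' := known_sub (Fs_Fc fil (t:=k.+1)) kU.
rewrite (_ : y_raw k = fun w => (x k.+1 w - eta *: (grads f (x k.+1 w) + grad_noise k.+1 w))
   - Mx *m U_raw k w); last by apply/funext => w; rewrite /y_raw DE.
apply: knownB => //; last exact: knownM.
apply: knownB => //; apply: knownZ => //; apply: knownD => //.
  exact: known_grads L_gt0 lip kx'.
exact: known_noise.
Qed.

Lemma known_x0 : known P (Fs 0) (x 0).
Proof. by apply: known_cst; exact: (Fs_sub fil 0).1. Qed.

(** Square integrability has to be carried through the induction together with
    measurability: the assumption on the compressor applies to square-integrable
    vectors only. *)
Lemma known_state k : [/\ known P (Fs k.+1) (x k.+1), known P (Fs k.+1) (U_raw k) &
  known P (Fs k.+1) (H_raw k)].
Proof.
elim: k => [|k [kx kU kH]].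
  have sF := (Fs_sub fil 1).1.
  split; [|exact: known_cst..].
  rewrite (_ : x 1 = fun w => xm1 - eta *: (grads f xm1 + grad_noise 0 w)).
    apply: knownB => //; first exact: known_cst.
    apply: knownZ => //; apply: knownD => //; first exact: known_cst.
    by apply: (known_sub (Fc_Fs fil (t:=0%N))); apply: known_noise; exact: known_x0.
  by apply/funext => w; rewrite x1E.
have ky := known_y kx kU.
have kyH := knownB (Fc_sub fil k.+1).1 ky (known_sub (Fs_Fc fil (t:=k.+1)) kH).
have ke := known_comp_noise kyH.
have ky2 := known_sub (Fc_Fs fil (t:=k.+1)) ky.
have kyH2 := known_sub (Fc_Fs fil (t:=k.+1)) kyH.
have FF : Fs k.+1 `<=` Fs k.+2.
  by move=> A h; apply: (Fc_Fs fil); exact: (Fs_Fc fil).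
have sF := (Fs_sub fil k.+2).1.
have kye := knownD sF ky2 ke.
split.
- rewrite (_ : x k.+2 = fun w => y_raw k w - Mx *m (y_raw k w + comp_noise k w)).
    by apply: knownB => //; exact: knownM.
  by apply/funext => w; rewrite x_next.
- by apply: knownD => //; exact: known_sub FF kU.
- rewrite (_ : H_raw k.+1 = fun w => H_raw k w
      + alpha *: (y_raw k w - H_raw k w + comp_noise k w)).
    apply: knownD => //; first exact: known_sub FF kH.
    by apply: knownZ => //; exact: knownD.
  by apply/funext => w; rewrite H_next.
Qed.

Hypothesis n_ge2 : (2 <= n)%N.

Local Notation V := (rmatrix P n p).
Local Notation toV := (@to_rmatrix R d T P n p).
Local Notation gF := (rgrad (P := P) L_gt0 lip).
Local Notation M := (rmulL P p Mx).
Local Notation J := (rmulL P p (mean_mx R n)).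
Local Notation info := (@rinfo R d T P n p).

(** The iterates and disturbances as elements of the space of random matrices. *)
Definition xV t : V := toV (x t).
Definition zV t : V := toV (grad_noise t).
Definition UV k : V := toV (U_raw k).
Definition HV k : V := toV (H_raw k).
Definition yV k : V := toV (y_raw k).
Definition eV k : V := toV (comp_noise k).

Lemma known_x t : known P (Fs t) (x t).
Proof. by case: t => [|k]; [exact: known_x0|case: (known_state k)]. Qed.

Lemma known_yH k : known P (Fc k.+1) (fun w => y_raw k w - H_raw k w).
Proof.
have [kx kU kH] := known_state k.
apply: knownB; first exact: (Fc_sub fil k.+1).1.
  exact: known_y.
exact: (known_sub (Fs_Fc fil (t:=k.+1)) kH).
Qed.

Lemma rval_x t : rval (xV t) = x t.
Proof. by apply: to_rmatrixK; case: (known_x t). Qed.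

Lemma rval_z t : rval (zV t) = grad_noise t.
Proof. by apply: to_rmatrixK; case: (known_noise (known_x t)). Qed.

Lemma rval_U k : rval (UV k) = U_raw k.
Proof. by apply: to_rmatrixK; case: (known_state k) => _ []. Qed.

Lemma rval_H k : rval (HV k) = H_raw k.
Proof. by apply: to_rmatrixK; case: (known_state k) => _ _ []. Qed.

Lemma rval_y k : rval (yV k) = y_raw k.
Proof.
have [kx kU _] := known_state k.
by apply: to_rmatrixK; case: (known_y kx kU).
Qed.

Lemma rval_e k : rval (eV k) = comp_noise k.
Proof. by apply: to_rmatrixK; case: (known_comp_noise (known_yH k)). Qed.

Lemma rdynamics : cedas_dynamics M gF eta alpha (fun k => xV k.+1)
  (fun k => zV k.+1) UV HV yV eV.
Proof.
split=> k; apply: rval_inj => w.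
- change (rval (yV k) w = rval (xV k.+1) w
    - eta *: (grads f (rval (xV k.+1) w) + rval (zV k.+1) w) - Mx *m rval (UV k) w).
  by rewrite rval_y rval_x rval_z rval_U /y_raw DE.
- change (rval (UV k.+1) w = rval (UV k) w + (rval (yV k) w + rval (eV k) w)).
  by rewrite !rval_U rval_y rval_e.
- change (rval (xV k.+2) w = rval (yV k) w - Mx *m (rval (yV k) w + rval (eV k) w)).
  by rewrite rval_x rval_y rval_e x_next.
- change (rval (HV k.+1) w = rval (HV k) w
    + alpha *: (rval (yV k) w - rval (HV k) w + rval (eV k) w)).
  by rewrite !rval_H rval_y rval_e H_next.
Qed.

Lemma rinformation : cedas_information M J (rmulL P p (mix_inv W (gamma / 2)))
  gF (fun k => xV k.+1) (fun k => zV k.+1) UV HV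
  (fun k => info (Fs k.+1)) (fun k => info (Fc k.+1)).
Proof.
split=> k.
- exact: infoP (Fs_sub fil k.+1).1.
- exact: infoP (Fc_sub fil k.+1).1.
- move=> v hv i j; exact: measurable_wrt_sub (Fs_Fc fil (t:=k.+1)) (hv i j).
- by rewrite /rinfo rval_x; case: (known_x k.+1).
- by rewrite /rinfo rval_U; case: (known_state k) => _ [].
- rewrite /rinfo rval_H; case: (known_state k) => _ _ [_ h] i j.
  exact: measurable_wrt_sub (Fs_Fc fil (t:=k.+1)) (h i j).
- by rewrite /rinfo rval_z; case: (known_noise (known_x k.+1)).
Qed.

Lemma noise_vanishes t i j :
  vanishes_on P (Fs t) (fun w => grad_noise t w i j).
Proof.
have [_] := cond_exp_vanishes (Fs_sub fil t) (sg_mean sga t i j).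
congr vanishes_on; apply/funext => w.
by have /rowP/(_ j) := row_grad_noise t w i; rewrite !mxE => ->.
Qed.

Lemma comp_noise_vanishes k i j :
  vanishes_on P (Fc k.+1) (fun w => comp_noise k w i j).
Proof.
have kyH := known_yH k.
have mrow := mx_measurable_row (Fc_sub fil k.+1).1 i kyH.2.
have [_] := cond_exp_vanishes (Fc_sub fil k.+1)
  (comp_unbiased cpa i mrow (known_row_sq i kyH) j).
congr vanishes_on; apply/funext => w.
by have /rowP/(_ j) := row_comp_noise k w i; rewrite !mxE => ->.
Qed.

Lemma noise_orth t (v : V) : info (Fs t) v -> rdot v (zV t) = 0.
Proof.
move=> hv; apply: (info_orth (Fs_sub fil t) hv) => i j.
by rewrite rval_z; exact: noise_vanishes.
Qed.

Lemma row_noise_var t i :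
  \int[P]_w dotv (row i (rval (zV t) w)) (row i (rval (zV t) w)) <= sigma ^+ 2.
Proof.
have [_] := cond_exp_le_integral (Fs_sub fil t) (sg_var sga t i)
  (finite_measure_integrable_cst _ _ measurableT).
rewrite Rintegral_cst // [fine _](_ : _ = 1);
  last exact: (congr1 fine (probability_setT P)).
rewrite mulr1; apply: le_trans.
rewrite le_eqVlt; apply/orP; left; apply/eqP; apply: eq_Rintegral => w _.
by rewrite -fnorm_row rval_z row_grad_noise.
Qed.

Lemma noise_var t : rdot (zV t) (zV t) <= n%:R * sigma ^+ 2.
Proof.
rewrite rdot_rows; apply: le_trans (ler_sum _ (fun i _ => row_noise_var t i)) _.
by rewrite big_const card_ord iter_addr addr0 mulr_natl.
Qed.

(** Entrywise orthogonality: the noise of agent [k] is a function of the past and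
    of the sample of [k] alone. *)
Lemma noise_pair_orth t k l : k != l ->
  \int[P]_w dotv (row k (rval (zV t) w)) (row l (rval (zV t) w)) = 0.
Proof.
move=> kl.
have mX i : measurable_fun [set: T] (xi t i).
  exact: measurable_wrt_fun (Fc_sub fil t).2 (xi_adapted fil t i).
rewrite /dotv Rintegral_big; last first.
  move=> j; rewrite (_ : _ \o _ = EFin \o
     (fun w => rval (zV t) w k j * rval (zV t) w l j)).
    by apply: square_integrableM; exact: rval_sq.
  by apply/funext => w /=; rewrite !mxE.
rewrite big1 // => j _.
have mD i : measurable_wrt <<s joint_events (Fs t) (xi t) i >>
    (fun w => rval (zV t) w i j).
  have sJ := joint_sigma_sub (Fs_sub fil t) mX i.
  have FJ : Fs t `<=` <<s joint_events (Fs t) (xi t) i >>.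
    by move=> A; exact: F_joint.
  have xiJ : measurable_wrt <<s joint_events (Fs t) (xi t) i >> (xi t i).
    by move=> B; exact: (X_joint (Fs_sub fil t)).
  have mrow := measurable_wrt_sub FJ
    (mx_measurable_row (Fs_sub fil t).1 i (known_x t).2).
  have mo := measurable_wrt_pair sJ.1 (sg_measurable sga i) mrow
    xiJ.
  have mg := grads_measurable L_gt0 lip (Fs_sub fil t).1 (known_x t).2.
  have h1 := measurable_wrt_coord sJ.1 j mo.
  have h2 := measurable_wrt_sub FJ (mg i j).
  rewrite rval_z (_ : (fun w => _) = fun w =>
    oracle i (row i (x t w)) (xi t i w) 0 j - grads f (x t w) i j).
    apply/(measurable_wrtP sJ.1)/measurable_funB; exact/(measurable_wrtP sJ.1).
  by apply/funext => w; rewrite mxE -row_sampled !mxE.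
rewrite (@eq_Rintegral _ _ _ P setT
  (fun w => rval (zV t) w k j * rval (zV t) w l j)); last first.
  by move=> w _; rewrite !mxE.
rewrite /Rintegral (cond_indep_orth (Fs_sub fil t) mX (sg_indep sga t) kl) //.
- exact: rval_sq.
- exact: rval_sq.
- by rewrite rval_z; exact: noise_vanishes.
Qed.

(** Of the double sum over pairs of agents only the diagonal remains. *)
Lemma mean_noise_var t : rdot (J (zV t)) (J (zV t)) <= sigma ^+ 2.
Proof.
have n0 : 0 < (n%:R : R) by rewrite ltr0n ltnW.
have -> : rdot (J (zV t)) (J (zV t)) = n%:R^-1 *
    \sum_k \sum_l \int[P]_w dotv (row k (rval (zV t) w)) (row l (rval (zV t) w)).
  transitivity (\int[P]_w (n%:R^-1 *
      \sum_k \sum_l dotv (row k (rval (zV t) w)) (row l (rval (zV t) w)))).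
    by apply: eq_Rintegral => w _; rewrite !rmulLE mdot_mean_pairs.
  have iS k : P.-integrable setT (EFin \o (fun w =>
      \sum_l dotv (row k (rval (zV t) w)) (row l (rval (zV t) w)))).
    by apply: integrable_big => l; exact: dotv_row_integrable.
  rewrite RintegralZl //; last exact: integrable_big.
  rewrite Rintegral_big //; congr (_ * _); apply: eq_bigr => k _.
  by rewrite Rintegral_big // => l; exact: dotv_row_integrable.
rewrite ler_pdivrMl //.
have -> : n%:R * sigma ^+ 2 = \sum_(k < n) sigma ^+ 2.
  by rewrite big_const card_ord iter_addr addr0 mulr_natl.
apply: ler_sum => k _; rewrite (bigD1 k) //= big1 ?addr0; first exact: row_noise_var.
by move=> l lk; rewrite noise_pair_orth // eq_sym.
Qed.

Lemma comp_noise_var k : rdot (eV k) (eV k) <=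
  C * rdot (yV k - HV k) (yV k - HV k).
Proof.
rewrite !rdot_rows mulr_sumr; apply: ler_sum => i _.
have kyH := known_yH k.
have mrow := mx_measurable_row (Fc_sub fil k.+1).1 i kyH.2.
have iy := known_row_sq i kyH.
have [_] := cond_exp_le_integral (Fc_sub fil k.+1) (comp_var cpa i mrow iy)
  (integrable_scale C iy).
rewrite RintegralZl // => h.
have -> : \int[P]_w dotv (row i (rval (eV k) w)) (row i (rval (eV k) w)) =
  \int[P]_w fnorm (comp (theta k.+1 i w) (row i (y_raw k w - H_raw k w))
     - row i (y_raw k w - H_raw k w)) ^+ 2.
  by apply: eq_Rintegral => w _; rewrite -fnorm_row rval_e row_comp_noise.
apply: (le_trans h); rewrite le_eqVlt; apply/orP; left; apply/eqP; congr (_ * _).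
apply: eq_Rintegral => w _; rewrite fnorm_row.
by change (rval (yV k - HV k) w) with (rval (yV k) w - rval (HV k) w);
  rewrite rval_y rval_H.
Qed.

Lemma rnoise : cedas_noise (@rdot R d T P n p) J C (sigma ^+ 2) n%:R (fun k => zV k.+1) HV yV eV
  (fun k => info (Fs k.+1)) (fun k => info (Fc k.+1)).
Proof.
split=> k.
- by move=> v; exact: noise_orth.
- move=> v hv; apply: (info_orth (Fc_sub fil k.+1) hv) => i j.
  by rewrite rval_e; exact: comp_noise_vanishes.
- exact: noise_var.
- exact: mean_noise_var.
- exact: comp_noise_var.
Qed.

Variables (link : rel 'I_n) (lam : n.-tuple R).
Hypothesis net : network_assumption link W lam.
Hypothesis lb : has_lbound (range (avg_fun f)).

Definition phi t : R := \int[P]_w avg_fun f (row_mean (rval (xV t) w)).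

(** Neither the dual variable nor the compression moves the mean, since the
    averaging kills [M]. *)
Lemma row_mean_next t w : row_mean (rval (xV t.+1) w) =
  row_mean (rval (xV t) w) - eta *: row_mean (rval (gF (xV t) + zV t) w).
Proof.
rewrite -scaleNr -(row_meanZ n_ge2) -(row_meanD n_ge2) scaleNr.
change (row_mean (rval (xV t.+1) w) = row_mean (rval (xV t) w
  - eta *: (grads f (rval (xV t) w) + rval (zV t) w))).
rewrite !rval_x rval_z; case: t => [|k]; first by rewrite x1E.
rewrite x_next /y_raw DE.
set a := _ - eta *: _.
have M0 A : row_mean (Mx *m A) = 0.
  by apply: (row_mean_eq0 n_ge2); rewrite mulmxA (mean_mix_mx net) mul0mx.
by rewrite !(row_meanB n_ge2) !M0 !subr0.
Qed.

Lemma rdescends t : descends (@rdot R d T P n p) J gF L eta n%:R (xV t) (zV t)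
  (phi t) (phi t.+1).
Proof. exact: mean_descent n_ge2 L_gt0 lip lb _ _ _ _ (row_mean_next t). Qed.

Lemma rstart : cedas_start (@rdot R d T P n p) J gF L eta (sigma ^+ 2) n%:R
  (fun k => xV k.+1) (fun k => zV k.+1) UV (xV 0) (zV 0) phi
  (inf (range (avg_fun f))).
Proof.
have x0 : info (Fs 0) (xV 0) by rewrite /rinfo rval_x; case: known_x0.
have [_ _ _ infJ _ infG] := infoP P L_gt0 lip Mx (mean_mx R n) 0 (Fs_sub fil 0).1.
split.
- apply: rval_inj => w.
  change (rval (xV 1) w = rval (xV 0) w
    - eta *: (grads f (rval (xV 0) w) + rval (zV 0) w)).
  by rewrite !rval_x rval_z x1E.
- by apply: rval_inj => w; rewrite rval_U.
- move=> v [] ->; apply: noise_orth; apply: (infJ); apply: (infG) => //.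
  exact: infJ.
- exact: noise_var.
- exact: mean_noise_var.
- exact: rdescends.
- by move=> k; exact: rdescends.
- by move=> k; exact: (avg_mean_lower n_ge2 L_gt0 lip lb (xV k)).
Qed.

Lemma expected_gradient t :
  ('E_P[fun w => (fnorm (grad (avg_fun f) (row_mean (x t w))) ^+ 2)%R])%E =
  (n%:R^-1 * rdot (J (gF (J (xV t)))) (J (gF (J (xV t)))))%:E.
Proof.
have n0 : (n%:R : R) != 0 by rewrite pnatr_eq0 -lt0n ltnW.
set Y := J (gF (J (xV t))).
have E w : fnorm (grad (avg_fun f) (row_mean (x t w))) ^+ 2 =
    n%:R^-1 * mdot (rval Y w) (rval Y w).
  change (rval Y w) with (mean_mx R n *m grads f (mean_mx R n *m rval (xV t) w)).
  rewrite rval_x mdot_mean (row_mean_grads (fun i => (lip i).1)).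
  by rewrite mulKf // fnorm_row.
rewrite unlock (_ : (fun w => _) = EFin \o (fun w => n%:R^-1 * mdot (rval Y w) (rval Y w)));
  last by apply/funext => w /=; rewrite E.
rewrite /rdot -RintegralZl //; last exact: mdot_integrable.
rewrite /Rintegral fineK //.
have := integrable_fin_num measurableT (integrable_scale n%:R^-1 (mdot_integrable Y Y)).
exact.
Qed.

Lemma rdot_cst (X : V) A : (forall w, rval X w = A) -> rdot X X = fnorm A ^+ 2.
Proof.
move=> h; rewrite /rdot (@eq_Rintegral _ _ _ P setT (cst (mdot A A))); last first.
  by move=> w _; rewrite h.
rewrite Rintegral_cst // [fine _](_ : _ = 1);
  last exact: (congr1 fine (probability_setT P)).
by rewrite mulr1 fnorm_mdot.
Qed.

Lemma phi0 : phi 0 = avg_fun f (row_mean xm1).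
Proof.
rewrite /phi (@eq_Rintegral _ _ _ P setT (cst (avg_fun f (row_mean xm1)))); last first.
  by move=> w _; rewrite rval_x.
rewrite Rintegral_cst // [fine _](_ : _ = 1);
  last exact: (congr1 fine (probability_setT P)).
by rewrite mulr1.
Qed.

(** The abstract bound of [descent_sum], with the initial quantities, which are
    deterministic, written out. *)
Theorem expected_gradient_sum g delta m : 0 < gamma -> g = gamma / 2 * (1 - lam`_1) ->
  cedas_parameters (gamma / 2) g L eta alpha C (sigma ^+ 2) n%:R delta ->
  (\sum_(t < m.+1)
     'E_P[fun w => (fnorm (grad (avg_fun f) (row_mean (x t w))) ^+ 2)%R] <=
  (n%:R^-1 *
  (2 * (n%:R * (avg_fun f (row_mean xm1) - inf (range (avg_fun f)))) / eta
  + 200 * L ^+ 2 / g ^+ 2 * (eta ^+ 2 * fnorm (grads f xm1) ^+ 2)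
  + 200 * L ^+ 2 / g * (fnorm xm1 ^+ 2 + fnorm H0 ^+ 2)
  + 600 * L ^+ 2 / g * (m.+1%:R * (eta ^+ 2 * (n%:R * sigma ^+ 2)))
  + L * eta * sigma ^+ 2 * m.+1%:R))%:E)%E.
Proof.
move=> gamma0 gE par.
have b0 : 0 < gamma / 2 by rewrite divr_gt0.
under eq_bigr do rewrite expected_gradient.
rewrite sumEFin lee_fin -mulr_sumr ler_wpM2l ?invr_ge0 // big_ord_recl.
have := @rmixing R d T P n p link W lam net n_ge2 _ b0; rewrite -gE => mix.
have := descent_sum (@rdot_semi_inner R d T P n p) mix (rgrad_lip (P := P) L_gt0 lip)
  par rdynamics rinformation rnoise rstart m.
have -> : rdot (gF (xV 0)) (gF (xV 0)) = fnorm (grads f xm1) ^+ 2.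
  apply: rdot_cst => w.
  by change (grads f (rval (xV 0) w) = grads f xm1); rewrite rval_x.
have -> : rdot (xV 0) (xV 0) = fnorm xm1 ^+ 2.
  by apply: rdot_cst => w; rewrite rval_x.
have -> : rdot (HV 0) (HV 0) = fnorm H0 ^+ 2.
  by apply: rdot_cst => w; rewrite rval_H.
by rewrite phi0.
Qed.

End Process.

(** * The convergence rate of CEDAS *)

Lemma cedas_parameters_of_bounds (R : realFieldType) (L q alpha gamma delta C s2 nn : R) :
  0 < L -> 0 <= s2 -> 1 <= nn -> 0 < C -> 0 < alpha -> 0 < gamma ->
  0 < delta <= 1 -> 0 <= q ->
  gamma <= 2^-1 -> gamma <= alpha ^+ 2 * delta / (15872 * C) ->
  alpha <= (4 * (C + 1))^-1 ->
  cedas_parameters (gamma / 2) (gamma / 2 * delta) L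
    (q + 16 * L / (gamma / 2 * delta))^-1 alpha C s2 nn delta.
Proof.
move=> L0 s0 n1 C0 a0 g0 /andP[d0 d1] q0 g1 g2 a1.
have gd0 : 0 < gamma / 2 * delta by rewrite mulr_gt0 // divr_gt0.
have C40 : 0 < 4 * (C + 1) by rewrite mulr_gt0 // ltr_wpDl // ltW.
have a2 : alpha * (4 * (C + 1)) <= 1 by rewrite -ler_pdivlMr // mul1r.
have aC : 0 < alpha * C by rewrite mulr_gt0.
have num : (100 * 100 : R) <= 15872 by rewrite -natrM ler_nat.
(* only [10000 <= 15872] matters, so the numeral is replaced by a variable *)
have [k [num' g3]] : exists k : R, 100 * 100 <= k /\ gamma <= alpha ^+ 2 * delta / (k * C).
  by exists 15872.
have k0 : 0 < k by apply: lt_le_trans num'; rewrite mulr_gt0 // ltr0n.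
have gC : 100 * (100 * (gamma * C)) <= alpha ^+ 2 * delta.
  apply: (@le_trans _ _ (gamma * (k * C))); last by rewrite -ler_pdivlMr // mulr_gt0.
  by rewrite mulrA [leRHS]mulrCA ler_wpM2r // mulr_ge0 // ltW.
clear num num' g2 g3.
have eL : 0 < 16 * L / (gamma / 2 * delta) by rewrite divr_gt0 // mulr_gt0.
have r0 : 0 < q + 16 * L / (gamma / 2 * delta) by rewrite ltr_wpDl.
split => //.
- lra.
- by apply/andP.
- by apply/andP; split => //; lra.
- lra.
- have : 0 < gamma * C by rewrite mulr_gt0.
  have -> : gamma / 2 * C = 2^-1 * (gamma * C) by ring.
  lra.
- by rewrite invr_gt0.
- rewrite mulrA ler_pdivrMr // mulrDr [X in _ + X]mulrC divfK ?gt_eqF //.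
  by rewrite lerDr mulr_ge0 // ltW.
Qed.

Theorem corollary1 (R : realType) (L sigma Delta0 : R)
    (L_gt0 : 0 < L) (sigma_gt0 : 0 < sigma) (Delta0_gt0 : 0 < Delta0) :
  exists M : R,
  forall (n p K : nat) (n_ge2 : (2 <= n)%N) (K_gt0 : (0 < K)%N)
    (link : rel 'I_n) (W : 'M[R]_n) (lam : n.-tuple R)
    (f : 'I_n -> 'rV[R]_p -> R)
    (d : measure_display) (T : measurableType d) (P : probability T R)
    (dX : measure_display) (Xi : measurableType dX)
    (dT : measure_display) (Theta : measurableType dT)
    (oracle : 'I_n -> 'rV[R]_p -> Xi -> 'rV[R]_p)
    (comp : Theta -> 'rV[R]_p -> 'rV[R]_p)
    (xi : nat -> 'I_n -> T -> Xi) (theta : nat -> 'I_n -> T -> Theta)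
    (Fs Fc : nat -> set (set T))
    (xm1 H0 : 'M[R]_(n, p)) (C alpha gamma : R),
  let lambda2 := lam`_1 in
  let gap := 1 - lambda_tilde2 gamma lambda2 in
  let eta := (Num.sqrt (L * sigma ^+ 2 * K%:R / (n%:R * Delta0))
              + 32 * L / (gamma * (1 - lambda2)))^-1 in
  let x := cedas_process W alpha gamma (fun=> eta) oracle comp xi theta
             xm1 H0 in
  network_assumption link W lam ->
  (forall i, lipschitz_gradient L (f i)) ->
  has_lbound (range (avg_fun f)) ->
  cedas_filtration xi theta Fs Fc ->
  stochastic_gradient_assumption P f oracle xi Fs x sigma ->
  0 < C ->
  unbiased_compressor_assumption P comp theta Fc C ->
  0 < alpha ->
  0 < gamma ->
  gamma <= Num.min (2^-1)
             (Num.min (alpha ^+ 2 * (1 - lambda2) / (15872 * C)) (alpha / 2)) ->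
  alpha <= (4 * (C + 1))^-1 ->
  Delta0 = avg_fun f (row_mean xm1) - inf (range (avg_fun f)) ->
  ((K%:R^-1)%:E *
     \sum_(t < K)
       'E_P[fun w => (fnorm (grad (avg_fun f) (row_mean (x t w))) ^+ 2)%R]
   <= (M * (1 / Num.sqrt (n%:R * K%:R)
            + n%:R / (gap * K%:R)
            + (fnorm xm1 ^+ 2 + fnorm H0 ^+ 2) / (n%:R * gap * K%:R)
            + fnorm (rowwise (fun i => grad (f i)) xm1) ^+ 2
              / (gap ^+ 2 * K%:R ^+ 2)))%:E)%E.
Proof.
exists (rate_constant L sigma Delta0).
move=> n p K n_ge2 K_gt0 link W lam f d T P dX Xi dT Theta oracle comp xi theta Fs Fc
  xm1 H0 C alpha gamma lambda2 gap eta x net lip lb fil sga C_gt0 cpa alpha_gt0 gamma_gt0.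
rewrite !le_min => /and3P[gamma1 gamma2 _] alpha1 Delta0E.
have delta_bounds : 0 < 1 - lambda2 <= 1.
  rewrite subr_gt0 (eig_second net) /= lerBlDr lerDl.
  by apply: (eig_ge0 net); apply: mem_nth; rewrite size_tuple.
have /andP[delta_gt0 _] := delta_bounds.
have n_ge1 : 1 <= (n%:R : R) by rewrite ler1n ltnW.
have gapE : gap = gamma / 2 * (1 - lambda2) by rewrite /gap /lambda_tilde2; ring.
have gap_gt0 : 0 < gap by rewrite gapE mulr_gt0 // divr_gt0.
have etaE : eta = (Num.sqrt (L * sigma ^+ 2 * K%:R / (n%:R * Delta0)) + 16 * L / gap)^-1.
  rewrite /eta gapE; congr (_ + _)^-1; field.
  by rewrite !gt_eqF.
have par := cedas_parameters_of_bounds L_gt0 (sqr_ge0 sigma) n_ge1 C_gt0 alpha_gt0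
  gamma_gt0 delta_bounds (sqrtr_ge0 (L * sigma ^+ 2 * K%:R / (n%:R * Delta0)))
  gamma1 gamma2 alpha1.
rewrite -gapE -etaE in par.
have hS := expected_gradient_sum L_gt0 lip fil sga cpa n_ge2 net lb K.-1 gamma_gt0
  gapE par.
rewrite (prednK K_gt0) -Delta0E in hS.
have KV : (0 <= (K%:R^-1 : R)%:E)%E by rewrite lee_fin invr_ge0.
apply: (le_trans (lee_wpmul2l KV hS)).
rewrite -EFinM lee_fin.
have K0 : 0 < (K%:R : R) by rewrite ltr0n.
apply: (rate_of_sum L_gt0 sigma_gt0 Delta0_gt0 n_ge1 K0 gap_gt0).
- by rewrite addr_ge0 ?sqr_ge0.
- exact: sqr_ge0.
- by rewrite -etaE.
Qed.
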